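(* For all $C\geq 1$, the $C$-strongly Leibniz propinquity $\mathsf{\Lambda}^\ast_{SL_C}$ is a metric, up to full quantum isometry, on the class $\mathcal{SL}_C$ of all $C$-strongly Leibniz quantum compact metric spaces (that is, it is finite, symmetric, satisfies the triangle inequality, and is zero between two elements of $\mathcal{SL}_C$ if and only if there is a full quantum isometry between them).
   Context: For a unital C*-algebra $\mathfrak A$: $\mathfrak{sa}(\mathfrak A)$ is the set of self-adjoint elements, $\mathrm{GL}(\mathfrak A)$ the group of invertible elements, $\mathscr S(\mathfrak A)$ the state space. Quantum compact metric space. Fix once and for all constants $A\geq 1$ and $B\geq 0$. A quantum compact metric space $(\mathfrak A,\mathsf L)$ is a unital C*-algebra $\mathfrak A$ with a seminorm $\mathsf L$ defined on a dense Jordan-Lie subalgebra $\mathrm{dom}(\mathsf L)$ of $\mathfrak{sa}(\mathfrak A)$ (a real subspace closed under $(ab+ba)/2$ and $(ab-ba)/(2i)$) such that: (1) $\{a\in\mathrm{dom}(\mathsf L):\mathsf L(a)=0\}=\mathbb R 1_{\mathfrak A}$; (2) the distance $\mathsf{mk}_{\mathsf L}(\varphi,\psi)=\sup\{|\varphi(a)-\psi(a)|:a\in\mathrm{dom}(\mathsf L),\ \mathsf L(a)\leq 1\}$ metrizes the weak* topology of $\mathscr S(\mathfrak A)$; (3) for all $a,b\in\mathrm{dom}(\mathsf L)$, $\max\{\mathsf L(\frac{ab+ba}{2}),\mathsf L(\frac{ab-ba}{2i})\}\leq A(\mathsf L(a)\|b\|_{\mathfrak A}+\|a\|_{\mathfrak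 A}\mathsf L(b))+B\,\mathsf L(a)\mathsf L(b)$; (4) $\{a\in\mathrm{dom}(\mathsf L):\mathsf L(a)\leq 1\}$ is closed in $\mathfrak A$. Such an $\mathsf L$ is called an L-seminorm. For $C\geq 1$, $(\mathfrak A,\mathsf L)$ is $C$-strongly Leibniz if for all $a\in\mathrm{dom}(\mathsf L)\cap\mathrm{GL}(\mathfrak A)$ one has $a^{-1}\in\mathrm{dom}(\mathsf L)$ and $\mathsf L(a^{-1})\leq C\|a^{-1}\|_{\mathfrak A}^2\mathsf L(a)$. $\mathcal{SL}_C$ is the class of all $C$-strongly Leibniz quantum compact metric spaces. A quantum isometry $\pi:(\mathfrak A,\mathsf L_{\mathfrak A})\to(\mathfrak B,\mathsf L_{\mathfrak B})$ is a surjective *-morphism $\pi:\mathfrak A\to\mathfrak B$ with $\pi(\mathrm{dom}(\mathsf L_{\mathfrak A}))\subseteq\mathrm{dom}(\mathsf L_{\mathfrak B})$ and $\mathsf L_{\mathfrak B}(b)=\inf\{\mathsf L_{\mathfrak A}(a):a\in\mathrm{dom}(\mathsf L_{\mathfrak A}),\pi(a)=b\}$ for all $b\in\mathrm{dom}(\mathsf L_{\mathfrak B})$. A full quantum isometry is a quantum isometry $\pi$ which is a *-isomorphism and such that $\pi^{-1}$ is also a quantum isometry. A tunnel $\tau=(\mathfrak D,\mathsf L_{\mathfrak D},\pi_1,\pi_2)$ from $(\mathfrak A_1,\mathsf L_1)$ to $(\mathfrak A_2,\mathsf L_2)$ is a quantum compact metric space $(\mathfrak D,\mathsf L_{\mathfrak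 D})$ with quantum isometries $\pi_j:(\mathfrak D,\mathsf L_{\mathfrak D})\to(\mathfrak A_j,\mathsf L_j)$, $j=1,2$. Its extent is $\chi(\tau)=\max_{j\in\{1,2\}}\mathsf{Haus}_{\mathsf{mk}_{\mathsf L_{\mathfrak D}}}(\mathscr S(\mathfrak D),\{\varphi\circ\pi_j:\varphi\in\mathscr S(\mathfrak A_j)\})$, where $\mathsf{Haus}$ is the Hausdorff distance. For $(\mathfrak A_1,\mathsf L_1),(\mathfrak A_2,\mathsf L_2)\in\mathcal{SL}_C$, $\mathsf{\Lambda}^\ast_{SL_C}((\mathfrak A_1,\mathsf L_1),(\mathfrak A_2,\mathsf L_2))$ is the infimum of $\chi(\tau)$ over all tunnels $\tau=(\mathfrak D,\mathsf L_{\mathfrak D},\pi_1,\pi_2)$ from $(\mathfrak A_1,\mathsf L_1)$ to $(\mathfrak A_2,\mathsf L_2)$ with $(\mathfrak D,\mathsf L_{\mathfrak D})\in\mathcal{SL}_C$. *)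

(* Defs.v *)
From HB Require Import structures.
From mathcomp Require Import all_boot all_order all_algebra.
From mathcomp Require Import complex.
From mathcomp Require Import all_classical all_reals all_analysis.

Set Implicit Arguments.
Unset Strict Implicit.
Unset Printing Implicit Defensive.

Import Order.TTheory GRing.Theory Num.Theory.
Import numFieldNormedType.Exports.

Local Open Scope classical_set_scope.
Local Open Scope complex_scope.
Local Open Scope ring_scope.

(* Unital C*-algebras.  The hierarchy has no structure joining rings and normed
   modules, so multiplication is axiomatized here on top of normed modules, and
   the [GRing] algebra structure is derived from it just below.  The zero algebra,
   which has no state, is excluded.  The norm of a normed module over [R[i]] takes
   its values in [R[i]]; see [rnorm] below. *)
HB.mixin Record isCStar (R : realType) A & CompleteNormedModule R[i] A := {
  cone : A ;
  cmul : A -> A -> A ;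
  star : A -> A ;
  cmulA : associative cmul ;
  cmul1l : left_id cone cmul ;
  cmul1r : right_id cone cmul ;
  cmulDl : left_distributive cmul +%R ;
  cmulDr : right_distributive cmul +%R ;
  cone_neq0 : cone != 0 ;
  cscaleAl : forall (c : R[i]) (a b : A), c *: cmul a b = cmul (c *: a) b ;
  cscaleAr : forall (c : R[i]) (a b : A), c *: cmul a b = cmul a (c *: b) ;
  starK : involutive star ;
  star_semilinear : forall (c : R[i]) (a b : A),
    star (c *: a + b) = c^* *: star a + star b ;
  starM : forall a b : A, star (cmul a b) = cmul (star b) (star a) ;
  cstar_normM : forall a b : A, `|cmul a b| <= `|a| * `|b| ;
  cstar_norm : forall a : A, `|cmul (star a) a| = `|a| ^+ 2
}.

#[short(type="cstarAlgType")]
HB.structure Definition CStarAlgebra (R : realType) :=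
  {A of isCStar R A & CompleteNormedModule R[i] A}.

#[non_forgetful_inheritance]
HB.instance Definition _ (R : realType) (A : cstarAlgType R) :=
  GRing.Zmodule_isNzRing.Build (CStarAlgebra.sort A)
    cmulA cmul1l cmul1r cmulDl cmulDr cone_neq0.

#[non_forgetful_inheritance]
HB.instance Definition _ (R : realType) (A : cstarAlgType R) :=
  GRing.Lmodule_isLalgebra.Build R[i] (CStarAlgebra.sort A) cscaleAl.

#[non_forgetful_inheritance]
HB.instance Definition _ (R : realType) (A : cstarAlgType R) :=
  GRing.Lalgebra_isAlgebra.Build R[i] (CStarAlgebra.sort A) cscaleAr.

(* The norm is a nonnegative real of [R[i]]: taking the real part loses nothing. *)
Definition rnorm (R : realType) (V : normedZmodType R[i]) (v : V) : R :=
  complex.Re `|v|.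

Section CStarNotions.
Context {R : realType}.
Implicit Types A : cstarAlgType R.

Definition self_adjoint A : set A := [set a | star a = a].

Definition jordan A (a b : A) : A := (2 : R[i])^-1 *: (a * b + b * a).

Definition lie A (a b : A) : A := (2 * 'i : R[i])^-1 *: (a * b - b * a).

(* [0 <= z] in [R[i]] means that [z] is real and nonnegative. *)
Definition state_space A : set (A -> R[i]) :=
  [set phi | [/\ linear (phi : A -> R[i]^o),
                 phi 1 = 1 &
                 forall a : A, 0 <= phi (star a * a)]].

Definition star_morphism A1 A2 (f : {lrmorphism A1 -> A2}) : Prop :=
  forall a : A1, f (star a) = star (f a).

End CStarNotions.

Arguments self_adjoint {R} A.
Arguments state_space {R} A.

(* [d] is a (finite) metric on [S] which induces the topology that [S] inherits
   from [T]. *)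
Definition metrizes {R : realType} {T : topologicalType} (S : set T)
    (d : T -> T -> \bar R) : Prop :=
  [/\ (forall x y, S x -> S y -> 0 <= d x y < +oo)%E,
      (forall x y, S x -> S y -> d x y = 0%E <-> x = y),
      (forall x y, S x -> S y -> d x y = d y x),
      (forall x y z, S x -> S y -> S z -> d x z <= d x y + d y z)%E &
      forall x, S x -> forall U : set T,
        within S (nbhs x) U <->
        exists2 e : R, 0 < e & forall y, S y -> (d x y < e%:E)%E -> U y].

Definition hausdorff_dist {R : realType} {T : Type} (d : T -> T -> \bar R)
    (X Y : set T) : \bar R :=
  maxe (ereal_sup [set ereal_inf [set d x y | y in Y] | x in X])
       (ereal_sup [set ereal_inf [set d x y | x in X] | y in Y]).

Definition mk_dist {R : realType} {A : cstarAlgType R} (dom : set A)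
    (L : A -> R) (phi psi : A -> R[i]) : \bar R :=
  ereal_sup [set (rnorm (phi a - psi a))%:E | a in [set a | dom a /\ L a <= 1]].

(* The seminorm is a total function [L], of which only the values on [dom]
   matter. *)
Record is_Lseminorm {R : realType} (KA KB : R) (A : cstarAlgType R)
    (dom : set A) (L : A -> R) : Prop := {
  dom_sa : dom `<=` self_adjoint A ;
  dom_dense : self_adjoint A `<=` closure dom ;
  dom_add : forall a b, dom a -> dom b -> dom (a + b) ;
  dom_scale : forall (t : R) a, dom a -> dom (t%:C *: a) ;
  dom_jordan : forall a b, dom a -> dom b -> dom (jordan a b) ;
  dom_lie : forall a b, dom a -> dom b -> dom (lie a b) ;
  L_ge0 : forall a, dom a -> 0 <= L a ;
  L_add : forall a b, dom a -> dom b -> L (a + b) <= L a + L b ;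
  L_scale : forall (t : R) a, dom a -> L (t%:C *: a) = `|t| * L a ;
  L_eq0 : [set a | dom a /\ L a = 0] = [set t%:C *: (1 : A) | t in [set: R]] ;
  (* the weak* topology is that of pointwise convergence *)
  L_mk : metrizes (state_space A : set {ptws A -> R[i]^o}) (mk_dist dom L) ;
  L_leibniz : forall a b, dom a -> dom b ->
    Num.max (L (jordan a b)) (L (lie a b)) <=
      KA * (L a * rnorm b + rnorm a * L b) + KB * (L a * L b) ;
  L_closed : closed [set a | dom a /\ L a <= 1]
}.

Record qcms (R : realType) (KA KB : R) := QCMS {
  qcms_alg :> cstarAlgType R ;
  lip_dom : set qcms_alg ;
  lip : qcms_alg -> R ;
  lipP : is_Lseminorm KA KB lip_dom lip
}.

Arguments lip_dom {R KA KB} q.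
Arguments lip {R KA KB} q.

Section Propinquity.
Context {R : realType} {KA KB : R}.
Implicit Types X Y : qcms KA KB.

Definition mk X : (X -> R[i]) -> (X -> R[i]) -> \bar R :=
  mk_dist (lip_dom X) (lip X).

(* [b] ranges over the inverse of [a], for [a] invertible. *)
Definition strongly_leibniz (C : R) X : Prop :=
  forall a b : X, lip_dom X a -> a * b = 1 -> b * a = 1 ->
    lip_dom X b /\ lip X b <= C * rnorm b ^+ 2 * lip X a.

(* The infimum is taken in [\bar R], where that of the empty set is [+oo]. *)
Definition quantum_isometry X Y (f : {lrmorphism X -> Y}) : Prop :=
  [/\ star_morphism f,
      (forall y : Y, exists x : X, f x = y),
      (forall x : X, lip_dom X x -> lip_dom Y (f x)) &
      forall y : Y, lip_dom Y y ->
        (lip Y y)%:E =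
        ereal_inf [set (lip X x)%:E | x in [set x | lip_dom X x /\ f x = y]]].

Definition full_quantum_isometry X Y (f : {lrmorphism X -> Y}) : Prop :=
  quantum_isometry f /\
  exists g : {lrmorphism Y -> X},
    [/\ cancel f g, cancel g f & quantum_isometry g].

Record tunnel X1 X2 := Tunnel {
  tun_space : qcms KA KB ;
  tun_pi1 : {lrmorphism tun_space -> X1} ;
  tun_pi2 : {lrmorphism tun_space -> X2} ;
  tun_pi1P : quantum_isometry tun_pi1 ;
  tun_pi2P : quantum_isometry tun_pi2
}.

Definition pullback_states X Y (f : {lrmorphism X -> Y}) : set (X -> R[i]) :=
  [set phi \o f | phi in state_space Y].

Definition extent X1 X2 (t : tunnel X1 X2) : \bar R :=
  maxe (hausdorff_dist (@mk (tun_space t)) (state_space (tun_space t))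
          (pullback_states (tun_pi1 t)))
       (hausdorff_dist (@mk (tun_space t)) (state_space (tun_space t))
          (pullback_states (tun_pi2 t))).

Definition propinquity (C : R) X1 X2 : \bar R :=
  ereal_inf [set x : \bar R | exists t : tunnel X1 X2,
    strongly_leibniz C (tun_space t) /\ x = extent t].

End Propinquity.

(* Main.v *)
(* All the compactness comes from Rieffel's characterization: the Monge-Kantorovich
   distance metrizes the weak* topology of the state space if and only if the
   elements [a] with [L a <= 1] and [`|a| <= r] form a compact set and
   [L a <= 1] bounds [a] modulo the scalars.  It relies on the existence of a state
   [phi] with [`|phi h| = `|h|] for [h] self-adjoint, hence on the positivity of
   [a^* a].

   Two quantum compact metric spaces are glued into a direct sum with the seminorm
   [max (L_1 a) (L_2 b) (N a b)], where [N] behaves like the derivation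
   [`|a m - m b|] into a bimodule and is therefore Leibniz and strongly Leibniz.
     For
   tunnels through [Y], [N a b = `|pi_2 a - rho_1 b| / k] gives the triangle
   inequality; for arbitrary [X] and [Y], the functional [m = phi (x)
     psi] on [X * Y]
   gives a tunnel, whose extent is finite.

   If the propinquity is zero, take tunnels [D_n] with extents tending to [0] and an
   ultrafilter on the indices.  The limits of the images of bounded sequences
   [d_n] of [D_n] in [X] and [Y] form the graph of the isomorphism: it is
   single-valued because the norm of [d_n] is controlled by that of its image in
   [X] up to [L (d_n)] times the extent, and total by compactness. *)
Require Import Defs.
From HB Require Import structures.
From mathcomp Require Import all_boot all_order all_algebra.
From mathcomp Require Import complex ring lra.
From mathcomp Require Import all_classical all_reals all_analysis.

Set Implicit Arguments.
Unset Strict Implicit.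
Unset Printing Implicit Defensive.

Import Order.TTheory GRing.Theory Num.Theory.
Import numFieldNormedType.Exports.

Local Open Scope classical_set_scope.
Local Open Scope complex_scope.
Local Open Scope ring_scope.

Local Notation "t %:S" := (t%:C%:A) (at level 1, format "t %:S").

(** Every tunnel has to be [C]-strongly Leibniz itself, so that each space built on the way must
    control inverses as well as brackets. Derivations do both: [a^-1 m - m b^-1 = - a^-1 (a m - m b)
    b^-1] bounds inverses with constant 1, the product rule bounds brackets with constant 1, and
    these constants are admissible because [1 <= C] and [1 <= KA].

    C*-algebra theory is developed without functional calculus. Positivity is the norm condition
    [|t - h| <= t], square roots and inverses are fixed points of contractions, and a bicommutant
    condition keeps track of what commutes.

    In the coincidence property the algebras change with [n], so convergence is visible only in the
    two ends. Seminorms live on self-adjoint elements; a general element is bounded through its real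
    and imaginary parts, and the Jordan and Lie brackets keep such bounds stable under products. The
    bounds may grow as the precision improves, which lets the graph reach non-Lipschitz elements.
    The swapped tunnels, taken along the same ultrafilter, provide the inverse map. *)

Inductive zterm := ZVar of nat | ZZero | ZAdd of zterm & zterm | ZOpp of zterm.

Fixpoint zeval {V : zmodType} (env : seq V) (e : zterm) : V :=
  match e with
  | ZVar n => env`_n
  | ZZero => 0
  | ZAdd e1 e2 => zeval env e1 + zeval env e2
  | ZOpp e1 => - zeval env e1
  end.

Fixpoint zcoef (e : zterm) (n : nat) : int :=
  match e with
  | ZVar m => (m == n)%:Z
  | ZZero => 0
  | ZAdd e1 e2 => zcoef e1 n + zcoef e2 n
  | ZOpp e1 => - zcoef e1 n
  end.

(** An expression evaluates to the integer combination of its atoms, so comparing coefficients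
    suffices, and this comparison is a computation. *)
Lemma zeval_eq {V : zmodType} (env : seq V) (e1 e2 : zterm) :
  all (fun n => zcoef e1 n == zcoef e2 n) (iota 0 (size env)) ->
  zeval env e1 = zeval env e2.
Proof.
have H e : zeval env e = \sum_(i < size env) env`_i *~ zcoef e i.
  elim: e => [n||e IH e' IH'|e IH] /=.
  - have [ns|sn] := ltnP n (size env); last first.
      rewrite nth_default// big1// => i _; rewrite (_ : (n == i) = false) ?mulr0z//.
      by apply/negbTE; rewrite gtn_eqF// (leq_trans (ltn_ord i)).
    rewrite (bigD1 (Ordinal ns))//= eqxx mulr1z big1 ?addr0// => i /eqP ni.
    by case: eqP => [nE|]; rewrite ?mulr0z//; case: ni; apply/val_inj.
  - by rewrite big1// => i _; rewrite mulr0z.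
  - by rewrite IH IH' -big_split; apply: eq_bigr => i _; rewrite mulrzDr.
  - by rewrite IH -sumrN; apply: eq_bigr => i _; rewrite mulrNz.
move=> /allP e12; rewrite !H; apply: eq_bigr => i _; congr (_ *~ _).
by apply/eqP/e12; rewrite mem_iota /=.
Qed.

(* Atoms are compared up to conversion: rewriting leaves several instances of
   the same operation in a goal. *)
Ltac zindex x env :=
  lazymatch env with
  | ?y :: ?env' =>
      match goal with
      | _ => let _ := match goal with _ => unify x y end in constr:(O)
      | _ => let n := zindex x env' in constr:(S n)
      end
  end.

Ltac zatoms t env :=
  lazymatch t with
  | (?a + ?b)%R => let env' := zatoms a env in zatoms b env'
  | (- ?a)%R => zatoms a env
  | 0%R => env
  | _ => match goal with
         | _ => let n := zindex t env in env
         | _ => constr:(t :: env)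
         end
  end.

Ltac zquote t env :=
  lazymatch t with
  | (?a + ?b)%R =>
      let e1 := zquote a env in let e2 := zquote b env in constr:(ZAdd e1 e2)
  | (- ?a)%R => let e := zquote a env in constr:(ZOpp e)
  | 0%R => constr:(ZZero)
  | _ => let n := zindex t env in constr:(ZVar n)
  end.

(* Decides equalities that hold in every abelian group, [ring] being unavailable
   in noncommutative rings. *)
Ltac zmod :=
  lazymatch goal with
  | |- @eq ?T ?l ?r =>
      let env := zatoms l (@nil T) in
      let env := zatoms r env in
      let e1 := zquote l env in let e2 := zquote r env in
      exact: (@zeval_eq _ env e1 e2 isT)
  end.

Ltac ncring :=
  rewrite ?(mulrDl, mulrDr, mulrN, mulNr, mulr1, mul1r, mulrA); zmod.

(** * The norm as a real number *)

Section RealNorm.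
Context {R : realType} {V : normedModType R[i]}.
Implicit Types u v w : V.

Lemma rnormE v : (rnorm v)%:C = `|v|.
Proof. by rewrite /rnorm RRe_real ?normr_real. Qed.

Lemma rnorm_ge0 v : 0 <= rnorm v.
Proof. by rewrite -lecR rnormE normr_ge0. Qed.

Lemma rnorm0 : rnorm (0 : V) = 0.
Proof. by apply: complexI; rewrite rnormE normr0. Qed.

Lemma rnorm_eq0 v : rnorm v = 0 -> v = 0.
Proof. by move=> v0; apply/normr0_eq0; rewrite -rnormE v0. Qed.

Lemma rnormN v : rnorm (- v) = rnorm v.
Proof. by rewrite /rnorm normrN. Qed.

Lemma rnormD u v : rnorm (u + v) <= rnorm u + rnorm v.
Proof. by rewrite -lecR rmorphD /= !rnormE ler_normD. Qed.

Lemma rnormB u v : rnorm (u - v) <= rnorm u + rnorm v.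
Proof. by rewrite -[rnorm v]rnormN rnormD. Qed.

Lemma rnorm_distC u v : rnorm (u - v) = rnorm (v - u).
Proof. by rewrite /rnorm distrC. Qed.

Lemma rnorm_distD w u v : rnorm (u - v) <= rnorm (u - w) + rnorm (w - v).
Proof. by rewrite -lecR rmorphD /= !rnormE ler_distD. Qed.

Lemma rnorm_le_dist u v : rnorm u <= rnorm v + rnorm (u - v).
Proof. by rewrite -[X in rnorm X <= _](subrK v) [leRHS]addrC rnormD. Qed.

Lemma rnormZ (c : R[i]) v : rnorm (c *: v) = complex.Re `|c| * rnorm v.
Proof.
by apply: complexI; rewrite rnormE normrZ -rnormE rmorphM /=.
Qed.

Lemma rnormZr (t : R) v : rnorm (t%:C *: v) = `|t| * rnorm v.
Proof.
by rewrite rnormZ normc_def /= expr0n /= addr0 sqrtr_sqr.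
Qed.

Lemma rnormZi v : rnorm ('i *: v) = rnorm v.
Proof. by rewrite rnormZ normCi mul1r. Qed.

Lemma ball_rnorm v u (e : R) : ball v e%:C u = (rnorm (v - u) < e) :> Prop.
Proof. by rewrite -ball_normE /= -ltcR rnormE. Qed.

Lemma nbhs_rnorm v (P : set V) :
  nbhs v P <-> exists2 e : R, 0 < e & forall u, rnorm (v - u) < e -> P u.
Proof.
split=> [/nbhs_ballP[e /= e0 eP]|[e e0 eP]].
  have eE : e = (complex.Re e)%:C by rewrite RRe_real ?gtr0_real.
  exists (complex.Re e); first by rewrite -ltcR -eE.
  by move=> u uv; apply: eP; rewrite eE ball_rnorm.
apply/nbhs_ballP; exists e%:C => /=; first by rewrite ltcR.
by move=> u; rewrite ball_rnorm; exact: eP.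
Qed.

Lemma closure_rnorm (P : set V) v :
  closure P v <-> forall e : R, 0 < e -> exists2 u, P u & rnorm (v - u) < e.
Proof.
split=> [clP e e0|ap U /nbhs_rnorm[e e0 eU]].
  have [|u [Pu uv]] := clP [set u | rnorm (v - u) < e].
    by apply/nbhs_rnorm; exists e.
  by exists u.
by have [u Pu uv] := ap e e0; exists u; split => //; exact: eU.
Qed.

Lemma closed_rnorm (P : set V) :
  (forall v, (forall e : R, 0 < e -> exists2 u, P u & rnorm (v - u) < e) -> P v)
  <-> closed P.
Proof.
split=> [ap v /closure_rnorm|/closure_id clP v vP]; first exact: ap.
by rewrite clP; apply/closure_rnorm.
Qed.

Lemma rnorm_small_eq u v :
  (forall e : R, 0 < e -> rnorm (u - v) <= e) -> u = v.
Proof.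
move=> uv; apply/subr0_eq/rnorm_eq0/le_anti; rewrite rnorm_ge0 andbT.
by apply/ler_addgt0Pr => e e0; rewrite add0r uv.
Qed.

End RealNorm.

Lemma cvg_filter_rnorm {R : realType} {V : completeNormedModType R[i]}
    (F : set_system V) : ProperFilter F ->
  (forall e : R, 0 < e -> exists v, F [set u | rnorm (v - u) < e]) ->
  exists v, forall e : R, 0 < e -> F [set u | rnorm (v - u) < e].
Proof.
move=> FF cF.
have : cvg F.
  apply: cauchy_cvg; apply/cauchy_exP => e e0.
  have eE : e = (complex.Re e)%:C by rewrite RRe_real ?gtr0_real.
  have [|v vF] := cF (complex.Re e); first by rewrite -ltcR -eE.
  by exists v; apply: filterS vF => u /=; rewrite eE ball_rnorm.
move=> /cvg_ex[v vF]; exists v => e e0; apply: vF.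
by apply/nbhs_rnorm; exists e.
Qed.

(** * Self-adjoint elements, real and imaginary parts *)

Section CStarBasics.
Context {R : realType} {A : cstarAlgType R}.
Implicit Types a b : A.

Lemma starZD (c : R[i]) a b : star (c *: a + b) = c^* *: star a + star b.
Proof. exact: star_semilinear. Qed.

Lemma starD a b : star (a + b) = star a + star b.
Proof. by rewrite -[a in LHS]scale1r starZD rmorph1 scale1r. Qed.

Lemma star0 : star (0 : A) = 0.
Proof. by apply: (@addIr _ (star (0 : A))); rewrite -starD !add0r. Qed.

Lemma starZ (c : R[i]) a : star (c *: a) = c^* *: star a.
Proof. by rewrite -[c *: a]addr0 starZD star0 addr0. Qed.

Lemma starZr (t : R) a : star (t%:C *: a) = t%:C *: star a.
Proof. by rewrite starZ conj_Creal// complex_real. Qed.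

Lemma starN a : star (- a) = - star a.
Proof. by rewrite -scaleN1r starZ rmorphN rmorph1 scaleN1r. Qed.

Lemma starB a b : star (a - b) = star a - star b.
Proof. by rewrite starD starN. Qed.

Lemma star_mul a b : star (a * b) = star b * star a.
Proof. exact: starM. Qed.

Lemma star1 : star (1 : A) = 1.
Proof. by rewrite -[LHS]mulr1 -{2}[1](starK (1 : A)) -star_mul mulr1 starK. Qed.

Lemma rnormM a b : rnorm (a * b) <= rnorm a * rnorm b.
Proof. by rewrite -lecR rmorphM /= !rnormE cstar_normM. Qed.

Lemma rnorm_cstar a : rnorm (star a * a) = rnorm a ^+ 2.
Proof. by apply: complexI; rewrite rmorphXn /= !rnormE; exact: cstar_norm. Qed.

Lemma rnorm_star a : rnorm (star a) = rnorm a.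
Proof.
have H b : rnorm b <= rnorm (star b).
  have [->|b0] := eqVneq (rnorm b) 0; first exact: rnorm_ge0.
  have {}b0 : 0 < rnorm b by rewrite lt_def b0 rnorm_ge0.
  by rewrite -(ler_pM2r b0) -expr2 -rnorm_cstar rnormM.
by apply/le_anti; rewrite H -{2}(starK a) H.
Qed.

Lemma rnorm1 : rnorm (1 : A) = 1.
Proof.
have := rnorm_cstar (1 : A); rewrite star1 mulr1.
have : rnorm (1 : A) != 0 by apply/eqP => /rnorm_eq0/eqP; rewrite oner_eq0.
by move=> n0; rewrite expr2 -[X in X = _]mulr1 => /(mulfI n0).
Qed.

Lemma rnorm_alg (t : R) : rnorm (t%:C%:A : A) = `|t|.
Proof. by rewrite rnormZr rnorm1 mulr1. Qed.

Lemma sa_add a b : self_adjoint A a -> self_adjoint A b -> self_adjoint A (a + b).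
Proof. by rewrite /self_adjoint /= starD => -> ->. Qed.

Lemma sa_sub a b : self_adjoint A a -> self_adjoint A b -> self_adjoint A (a - b).
Proof. by rewrite /self_adjoint /= starB => -> ->. Qed.

Lemma sa_scale (t : R) a : self_adjoint A a -> self_adjoint A (t%:C *: a).
Proof. by rewrite /self_adjoint /= starZr => ->. Qed.

Lemma sa_opp a : self_adjoint A a -> self_adjoint A (- a).
Proof. by rewrite /self_adjoint /= starN => ->. Qed.

Lemma sa_alg (t : R) : self_adjoint A t%:C%:A.
Proof. by rewrite /self_adjoint /= starZr star1. Qed.

Lemma sa1 : self_adjoint A 1.
Proof. exact: star1. Qed.

Lemma sa_comm_mul a b : self_adjoint A a -> self_adjoint A b -> a * b = b * a ->
  self_adjoint A (a * b).
Proof. by rewrite /self_adjoint /= star_mul => -> -> ->. Qed.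

Lemma sa_sqr a : self_adjoint A a -> self_adjoint A (a * a).
Proof. by move=> sa; exact: sa_comm_mul. Qed.

Lemma sa_star_mul a : self_adjoint A (star a * a).
Proof. by rewrite /self_adjoint /= star_mul starK. Qed.

Lemma rnorm_sa_sqr a : self_adjoint A a -> rnorm (a * a) = rnorm a ^+ 2.
Proof. by move=> sa; rewrite -rnorm_cstar sa. Qed.

Lemma closed_sa : closed (self_adjoint A).
Proof.
apply/closed_rnorm => v ap; apply: rnorm_small_eq => e e0.
have e2 : 0 < e / 2 by rewrite divr_gt0.
have [u su uv] := ap _ e2.
rewrite (le_trans (rnorm_distD u _ _))// -[X in star v - X]su -starB rnorm_star.
rewrite (rnorm_distC u).
by rewrite [leRHS](splitr e) lerD// ltW.
Qed.

Definition cre a : A := (2^-1 : R)%:C *: (a + star a).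
Definition cim a : A := (2^-1 : R)%:C *: (- 'i *: (a - star a)).

Lemma sa_cre a : self_adjoint A (cre a).
Proof. by rewrite /self_adjoint /= starZr starD starK addrC. Qed.

Lemma sa_cim a : self_adjoint A (cim a).
Proof.
rewrite /self_adjoint /= starZr starZ starB starK rmorphN /= conjCi opprK.
by rewrite -(opprB a) scalerN /cim scaleNr.
Qed.

Lemma half_add (a : A) : (2^-1 : R)%:C *: a + (2^-1 : R)%:C *: a = a.
Proof.
rewrite -scalerDl -rmorphD /= (_ : _ + _ = 1) ?scale1r//; lra.
Qed.

Lemma cre_cim a : cre a + 'i *: cim a = a.
Proof.
rewrite /cre /cim [X in _ + X]scalerA mulrC -scalerA -scalerDr [X in _ + X]scalerA.
rewrite mulrN -expr2 sqrCi opprK scale1r addrACA subrr addr0.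
by rewrite scalerDr half_add.
Qed.

Lemma rnorm_cre a : rnorm (cre a) <= rnorm a.
Proof.
rewrite rnormZr ger0_norm ?invr_ge0// mulrC ler_pdivrMr// mulr_natr mulr2n.
by rewrite (le_trans (rnormD _ _))// rnorm_star.
Qed.

Lemma rnorm_cim a : rnorm (cim a) <= rnorm a.
Proof.
rewrite rnormZr ger0_norm ?invr_ge0// mulrC ler_pdivrMr// mulr_natr mulr2n.
by rewrite scaleNr rnormN rnormZi (le_trans (rnormB _ _))// rnorm_star.
Qed.

End CStarBasics.

(** * Positive elements of a C*-algebra *)

(** Banach's fixed point theorem, used in place of power series for both square roots and inverses.
    The closed set [S] carries to the limit the side conditions: self-adjointness, size,
    commutation. *)
Lemma contraction_fixpoint {R : realType} {V : completeNormedModType R[i]}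
    (S : set V) (f : V -> V) (q : R) (v0 : V) :
  closed S -> S v0 -> 0 <= q < 1 -> (forall v, S v -> S (f v)) ->
  (forall u v, S u -> S v -> rnorm (f u - f v) <= q * rnorm (u - v)) ->
  exists2 v, S v & f v = v.
Proof.
move=> /closed_rnorm clS Sv0 /andP[q0 q1] Sf fq.
pose u n := iter n f v0.
have Su n : S (u n) by elim: n => //= n; exact: Sf.
have fwd : 0 < 1 - q by rewrite subr_gt0.
(* The sum of the geometric series that bounds the total displacement; it solves
   [|f v0 - v0| + q M = M]. *)
pose M := rnorm (f v0 - v0) / (1 - q).
have uM n k : rnorm (u n - u (n + k)%N) <= q ^+ n * M.
  elim: n k => [k|n IH k]; last first.
    by rewrite exprS -mulrA (le_trans (fq _ _ _ _))// ler_wpM2l.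
  rewrite add0n expr0 mul1r.
  elim: k => [|k IH]; first by rewrite subrr rnorm0 divr_ge0 ?rnorm_ge0 ?ltW.
  rewrite (le_trans (rnorm_distD (f v0) _ _))//.
  rewrite (le_trans (lerD (lexx _) (fq v0 (u k) Sv0 (Su k))))//.
  rewrite (le_trans (lerD (lexx _) (ler_wpM2l q0 IH)))// rnorm_distC /M.
  by rewrite -subr_ge0 le_eqVlt; apply/orP; left; apply/eqP; field; rewrite gt_eqF.
have qn e : 0 < e -> \forall n \near \oo, q ^+ n * M < e.
  move=> e0.
  have /cvgrPdist_lt/(_ e e0) : geometric M q n @[n --> \oo] --> (0 : R).
    by apply: cvg_geometric; rewrite ger0_norm.
  apply: filterS => n /=; rewrite sub0r normrN mulrC; apply: le_lt_trans.
  exact: ler_norm.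
have [|v vP] := @cvg_filter_rnorm R V (u @ \oo) _.
  move=> e e0; have [N _ /(_ N (leqnn N)) /= NP] := qn _ e0.
  exists (u N); exists N => // n /= Nn.
  by rewrite -(subnKC Nn) (le_lt_trans (uM _ _)).
have Sv : S v.
  apply: clS => e e0; have [N _ /(_ N (leqnn N)) /= NP] := vP _ e0.
  by exists (u N).
exists v => //; apply: rnorm_small_eq => e e0.
have e2 : 0 < e / 2 by rewrite divr_gt0.
have [N _ NP] := vP _ e2.
rewrite (le_trans (rnorm_distD (u N.+1) _ _))// [leRHS](splitr e) lerD//.
  rewrite (le_trans (fq _ _ _ _))// -[leRHS]mul1r ler_pM ?rnorm_ge0 ?(ltW q1)//.
  by rewrite ltW// NP /=.
by rewrite rnorm_distC ltW// NP /=.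
Qed.

Section Positive.
Context {R : realType} {A : cstarAlgType R}.
Implicit Types a b h p v w x y z : A.
Local Notation sa := (self_adjoint A).

Lemma alg_add (s t : R) : (s + t)%:S = s%:S + t%:S :> A.
Proof. by rewrite rmorphD scalerDl. Qed.

Lemma alg_sub (s t : R) : (s - t)%:S = s%:S - t%:S :> A.
Proof. by rewrite rmorphB scalerBl. Qed.

Lemma alg_scale (s t : R) : s%:C *: t%:S = (s * t)%:S :> A.
Proof. by rewrite scalerA rmorphM. Qed.

Lemma alg_comm (t : R) x : x * t%:S = t%:S * x.
Proof. by rewrite mulr_algl mulr_algr. Qed.

(** The substitute for functional calculus: a square root taken from [h] commutes with all that
    commutes with [h], in particular with other such roots. *)
Definition in_bicommutant w h := forall x, x * h = h * x -> x * w = w * x.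

Lemma closed_comm x : closed [set y | x * y = y * x].
Proof.
apply/closed_rnorm => v ap /=; apply: rnorm_small_eq => e e0.
have K0 : 0 < 2 * rnorm x + 1 by rewrite ltr_wpDl// mulr_ge0 ?rnorm_ge0.
have [u /= su uv] := ap _ (divr_gt0 e0 K0).
rewrite (_ : _ - _ = x * (v - u) - (v - u) * x); last first.
  by rewrite mulrBl mulrBr su; zmod.
rewrite (le_trans (rnormB _ _))// (le_trans (lerD (rnormM _ _) (rnormM _ _)))//.
rewrite [rnorm (v - u) * _]mulrC -mulr2n -mulr_natl mulrA.
rewrite (le_trans (ler_wpM2l _ (ltW uv))) ?mulr_ge0 ?rnorm_ge0//.
by rewrite mulrA ler_pdivrMr// mulrC ler_wpM2l ?ltW// ltrDl.
Qed.

Lemma closed_rball (r : R) : closed [set y : A | rnorm y <= r].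
Proof.
apply/closed_rnorm => v ap /=; apply/ler_addgt0Pr => e e0.
have [u /= su uv] := ap _ e0.
by rewrite (le_trans (rnorm_le_dist v u))// lerD// ltW.
Qed.

(* [(1 - c) ^ 2 = 1 - h] means that [c] is a fixed point of [c |-> (h + c ^ 2) / 2],
   which is a contraction of the ball of radius [rnorm h]. *)
Lemma sqrt_one_sub h : sa h -> rnorm h < 1 ->
  exists b, [/\ sa b, b * b = 1 - h, in_bicommutant b h & rnorm (1 - b) < 1].
Proof.
move=> sh h1; set q := rnorm h.
pose S := [set c : A | [/\ sa c, rnorm c <= q & in_bicommutant c h]].
pose f c : A := (2^-1 : R)%:C *: (h + c * c).
have hq : 0 <= q by exact: rnorm_ge0.
have [|||||c [sc cq cb] fc] := @contraction_fixpoint R A S f q 0.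
- have -> : S = sa `&` [set y | rnorm y <= q] `&`
      (\bigcap_(x in [set x | x * h = h * x]) [set y | x * y = y * x]).
    by apply/seteqP; split=> [c [? ? ?]|c [[? ?] ?]].
  apply: closedI; first by apply: closedI; [exact: closed_sa|exact: closed_rball].
  by apply: closed_bigI => x _; exact: closed_comm.
- split=> [||x _]; rewrite ?rnorm0 ?mulr0 ?mul0r//.
  exact: star0.
- by rewrite hq.
- move=> c [sc cq cb]; split.
  + exact/sa_scale/sa_add/sa_sqr.
  + rewrite rnormZr ger0_norm// mulrC ler_pdivrMr// mulr_natr mulr2n.
    rewrite (le_trans (rnormD _ _))// lerD// (le_trans (rnormM _ _))//.
    by rewrite -[leRHS]mulr1 ler_pM ?rnorm_ge0// (le_trans cq)// ltW.
  + move=> x xh; rewrite -scalerAr -scalerAl mulrDr mulrDl xh.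
    by rewrite mulrA (cb _ xh) -mulrA (cb _ xh) mulrA.
- move=> u v [_ uq _] [_ vq _]; rewrite -scalerBr rnormZr ger0_norm//.
  rewrite opprD addrACA subrr add0r.
  rewrite (_ : u * u - v * v = u * (u - v) + (u - v) * v); last first.
    by rewrite mulrBr mulrBl addrA subrK.
  rewrite mulrC ler_pdivrMr// mulr_natr mulr2n.
  rewrite (le_trans (rnormD _ _))// lerD// (le_trans (rnormM _ _))//.
    by rewrite ler_wpM2r ?rnorm_ge0.
  by rewrite mulrC ler_wpM2r ?rnorm_ge0.
exists (1 - c); split.
- exact/sa_sub/sc/sa1.
- have -> : h = c + c - c * c.
    by rewrite -{1 2}fc half_add addrK.
  by ncring.
- by move=> x xh; rewrite mulrBr mulrBl mulr1 mul1r (cb _ xh).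
- by rewrite opprB addrCA subrr addr0 (le_lt_trans cq).
Qed.

(* [x + i y] is a multiple of a unitary. *)
Lemma rnorm_pythagoras x y (t : R) : sa x -> sa y -> x * y = y * x -> 0 <= t ->
  x * x + y * y = (t ^+ 2)%:S -> rnorm x <= t.
Proof.
move=> sx sy xy t0 xyt; pose u := x + 'i *: y.
have su : star u = x - 'i *: y by rewrite starD starZ conjCi sx sy scaleNr.
have uu : star u * u = (t ^+ 2)%:S.
  rewrite su mulrDr !mulrDl !mulNr -!scalerAr -!scalerAl xy scalerA -!expr2 sqrCi.
  by rewrite scaleN1r -xyt !expr2; zmod.
have ut : rnorm u <= t.
  by rewrite -ler_sqr ?nnegrE ?rnorm_ge0// -rnorm_cstar uu rnorm_alg ger0_norm
    ?sqr_ge0.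
suff -> : x = cre u by exact: le_trans (rnorm_cre _) ut.
by rewrite /cre su /u addrACA subrr addr0 scalerDr half_add.
Qed.

(* For self-adjoint [h], this says that the spectrum of [h] is nonnegative. *)
Definition pos h := exists t : R, rnorm (t%:S - h) <= t.

Lemma pos_add h v : pos h -> pos v -> pos (h + v).
Proof.
move=> [s sh] [t tv]; exists (s + t).
by rewrite alg_add opprD addrACA (le_trans (rnormD _ _))// lerD.
Qed.

Lemma pos_scale (t : R) h : 0 <= t -> pos h -> pos (t%:C *: h).
Proof.
move=> t0 [s sh]; exists (t * s).
by rewrite -alg_scale -scalerBr rnormZr ger0_norm// ler_wpM2l.
Qed.

Lemma pos_alg (t : R) : 0 <= t -> pos t%:S.
Proof. by move=> t0; exists t; rewrite subrr rnorm0. Qed.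

Lemma pos_norm_add (t : R) x : rnorm x <= t -> pos (t%:S + x).
Proof. by move=> xt; exists t; rewrite opprD addrA subrr add0r rnormN. Qed.

Lemma pos_norm_sub (t : R) x : rnorm x <= t -> pos (t%:S - x).
Proof. by rewrite -rnormN; exact: pos_norm_add. Qed.

Lemma pos_near h v (e : R) : pos v -> rnorm (h - v) <= e -> pos (h + e%:S).
Proof.
move=> pv hv; rewrite (_ : h + _ = v + (e%:S + (h - v))).
  exact/pos_add/pos_norm_add.
by rewrite addrCA [v + _]addrC subrK addrC.
Qed.

(** The shift by [e] makes the contraction strict: [h + e = (t + e) (1 - g)] where
    [g = (t - h) / (t + e)] has norm at most [t / (t + e) < 1]. *)
Lemma pos_sqrt h (e : R) : sa h -> pos h -> 0 < e ->
  exists w, [/\ sa w, w * w = h + e%:S, in_bicommutant w h & pos w].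
Proof.
move=> sh [t th] e0.
have t0 : 0 <= t by exact: le_trans (rnorm_ge0 _) th.
have te : 0 < t + e by exact: ltr_wpDl.
have te0 : t + e != 0 by rewrite gt_eqF.
pose g : A := ((t + e)^-1)%:C *: (t%:S - h).
have sg : sa g by exact/sa_scale/sa_sub/sh/sa_alg.
have g1 : rnorm g < 1.
  rewrite rnormZr gtr0_norm ?invr_gt0// mulrC ltr_pdivrMr// mul1r.
  by rewrite (le_lt_trans th)// ltrDl.
have [b [sb bb bg b1]] := sqrt_one_sub sg g1.
exists ((Num.sqrt (t + e))%:C *: b); split.
- exact: sa_scale.
- rewrite -scalerAl -scalerAr scalerA -rmorphM /= -expr2 sqr_sqrtr ?ltW// bb.
  rewrite scalerBr scalerA -rmorphM /= mulfV// scale1r alg_add opprB.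
  by zmod.
- move=> x xh; rewrite -scalerAl -scalerAr bg//.
  by rewrite -scalerAl -scalerAr mulrBr mulrBl alg_comm xh.
- apply: pos_scale; first exact: sqrtr_ge0.
  by exists 1; rewrite scale1r ltW.
Qed.

(** Let [b] be the square root of [1 - h^2 / s^2]. Then [b] and [h / s] commute and their squares
    add up to 1, so [b] has norm at most 1, and [s^2 - h^2 = s^2 b^2]. *)
Lemma sqr_sub_norm h (s : R) : sa h -> rnorm h < s ->
  rnorm ((s ^+ 2)%:S - h * h) <= s ^+ 2.
Proof.
move=> sh hs; have s0 : 0 < s by exact: le_lt_trans (rnorm_ge0 _) hs.
have s20 : 0 < s ^+ 2 by rewrite exprn_gt0.
pose g : A := ((s ^+ 2)^-1)%:C *: (h * h).
have sg : sa g by exact/sa_scale/sa_sqr.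
have g1 : rnorm g < 1.
  rewrite rnormZr gtr0_norm ?invr_gt0// mulrC ltr_pdivrMr// mul1r.
  by rewrite rnorm_sa_sqr// ltr_sqr ?nnegrE ?rnorm_ge0 ?ltW.
have [b [sb bb bg _]] := sqrt_one_sub sg g1.
have -> : (s ^+ 2)%:S - h * h = (s ^+ 2)%:C *: (b * b).
  by rewrite bb scalerBr scalerA -rmorphM /= mulfV ?gt_eqF// scale1r.
rewrite rnormZr gtr0_norm// rnorm_sa_sqr// -[leRHS]mulr1 (ler_wpM2l (ltW s20))//.
rewrite expr_le1 ?rnorm_ge0//.
apply: (@rnorm_pythagoras b ((s^-1)%:C *: h)) => //.
- exact: sa_scale.
- rewrite -scalerAr -scalerAl; congr (_ *: _); apply/esym/bg.
  by rewrite -scalerAl -scalerAr mulrA.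
- by rewrite bb -scalerAl -scalerAr scalerA -rmorphM /= -invfM -expr2 subrK
    expr1n scale1r.
Qed.

Lemma pos_sqr h : sa h -> pos (h * h).
Proof.
move=> sh; exists ((rnorm h + 1) ^+ 2); apply: sqr_sub_norm => //.
by rewrite ltrDl.
Qed.

(** The witness of [pos] can be taken to be the norm, which is what lets [pos] pass to limits. Up to
    a vanishing error, [h] is a square [w^2], and [sqr_sub_norm] applies to [w]; [m] exceeds the
    norm of [h + e], as its strict hypothesis requires. *)
Lemma pos_norm h : sa h -> pos h -> rnorm ((rnorm h)%:S - h) <= rnorm h.
Proof.
move=> sh ph; apply/ler_addgt0Pr => e' e'0.
pose e := e' / 3; have e0 : 0 < e by rewrite divr_gt0.
have [w [sw ww _ _]] := pos_sqrt sh ph e0.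
pose m := rnorm h + 2 * e.
have m0 : 0 <= m by rewrite addr_ge0 ?rnorm_ge0// mulr_ge0 ?ltW.
have wm : rnorm (m%:S - (h + e%:S)) <= m.
  rewrite -[m]sqr_sqrtr// -ww; apply: sqr_sub_norm => //.
  rewrite -ltr_sqr ?nnegrE ?rnorm_ge0 ?sqrtr_ge0// sqr_sqrtr// -rnorm_sa_sqr// ww.
  rewrite (le_lt_trans (rnormD _ _))// rnorm_alg gtr0_norm// /m ltrD2l.
  by rewrite mulr_natl mulr2n ltrDl.
rewrite (_ : _ - h = m%:S - (h + e%:S) - e%:S); last first.
  rewrite (_ : rnorm h = m - e - e); last by rewrite /m; lra.
  by rewrite !alg_sub; zmod.
rewrite (le_trans (rnormB _ _))// rnorm_alg gtr0_norm//.
by rewrite (le_trans (lerD wm (lexx _)))// /m /e; lra.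
Qed.

Lemma pos_closed h : sa h -> (forall e : R, 0 < e -> pos (h + e%:S)) -> pos h.
Proof.
move=> sh ph; exists (rnorm h); apply/ler_addgt0Pr => e' e'0.
pose e := e' / 3; have e0 : 0 < e by rewrite divr_gt0.
have /(pos_norm (sa_add sh (sa_alg e))) := ph e e0.
set m := rnorm (h + _) => hm.
have m1 : m <= rnorm h + e.
  by rewrite (le_trans (rnormD _ _))// rnorm_alg gtr0_norm.
have m2 : rnorm h <= m + e.
  by rewrite (le_trans (rnorm_le_dist h (h + e%:S)))// opprD addrA subrr sub0r
    rnormN rnorm_alg gtr0_norm.
rewrite (_ : _ - h = (m%:S - (h + e%:S)) + (rnorm h - m + e)%:S); last first.
  by rewrite alg_add alg_sub; zmod.
rewrite (le_trans (rnormD _ _))// rnorm_alg.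
rewrite (le_trans (lerD (le_trans hm m1) (_ : _ <= 2 * e)))//;
  last by rewrite /e; lra.
by rewrite ler_norml; apply/andP; split; lra.
Qed.

(** With [w^2 = y + d], the bicommutant condition makes [w] and [v] commute, so [y v^2] differs from
    the square of [w v] by [d v^2], which is small. *)
Lemma pos_mul_sqr y v : sa y -> pos y -> sa v -> y * v = v * y ->
  pos (y * (v * v)).
Proof.
move=> sy py sv yv.
have syvv : sa (y * (v * v)).
  by apply: sa_comm_mul => //; [exact: sa_sqr|rewrite mulrA yv -mulrA yv mulrA].
apply: pos_closed => // e e0.
have K0 : 0 < rnorm (v * v) + 1 by rewrite ltr_wpDl ?rnorm_ge0.
have d0 := divr_gt0 e0 K0; set d := e / _ in d0.
have [w [sw ww wy _]] := pos_sqrt sy py d0.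
have vw : v * w = w * v by apply: wy.
apply: (@pos_near _ ((w * v) * (w * v))).
  exact/pos_sqr/sa_comm_mul.
rewrite (_ : w * v * (w * v) = (y + d%:S) * (v * v)); last first.
  by rewrite -ww -!mulrA; congr (_ * _); rewrite mulrA vw mulrA.
rewrite mulrDl opprD addrA subrr sub0r  rnormN mulr_algl rnormZr gtr0_norm//.
by rewrite /d mulrAC ler_pdivrMr// ler_wpM2l ?ltW// ltrDl.
Qed.

(** With [w^2 = t - x + e] and [z^2 = t + x + e], all of which commute, [x^2] and the square of
    [w z] add up to [(t + e)^2]. *)
Lemma pos_between x (t : R) : sa x -> pos (t%:S - x) -> pos (t%:S + x) ->
  rnorm x <= t.
Proof.
move=> sx pB pD; apply/ler_addgt0Pr => e e0.
have [w [sw ww wc _]] := pos_sqrt (sa_sub (sa_alg t) sx) pB e0.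
have [z [sz zz zc _]] := pos_sqrt (sa_add (sa_alg t) sx) pD e0.
have t0 : 0 <= t.
  have [s] := pos_add pB pD; rewrite addrACA addNr addr0 -alg_add -alg_sub.
  by rewrite rnorm_alg ler_norml => /andP[_]; lra.
have xw : x * w = w * x by apply: wc; rewrite mulrBr mulrBl alg_comm.
have xz : x * z = z * x by apply: zc; rewrite mulrDr mulrDl alg_comm.
have zw : z * w = w * z.
  by apply: wc; rewrite mulrBr mulrBl alg_comm xz.
have te0 : 0 <= t + e by rewrite addr_ge0// ltW.
apply: (@rnorm_pythagoras _ (w * z)) => //.
- exact: sa_comm_mul.
- by rewrite mulrA xw -mulrA xz mulrA.
rewrite (_ : w * z * (w * z) = (w * w) * (z * z)); last first.
  by rewrite -!mulrA; congr (_ * _); rewrite mulrA zw mulrA.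
rewrite ww zz [t%:S - x + _]addrAC [t%:S + x + _]addrAC -alg_add.
rewrite mulrBl !mulrDr alg_comm !mulr_algl alg_scale -!expr2.
by rewrite alg_comm mulr_algl; zmod.
Qed.

Definition invertible x := exists z, x * z = 1 /\ z * x = 1.

Lemma invertible_lr x y z : y * x = 1 -> x * z = 1 -> invertible x.
Proof.
move=> yx xz; exists z; split => //.
by rewrite -[z]mul1r -{1}yx -[y * x * z]mulrA xz mulr1.
Qed.

Lemma invertibleZ (t : R) x : t != 0 -> invertible x -> invertible (t%:C *: x).
Proof.
move=> t0 [z [xz zx]]; exists ((t^-1)%:C *: z).
by rewrite -!scalerAl -!scalerAr !scalerA -!rmorphM /= mulfV// mulVf// xz zx
  scale1r.
Qed.

Lemma invertible_one_sub (g : A) : rnorm g < 1 -> invertible (1 - g).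
Proof.
move=> g1; have qg : 0 <= rnorm g < 1 by rewrite rnorm_ge0.
have closedT' : closed [set: A] by exact: closedT.
have [||p _ pE] := @contraction_fixpoint R A setT (fun z => 1 + g * z) _ 0
  closedT' I qg.
- by [].
- by move=> u v _ _; rewrite opprD addrACA subrr add0r -mulrBr rnormM.
have [||p' _ p'E] := @contraction_fixpoint R A setT (fun z => 1 + z * g) _ 0
  closedT' I qg.
- by [].
- by move=> u v _ _; rewrite opprD addrACA subrr add0r -mulrBl mulrC rnormM.
apply: (@invertible_lr _ p' p).
- by rewrite mulrBr mulr1 -{1}p'E addrK.
- by rewrite mulrBl mul1r -{1}pE addrK.
Qed.

Lemma pos_invertible h (r : R) : pos h -> 0 < r -> invertible (h + r%:S).
Proof.
move=> [t th] r0.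
have t0 : 0 <= t by exact: le_trans (rnorm_ge0 _) th.
have te : 0 < t + r by exact: ltr_wpDl.
have te0 : t + r != 0 by rewrite gt_eqF.
rewrite (_ : _ + _ = (t + r)%:C *: (1 - ((t + r)^-1)%:C *: (t%:S - h))).
  apply/invertibleZ/invertible_one_sub => //.
  rewrite rnormZr gtr0_norm ?invr_gt0// mulrC ltr_pdivrMr// mul1r.
  by rewrite (le_lt_trans th)// ltrDl.
rewrite scalerBr scalerA -rmorphM /= mulfV// scale1r alg_add.
by zmod.
Qed.

(** With [z] the inverse of [y], [y - d = y (1 - d z)], and [1 - d z] is a square as soon as
    [d |z| < 1]. *)
Lemma pos_invertible_sub y : sa y -> pos y -> invertible y ->
  exists2 d : R, 0 < d & pos (y - d%:S).
Proof.
move=> sy py [z [yz zy]].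
have sz : sa z.
  rewrite /self_adjoint /= -[star z]mulr1 -yz mulrA -{1}sy -star_mul yz.
  by rewrite star1 mul1r.
have K0 : 0 < rnorm z + 1 by rewrite ltr_wpDl ?rnorm_ge0.
pose d := (rnorm z + 1)^-1; have d0 : 0 < d by rewrite invr_gt0.
have dz1 : rnorm (d%:C *: z) < 1.
  by rewrite rnormZr gtr0_norm// mulrC ltr_pdivrMr// mul1r ltrDl.
have [v [sv vv vz _]] := sqrt_one_sub (sa_scale d sz) dz1.
exists d => //; rewrite (_ : _ - _ = y * (v * v)).
  apply: pos_mul_sqr => //; apply: vz.
  by rewrite -scalerAr -scalerAl yz zy.
by rewrite vv mulrBr mulr1 -scalerAr yz.
Qed.

(** A converse of [pos_invertible]. Take the infimum of the [r >= 0] for which [x + r] is positive: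
    were it nonzero, invertibility there would leave room to decrease it. *)
Lemma pos_of_invertible x : sa x ->
  (forall r : R, 0 < r -> invertible (x + r%:S)) -> pos x.
Proof.
move=> sx xinv.
pose S := [set r : R | 0 <= r /\ pos (x + r%:S)].
have S0 : S (rnorm x).
  by split; [exact: rnorm_ge0|rewrite addrC; exact: pos_norm_add].
have infS : has_inf S.
  by split; [exists (rnorm x)|exists 0 => r []].
have r0_ge0 : 0 <= inf S by apply: lb_le_inf; [exists (rnorm x)|move=> r []].
have px : pos (x + (inf S)%:S).
  apply: pos_closed => [|e e0]; first exact/sa_add/sa_alg.
  have [r [r0 pr] rlt] := inf_adherent e0 infS.
  rewrite (_ : _ + e%:S = x + r%:S + (inf S + e - r)%:S).
    by apply/pos_add/pos_alg => //; rewrite subr_ge0 ltW.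
  by rewrite alg_sub alg_add; zmod.
have [S1|S1] := leP (inf S) 0.
  by rewrite -[x]addr0 -(scale0r 1)
    (_ : 0 = (inf S)%:C)// (le_anti (introT andP (conj S1 r0_ge0))).
have [d d0 pd] := pos_invertible_sub (sa_add sx (sa_alg (inf S))) px (xinv _ S1).
(* Capped by [inf S], since the elements of [S] must be nonnegative. *)
pose d' := Num.min d (inf S).
have d'0 : 0 < d' by rewrite lt_min d0.
have : S (inf S - d').
  split; first by rewrite subr_ge0 ge_min lexx orbT.
  rewrite (_ : _ + _ = x + (inf S)%:S - d%:S + (d - d')%:S).
    by apply/pos_add/pos_alg => //; rewrite subr_ge0 ge_min lexx.
  by rewrite !alg_sub; zmod.
by move=> /(ge_inf infS.2); rewrite -subr_ge0 addrAC subrr add0r oppr_ge0 leNgt d'0.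
Qed.

(* With [z] the inverse of [a b + r], the inverse of [b a + r] is
   [(1 - b z a) / r]. *)
Lemma invertible_swap a b (r : R) : r != 0 ->
  invertible (a * b + r%:S) -> invertible (b * a + r%:S).
Proof.
move=> r0 [z [abz zab]].
have zE : a * b * z = 1 - r%:C *: z by rewrite -abz mulrDl mulr_algl addrK.
have zE' : z * a * b = 1 - r%:C *: z by rewrite -zab mulrDr mulr_algr mulrA addrK.
have c1 : (b * a + r%:S) * (1 - b * z * a) = r%:S.
  rewrite mulrBr mulr1 !mulrDl mulr_algl.
  rewrite (_ : b * a * (b * z * a) = b * (a * b * z) * a); last by rewrite !mulrA.
  rewrite zE mulrBr mulr1 mulrBl -scalerAr -scalerAl.
  by zmod.
have c2 : (1 - b * z * a) * (b * a + r%:S) = r%:S.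
  rewrite mulrBl mul1r !mulrDr mulr_algr.
  rewrite (_ : b * z * a * (b * a) = b * (z * a * b) * a); last by rewrite !mulrA.
  rewrite zE' mulrBr mulr1 mulrBl -scalerAr -scalerAl.
  by zmod.
exists ((r^-1)%:C *: (1 - b * z * a)).
by rewrite -scalerAr -scalerAl c1 c2 alg_scale mulVf// scale1r.
Qed.

(** For [b = x + i y] with self-adjoint [x] and [y], the cross terms cancel and the sum is
    [2 (x^2 + y^2)]. *)
Lemma pos_star_mul_add b : pos (star b * b + b * star b).
Proof.
have : star b = cre b - 'i *: cim b.
  by rewrite -{1}(cre_cim b) starD (starZ 'i) conjCi sa_cre sa_cim scaleNr.
move: (cre_cim b) (sa_cre b) (sa_cim b).
move: (cre b) (cim b) => x y <- sx sy ->.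
rewrite (_ : _ + _ = x * x + y * y + (x * x + y * y)).
  by apply: pos_add; apply: pos_add; exact: pos_sqr.
rewrite !(mulrDl, mulrDr, mulNr, mulrN) -!scalerAr -!scalerAl !scalerA -!expr2.
by rewrite sqrCi !scaleN1r !expr2; zmod.
Qed.

(* Kaplansky's argument: with [w = sqrt (h ^ 2 + e)] and [p = w - h], which is
   nearly twice the negative part of [h], the element [b = a p] satisfies
   [2 b^* b = e p - p ^ 3].  As [b^* b + b b^*] is positive, [b b^*], hence also
   [b^* b], is nearly positive, so that [p] is small. *)
Lemma pos_star_mul a : pos (star a * a).
Proof.
set h := star a * a; have sh : sa h by exact: sa_star_mul.
suff small d : 0 < d -> exists w p, [/\ pos w, h = w - p & rnorm p <= d].
  apply: pos_closed => // d d0; have [w [p [pw hE pd]]] := small d d0.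
  by rewrite hE -addrA [- p + _]addrC; apply: pos_add => //; exact: pos_norm_sub.
move=> d0; pose e := d ^+ 2 / 2.
have e0 : 0 < e by rewrite divr_gt0// exprn_gt0.
have [w [sw ww wh pw]] := pos_sqrt (sa_sqr sh) (pos_sqr sh) e0.
have hw : h * w = w * h by apply: wh; rewrite mulrA.
pose p := w - h; exists w, p; rewrite subKr; split => //.
have sp : sa p by exact: sa_sub.
have hp : h * p = p * h by rewrite mulrBr mulrBl hw.
have wp : w * p = p * w by rewrite mulrBr mulrBl hw.
have difE : (w + h) * p = e%:S.
  by rewrite mulrDl !mulrBr ww hw; zmod.
have difE' : p * (w + h) = e%:S by rewrite -difE [RHS]mulrDl [LHS]mulrDr wp hp.
(* [(p + r) (w + h + r) = 2 r w + e + r^2] is invertible because [w] is positive, and the two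
   factors commute. *)
have pp : pos p.
  apply: pos_of_invertible => // r r0.
  have prE : (p + r%:S) * (w + h + r%:S) =
      (2 * r)%:C *: w + (e + r ^+ 2)%:S.
    have pE : r%:C *: p = r%:C *: w - r%:C *: h by rewrite scalerBr.
    rewrite mulrDl [p * _]mulrDr difE' alg_comm !mulr_algl pE !scalerDr.
    by rewrite alg_scale -expr2 mulr_natl mulr2n rmorphD scalerDl alg_add; zmod.
  have prC : (w + h + r%:S) * (p + r%:S) = (p + r%:S) * (w + h + r%:S).
    by rewrite /p !(mulrDl, mulrDr, mulNr, mulrN, mulr_algl, mulr_algr) hw; zmod.
  have [||z [z1 z2]] := @pos_invertible ((2 * r)%:C *: w) (e + r ^+ 2) _ _.
  - by apply: pos_scale => //; rewrite mulr_ge0// ltW.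
  - by rewrite ltr_wpDr// sqr_ge0.
  apply: (@invertible_lr _ (z * (w + h + r%:S)) ((w + h + r%:S) * z)).
  - by rewrite -mulrA prC prE.
  - by rewrite mulrA prE.
pose b := a * p.
have hpE : h * p = (2^-1 : R)%:C *: (e%:S - p * p).
  rewrite -difE -mulrBl (_ : w + h - p = h + h); last by rewrite /p; zmod.
  by rewrite mulrDl scalerDr half_add.
have bbE : star b * b = (2^-1 : R)%:C *: (e%:C *: p - p * p * p).
  rewrite star_mul sp -mulrA [star a * _]mulrA -/h hpE -scalerAr mulrBr.
  by rewrite mulr_algr mulrA.
have sbb : sa (star b * b) by exact: sa_star_mul.
(* [n] dominates [b^* b]: twice the difference is [e (|p| - p) + p^3], a sum of positive
   elements. *)
pose n := (2^-1 : R) * (e * rnorm p).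
have n0 : 0 <= n by rewrite !mulr_ge0 ?rnorm_ge0 ?ltW.
have p3 : pos (p * p * p).
  by rewrite -mulrA; apply: pos_mul_sqr.
have up : pos (n%:S - star b * b).
  rewrite (_ : _ - _ = (2^-1 : R)%:C *: (e%:C *: ((rnorm p)%:S - p) + p * p * p)).
    apply: pos_scale => //; apply: pos_add => //; apply: pos_scale;
      first exact: ltW.
    exact: pos_norm_sub.
  by rewrite bbE !(scalerBr, scalerDr) !alg_scale; zmod.
(* [b b^* + n] is the sum of [b^* b + b b^*] and of [n - b^* b], both positive; invertibility of its
   positive shifts passes to those of [b^* b + n]. *)
have lo : pos (n%:S + star b * b).
  rewrite addrC; apply: pos_of_invertible => [|r r0]; first exact/sa_add/sa_alg.
  rewrite -addrA -alg_add; apply: invertible_swap.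
    by rewrite gt_eqF// ltr_wpDl.
  rewrite alg_add addrA; apply: pos_invertible => //.
  rewrite (_ : _ + _ = star b * b + b * star b + (n%:S - star b * b)); last by zmod.
  exact/pos_add/up/pos_star_mul_add.
have bn : rnorm (star b * b) <= n by exact: pos_between.
(* This bounds [|p|^4 = |p^4|] by [2 e |p|^2], hence [|p|^2] by [2 e = d^2], the reason for the
   choice of [e]. *)
have p3n : rnorm (p * p * p) <= 2 * e * rnorm p.
  rewrite (_ : p * p * p = e%:C *: p - (2 : R)%:C *: (star b * b)).
    rewrite (le_trans (rnormB _ _))// !rnormZr !gtr0_norm//.
    by move: bn; rewrite /n; lra.
  by rewrite bbE scalerA -rmorphM /= mulfV// scale1r; zmod.
have [->|p0] := eqVneq (rnorm p) 0; first exact: ltW.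
have {}p0 : 0 < rnorm p by rewrite lt_def p0 rnorm_ge0.
rewrite -ler_sqr ?nnegrE ?rnorm_ge0 ?(ltW d0)//.
rewrite -(ler_pM2r (exprn_gt0 2 p0)) -exprD.
have -> : rnorm p ^+ (2 + 2) = rnorm (p * p * (p * p)).
  by rewrite rnorm_sa_sqr ?rnorm_sa_sqr// -?exprM//; exact: sa_sqr.
rewrite mulrA (le_trans (rnormM _ _))// (le_trans (ler_wpM2r _ p3n)) ?rnorm_ge0//.
by rewrite /e; lra.
Qed.

End Positive.

(** * States *)

Section HahnBanach.
Context {R : realType} {V : lmodType R[i]}.
Implicit Types (p q : V -> R) (u v w x y : V).

Definition sublinear q := (forall u v, q (u + v) <= q u + q v) /\
  (forall (t : R) u, 0 < t -> q (t%:C *: u) <= t * q u).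

Lemma sublinear0 q : sublinear q -> q 0 = 0.
Proof.
move=> [qD qZ]; have := qD 0 0; have /(_ 0) := @qZ 2^-1 _ _.
rewrite invr_gt0 scaler0 addr0 ltr0n => /(_ isT) h1 h2.
by apply/le_anti/andP; split; lra.
Qed.

Lemma sublinearZ q (t : R) u : sublinear q -> 0 <= t -> q (t%:C *: u) = t * q u.
Proof.
move=> sq; rewrite le_eqVlt => /predU1P[<-|t0].
  by rewrite scale0r mul0r sublinear0.
case: sq => _ qZ; apply/le_anti; rewrite qZ//=.
rewrite -ler_pdivlMl// (le_trans _ (qZ _ _ _)) ?invr_gt0//.
by rewrite scalerA -rmorphM /= mulVf ?gt_eqF// scale1r.
Qed.

Lemma sublinear_lb q u v : sublinear q -> q v - q (- u) <= q (u + v).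
Proof.
by move=> [qD _]; have := qD (- u) (u + v); rewrite addKr; lra.
Qed.

(** A lowering of [q] that stays sublinear and is at most [- q x] at [- x]. Minimality of a
    functional [f] against its lowering along [v] reads [f u <= f (u + v) - f v], hence additivity;
    lowering [p] along [x] beforehand secures [f x = p x]. *)
Definition lower_along q x y :=
  inf [set q (y + t%:C *: x) - t * q x | t in [set t : R | 0 <= t]].

Lemma lower_along_lb q x y : sublinear q -> has_inf
  [set q (y + t%:C *: x) - t * q x | t in [set t : R | 0 <= t]].
Proof.
move=> sq; split; first by exists (q (y + (0 : R)%:C *: x) - 0 * q x), 0 => /=.
exists (- q (- y)) => _ [t /= t0 <-].
have := sublinear_lb y (t%:C *: x) sq.
by rewrite (sublinearZ _ sq t0); lra.
Qed.

Lemma lower_along_le q x y (t : R) : sublinear q -> 0 <= t ->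
  lower_along q x y <= q (y + t%:C *: x) - t * q x.
Proof.
by move=> sq t0; apply: (ge_inf (lower_along_lb x y sq).2); exists t.
Qed.

Lemma lower_along_ge q x y (m : R) : sublinear q ->
  (forall t : R, 0 <= t -> m <= q (y + t%:C *: x) - t * q x) ->
  m <= lower_along q x y.
Proof.
move=> sq H; apply: lb_le_inf; first exact: (lower_along_lb x y sq).1.
by move=> _ [t /= t0 <-]; exact: H.
Qed.

Lemma lower_along_sublinear q x : sublinear q -> sublinear (lower_along q x).
Proof.
move=> sq; split=> [u v|t u t0].
- rewrite -lerBlDr; apply: lower_along_ge => // s s0.
  rewrite lerBlDr -lerBlDl; apply: lower_along_ge => // r r0.
  rewrite lerBlDr (le_trans (lower_along_le x (u + v) sq (addr_ge0 r0 s0)))//.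
  rewrite rmorphD scalerDl (_ : u + v + _ = v + r%:C *: x + (u + s%:C *: x));
    last by zmod.
  by have := sq.1 (v + r%:C *: x) (u + s%:C *: x); lra.
- rewrite -ler_pdivrMl//; apply: lower_along_ge => // s s0.
  have ts : 0 <= t * s by rewrite mulr_ge0// ltW.
  rewrite ler_pdivrMl// (le_trans (lower_along_le x _ sq ts))//.
  rewrite rmorphM -scalerA -scalerDr mulrBr mulrA lerD2r.
  exact: sq.2.
Qed.

Lemma lower_along_self q x y : sublinear q -> lower_along q x y <= q y.
Proof.
move=> sq; rewrite (le_trans (lower_along_le x y sq (lexx 0)))//.
by rewrite scale0r addr0 mul0r subr0.
Qed.

(** Zorn's lemma for the reversed pointwise order. The infimum along a chain is finite since
    [q v >= - p (- v)], and sublinear since two members are always comparable; [p] itself bounds the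
    empty chain. *)
Lemma minimal_sublinear p : sublinear p ->
  exists q, [/\ sublinear q, (forall v, q v <= p v) &
    forall q', sublinear q' -> (forall v, q' v <= q v) -> forall v, q v <= q' v].
Proof.
move=> sp; pose T := {q : V -> R | sublinear q /\ forall v, q v <= p v}.
pose le_T (q q' : T) := `[< forall v, sval q' v <= sval q v >].
have [||F totF|[q [sq qp]] qmin] :=
  @ZL_preorder T (exist _ p (conj sp (fun v => lexx (p v)))) le_T.
- by move=> q; apply/asboolP.
- by move=> q1 q2 q3 /asboolP h1 /asboolP h2; apply/asboolP => v;
    exact: le_trans (h1 v).
- have [[q0 Fq0]|F0] := pselect (exists q : T, F q); last first.
    exists (exist _ p (conj sp (fun v => lexx (p v)))) => q Fq.
    by case: F0; exists q.
  pose m v := inf [set sval q v | q in F].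
  have infm v : has_inf [set sval q v | q in F].
    split; first by exists (sval q0 v), q0.
    exists (- p (- v)) => _ [[q [sq qp]] Fq <-] /=.
    have := sublinear_lb v 0 sq; rewrite addr0 sublinear0//.
    by have := qp (- v); lra.
  have mle v (q : T) : F q -> m v <= sval q v.
    by move=> Fq; apply: (ge_inf (infm v).2); exists q.
  have sm : sublinear m.
    split=> [u v|t u t0].
    - apply/ler_addgt0Pr => e e0; have e2 : 0 < e / 2 by rewrite divr_gt0.
      have [_ [q1 Fq1 <-] h1] := inf_adherent e2 (infm u).
      have [_ [q2 Fq2 <-] h2] := inf_adherent e2 (infm v).
      have [q [Fq l1 l2]] : exists q : T, [/\ F q,
        sval q u <= sval q1 u & sval q v <= sval q2 v].
        by have [/asboolP l|/asboolP l] := totF _ _ Fq1 Fq2; [exists q2|exists q1].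
      have := (svalP q).1.1 u v; have := mle (u + v) q Fq.
      by rewrite -/(m u) -/(m v) in h1 h2 *; lra.
    - rewrite -ler_pdivrMl//; apply: lb_le_inf; first exact: (infm u).1.
      move=> _ [q Fq <-]; rewrite ler_pdivrMl//.
      by rewrite (le_trans (mle _ q Fq))//; exact: (svalP q).1.2.
  have mp v : m v <= p v by rewrite (le_trans (mle v q0 Fq0))//;
    exact: (svalP q0).2.
  exists (exist _ m (conj sm mp)) => q Fq; apply/asboolP => v /=; exact: mle.
exists q; split => // q' sq' q'q v.
have q'p u : q' u <= p u by rewrite (le_trans (q'q u)).
have /asboolP := qmin (exist _ q' (conj sq' q'p)) (asboolT q'q).
exact.
Qed.

(* A minimal sublinear functional is linear. *)
Theorem hahn_banach p x : sublinear p ->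
  exists f : V -> R, [/\ {morph f : u v / u + v},
    (forall (t : R) u, f (t%:C *: u) = t * f u),
    (forall u, f u <= p u) & f x = p x].
Proof.
move=> sp; have sp' := lower_along_sublinear x sp.
have [f [sf fp' fmin]] := minimal_sublinear sp'.
have fD : {morph f : u v / u + v}.
  move=> u v; apply/le_anti; rewrite sf.1/=.
  have := fmin _ (lower_along_sublinear v sf) (fun y => lower_along_self v y sf) u.
  move=> /le_trans/(_ (lower_along_le v u sf ler01)).
  by rewrite scale1r mul1r lerBrDr.
have fN u : f (- u) = - f u.
  by apply/eqP; rewrite -addr_eq0 -fD addNr sublinear0.
have fp u : f u <= p u by rewrite (le_trans (fp' u))// lower_along_self.
exists f; split => // [t u|].
- have [t0|t0] := leP 0 t; first exact: sublinearZ.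
  rewrite -[t]opprK rmorphN scaleNr fN sublinearZ ?oppr_ge0 ?ltW//.
  by rewrite !mulNr opprK.
- apply/le_anti; rewrite fp/=.
  have := fp' (- x); rewrite fN => /le_trans/(_ (lower_along_le x (- x) sp ler01)).
  by rewrite scale1r addNr sublinear0// mul1r sub0r lerN2.
Qed.

End HahnBanach.

(** * Norming states of self-adjoint elements *)

Section States.
Context {R : realType} {A : cstarAlgType R}.
Implicit Types (a b h x y : A) (phi psi : A -> R[i]).
Local Notation sa := (self_adjoint A).
Local Notation Re := complex.Re.
Local Notation Im := complex.Im.

Lemma cre_unique x y : sa x -> sa y -> cre (x + 'i *: y) = x.
Proof.
move=> sx sy; rewrite /cre starD (starZ 'i) conjCi sx sy scaleNr.
by rewrite addrACA subrr addr0 scalerDr half_add.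
Qed.

Lemma cim_unique x y : sa x -> sa y -> cim (x + 'i *: y) = y.
Proof.
move=> sx sy; rewrite /cim starD (starZ 'i) conjCi sx sy !scaleNr.
rewrite (_ : _ - _ = 'i *: (y + y)); last by rewrite scalerDr; zmod.
by rewrite scalerA -expr2 sqrCi scaleN1r opprK scalerDr half_add.
Qed.

Lemma cre_sa x : sa x -> cre x = x.
Proof. by move=> sx; rewrite /cre sx scalerDr half_add. Qed.

Lemma cim_sa x : sa x -> cim x = 0.
Proof. by move=> sx; rewrite /cim sx subrr !scaler0. Qed.

Lemma complexi (z : R[i]) : z = (Re z)%:C + 'i * (Im z)%:C.
Proof. by rewrite -complexiE -complexE. Qed.

Lemma creZD (c : R[i]) a b :
  cre (c *: a + b) = (Re c)%:C *: cre a - (Im c)%:C *: cim a + cre b /\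
  cim (c *: a + b) = (Re c)%:C *: cim a + (Im c)%:C *: cre a + cim b.
Proof.
move: (cre_cim a) (cre_cim b) (sa_cre a) (sa_cim a) (sa_cre b) (sa_cim b).
move: (cre a) (cim a) (cre b) (cim b) => x y x' y' <- <- sx sy sx' sy'.
have -> : c *: (x + 'i *: y) + (x' + 'i *: y') =
    (Re c)%:C *: x - (Im c)%:C *: y + x' +
    'i *: ((Re c)%:C *: y + (Im c)%:C *: x + y').
  rewrite {1}(complexi c) !(scalerDr, scalerDl) !scalerA.
  rewrite [_%:C * 'i]mulrC ['i * _ * 'i]mulrAC -expr2 sqrCi mulN1r scaleNr.
  by zmod.
have s1 : sa ((Re c)%:C *: x - (Im c)%:C *: y + x').
  by apply/sa_add/sx'/sa_sub; exact: sa_scale.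
have s2 : sa ((Re c)%:C *: y + (Im c)%:C *: x + y').
  by apply/sa_add/sy'/sa_add; exact: sa_scale.
by rewrite cre_unique ?cim_unique.
Qed.

(** Positivity is read off [|t - a^* a| <= t]: applying [f] to [t - a^* a] gives a value at most
    [t], so [f] is nonnegative at [a^* a]. *)
Lemma complexification_state (f : A -> R) :
  {morph f : u v / u + v} -> (forall (t : R) u, f (t%:C *: u) = t * f u) ->
  (forall u, f u <= rnorm u) -> f 1 = 1 ->
  state_space A (fun a => (f (cre a))%:C + 'i * (f (cim a))%:C).
Proof.
move=> fD fZ fn f1.
have f0 : f 0 = 0 by rewrite -(scale0r (0 : A)) (fZ 0) mul0r.
have fN u : f (- u) = - f u by apply/eqP; rewrite -addr_eq0 -fD addNr f0.
split=> [c a b||a].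
- have [-> ->] := creZD c a b.
  move: (cre a) (cim a) (cre b) (cim b) => x y x' y'.
  rewrite !fD fN !fZ; move: (f x) (f y) (f x') (f y') => p q p' q' /=.
  rewrite [c *: _]/(c * _) -complexiE.
  by apply/eqP; case: c => c d; rewrite eq_complex /=; apply/andP; split;
    apply/eqP; ring.
- by rewrite cre_sa ?cim_sa ?f1 ?f0 ?mulr0 ?addr0//; exact: sa1.
- have sa_a := sa_star_mul a.
  rewrite cre_sa// cim_sa// f0 mulr0 addr0 ler0c.
  have [t ta] := pos_star_mul a.
  have := le_trans (fn _) ta; rewrite fD fN fZ f1; lra.
Qed.

Lemma rnorm_sublinear : sublinear (fun a : A => rnorm a).
Proof.
split=> [u v|t u t0]; first exact: rnormD.
by rewrite rnormZr gtr0_norm.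
Qed.

(** If both norms were below [2 s], with maximum [m], then [h] would lie between [s - m] and
    [m - s], and its norm would be at most [m - s < s]. *)
Lemma rnorm_shift h : sa h ->
  rnorm ((rnorm h)%:S + h) = 2 * rnorm h \/ rnorm ((rnorm h)%:S - h) = 2 * rnorm h.
Proof.
move=> sh; set s := rnorm h.
have s0 : 0 <= s by exact: rnorm_ge0.
have le1 : rnorm (s%:S + h) <= 2 * s.
  by rewrite (le_trans (rnormD _ _))// rnorm_alg ger0_norm// -/s; lra.
have le2 : rnorm (s%:S - h) <= 2 * s.
  by rewrite (le_trans (rnormB _ _))// rnorm_alg ger0_norm// -/s; lra.
have [->|n1] := eqVneq (rnorm (s%:S + h)) (2 * s); first by left.
have [->|n2] := eqVneq (rnorm (s%:S - h)) (2 * s); first by right.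
pose m := Num.max (rnorm (s%:S + h)) (rnorm (s%:S - h)).
have m2 : m < 2 * s by rewrite gt_max !lt_neqAle n1 n2 le1.
have : rnorm h <= m - s.
  apply: pos_between => //.
  - have -> : (m - s)%:S - h = m%:S - (s%:S + h) by rewrite alg_sub; zmod.
    by apply: pos_norm_sub; rewrite le_max lexx.
  - have -> : (m - s)%:S + h = m%:S - (s%:S - h) by rewrite alg_sub; zmod.
    by apply: pos_norm_sub; rewrite le_max lexx orbT.
by rewrite -/s; lra.
Qed.

(** A functional that norms [h] itself need not be unital. One that norms [|h| + h'], where [h'] is
    [h] or [- h] and the norm is [2 |h|], must satisfy [f 1 = 1] and [f h' = |h|], since these are
    the largest possible values. *)
Lemma exists_norming_state h : sa h ->
  exists2 phi, state_space A phi & rnorm (phi h) = rnorm h.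
Proof.
move=> sh.
have cn (t : R) : rnorm (t%:C : R[i]) = `|t|.
  by rewrite /rnorm normc_def /= expr0n /= addr0 sqrtr_sqr.
(* For [h = 0] any state will do; norming the unit provides one. *)
have [h0|h0] := eqVneq (rnorm h) 0.
  have [f [fD fZ fn f1]] := hahn_banach (1 : A) rnorm_sublinear.
  exists (fun a => (f (cre a))%:C + 'i * (f (cim a))%:C).
    by apply: complexification_state => //; rewrite f1 rnorm1.
  rewrite cre_sa// cim_sa// (rnorm_eq0 h0) -(scale0r (0 : A)) (fZ 0)
    mul0r mulr0 addr0.
  by rewrite scale0r rnorm0 cn normr0.
have {}h0 : 0 < rnorm h by rewrite lt_def h0 rnorm_ge0.
suff [h' [sh' hh' hN]] : exists h', [/\ sa h', h' = h \/ h' = - h &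
    rnorm ((rnorm h)%:S + h') = 2 * rnorm h].
  have [f [fD fZ fn fh]] := hahn_banach ((rnorm h)%:S + h') rnorm_sublinear.
  have f0 : f 0 = 0 by rewrite -(scale0r (0 : A)) (fZ 0) mul0r.
  have fN u : f (- u) = - f u by apply/eqP; rewrite -addr_eq0 -fD addNr f0.
  have := fn 1; rewrite rnorm1 => f1.
  have fh' : f h' <= rnorm h by rewrite (le_trans (fn _))//;
    case: hh' => -> //; rewrite rnormN.
  move: fh; rewrite hN fD fZ => fh.
  have {}f1 : f 1 = 1.
    apply/le_anti; rewrite f1/= -(ler_pM2l h0) mulr1; lra.
  exists (fun a => (f (cre a))%:C + 'i * (f (cim a))%:C).
    exact: complexification_state.
  rewrite cre_sa// cim_sa// f0 mulr0 addr0 cn.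
  have {}fh : f h' = rnorm h by move: fh; rewrite f1; lra.
  case: hh' fh => -> ; rewrite ?fN => fh; first by rewrite fh gtr0_norm.
  by rewrite -normrN fh gtr0_norm.
have [hp|hm] := rnorm_shift sh; first by exists h; split => //; left.
by exists (- h); split => //; [exact: sa_opp|right].
Qed.

End States.

(** * The modulus of complex numbers *)

Section ComplexNorm.
Context {R : realType}.
Implicit Types z w : R[i].

Lemma cnormE z : (rnorm z)%:C = `|z|.
Proof. exact: (@rnormE R R[i]^o). Qed.

Lemma cnorm_ge0 z : 0 <= rnorm z.
Proof. exact: (@rnorm_ge0 R R[i]^o). Qed.

Lemma cnorm0 : rnorm (0 : R[i]) = 0.
Proof. exact: (@rnorm0 R R[i]^o). Qed.

Lemma cnorm_eq0 z : rnorm z = 0 -> z = 0.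
Proof. exact: (@rnorm_eq0 R R[i]^o). Qed.

Lemma cnormN z : rnorm (- z) = rnorm z.
Proof. exact: (@rnormN R R[i]^o). Qed.

Lemma cnormD z w : rnorm (z + w) <= rnorm z + rnorm w.
Proof. exact: (@rnormD R R[i]^o). Qed.

Lemma cnorm_distC z w : rnorm (z - w) = rnorm (w - z).
Proof. exact: (@rnorm_distC R R[i]^o). Qed.

Lemma cnorm_distD v z w : rnorm (z - w) <= rnorm (z - v) + rnorm (v - w).
Proof. exact: (@rnorm_distD R R[i]^o). Qed.

Lemma cnormM z w : rnorm (z * w) = rnorm z * rnorm w.
Proof. by apply: complexI; rewrite rmorphM /= !cnormE normrM. Qed.

Lemma cnorm_real (t : R) : rnorm (t%:C : R[i]) = `|t|.
Proof. by rewrite /rnorm normc_def /= expr0n /= addr0 sqrtr_sqr. Qed.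

Lemma cnorm_Re z : `|complex.Re z| <= rnorm z.
Proof. by rewrite -lecR cnormE normc_ge_Re. Qed.

Lemma cnorm_i z : rnorm ('i * z) = rnorm z.
Proof. exact: (@rnormZi R R[i]^o). Qed.

End ComplexNorm.

Section StateTheory.
Context {R : realType} {A : cstarAlgType R} (phi : A -> R[i])
  (phiS : state_space A phi).
Implicit Types (a b h x y : A).
Local Notation sa := (self_adjoint A).

Lemma stateZD (c : R[i]) a b : phi (c *: a + b) = c * phi a + phi b.
Proof. by case: phiS => lphi _ _; exact: lphi. Qed.

Lemma state1 : phi 1 = 1.
Proof. by case: phiS. Qed.

Lemma state_pos a : 0 <= phi (star a * a).
Proof. by case: phiS. Qed.

Lemma stateD a b : phi (a + b) = phi a + phi b.
Proof. by rewrite -[a in LHS]scale1r stateZD mul1r. Qed.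

Lemma state0 : phi 0 = 0.
Proof. by apply: (@addIr _ (phi 0)); rewrite -stateD !add0r. Qed.

Lemma stateZ (c : R[i]) a : phi (c *: a) = c * phi a.
Proof. by rewrite -[c *: a]addr0 stateZD state0 addr0. Qed.

Lemma stateN a : phi (- a) = - phi a.
Proof. by rewrite -scaleN1r stateZ mulN1r. Qed.

Lemma stateB a b : phi (a - b) = phi a - phi b.
Proof. by rewrite stateD stateN. Qed.

Lemma state_alg (t : R) : phi t%:S = t%:C.
Proof. by rewrite stateZ state1 mulr1. Qed.

Lemma state_sa_real h : sa h -> phi h = (complex.Re (phi h))%:C.
Proof.
move=> sh; suff hr : phi h \is Num.real by rewrite RRe_real.
have sqr_ge0' k : sa k -> phi (k * k) \is Num.real.
  by move=> sk; rewrite ger0_real// -[X in X * _]sk state_pos.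
suff -> : phi h = (phi ((1 + h) * (1 + h)) - phi ((1 - h) * (1 - h))) / 4.
  apply/rpred_div/realn/rpredB; apply: sqr_ge0'.
    exact/sa_add/sh/sa1.
  exact/sa_sub/sh/sa1.
rewrite -stateB (_ : _ - _ = h + h + (h + h)); last by ncring.
by rewrite !stateD; field.
Qed.

(** For self-adjoint [h] and [s > |h|], [1 - h / s] is a square, hence the value at [h] is at most
    [s]. In general the phase [c] makes [phi (c a)] real and equal to [|phi a|]; it is then the
    value at the real part of [c a]. *)
Lemma state_le_norm a : rnorm (phi a) <= rnorm a.
Proof.
have sa_le1 h (s : R) : sa h -> rnorm h < s -> complex.Re (phi h) <= s.
  move=> sh hs; have s0 : 0 < s by exact: le_lt_trans (rnorm_ge0 _) hs.
  have h1 : rnorm ((s^-1)%:C *: h) < 1.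
    by rewrite rnormZr gtr0_norm ?invr_gt0// mulrC ltr_pdivrMr// mul1r.
  have [b [sb bb _ _]] := sqrt_one_sub (sa_scale s^-1 sh) h1.
  have := state_pos b; rewrite sb bb stateB state1 stateZ (state_sa_real sh).
  rewrite -rmorphM -[1]/((1 : R)%:C) -rmorphB ler0c subr_ge0.
  by rewrite mulrC ler_pdivrMr// mul1r.
have sa_le h : sa h -> complex.Re (phi h) <= rnorm h.
  by move=> sh; apply/ler_addgt0Pr => e e0; apply: sa_le1 => //; rewrite ltrDl.
have [z0|z0] := eqVneq (phi a) 0; first by rewrite z0 cnorm0 rnorm_ge0.
pose c := `|phi a| / phi a.
have cphi : phi (c *: a) = (rnorm (phi a))%:C.
  by rewrite stateZ /c divfK// cnormE.
have c1 : complex.Re `|c| = 1.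
  by rewrite /c normrM normfV normr_id divff// normr_eq0.
have -> : rnorm (phi a) = complex.Re (phi (cre (c *: a))).
  have : complex.Re (phi (c *: a)) = rnorm (phi a) by rewrite cphi.
  rewrite -{1}(cre_cim (c *: a)) stateD (stateZ 'i).
  rewrite (state_sa_real (sa_cre _)) (state_sa_real (sa_cim _)) -complexiE.
  by move: (complex.Re _) (complex.Re (phi (cim _))) => u v <- /=; ring.
rewrite (le_trans (sa_le _ (sa_cre _)))// (le_trans (rnorm_cre _))//.
by rewrite rnormZ c1 mul1r.
Qed.

End StateTheory.

Section StateNorm.
Context {R : realType} {A : cstarAlgType R}.

Lemma rnorm_le_states (h : A) (K : R) : self_adjoint A h ->
  (forall phi, state_space A phi -> rnorm (phi h) <= K) -> rnorm h <= K.
Proof. by move=> /exists_norming_state[phi sp <-]; apply. Qed.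

Lemma state_exists : exists phi, state_space A phi.
Proof. by have [phi] := exists_norming_state (@sa1 R A); exists phi. Qed.

Lemma state_convex (phi psi : A -> R[i]) (t : R) :
  state_space A phi -> state_space A psi -> 0 <= t <= 1 ->
  state_space A (fun a => t%:C * phi a + (1 - t)%:C * psi a).
Proof.
move=> sp sq /andP[t0 t1]; split=> [c a b||a].
- rewrite (stateZD sp) (stateZD sq); move: t%:C (1 - t)%:C => u v.
  transitivity (c * (u * phi a + v * psi a) + (u * phi b + v * psi b)) => //.
  by ring.
- by rewrite !state1// !mulr1 -rmorphD addrC subrK.
- by rewrite addr_ge0// mulr_ge0 ?state_pos ?ler0c ?subr_ge0.
Qed.

End StateNorm.

Section Morphisms.
Context {R : realType} {A B : cstarAlgType R} (f : {lrmorphism A -> B})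
  (fs : star_morphism f).

Lemma state_comp psi : state_space B psi -> state_space A (psi \o f).
Proof.
move=> sp; split=> [c a b||a] /=.
- by rewrite linearD linearZ /= stateZD.
- by rewrite rmorph1 state1.
- by rewrite rmorphM /= fs state_pos.
Qed.

Lemma star_morphism_sa a : self_adjoint A a -> self_adjoint B (f a).
Proof. by rewrite /self_adjoint /= -fs => ->. Qed.

(** By the C*-identity only [a^* a] matters; its image is self-adjoint, so that states detect its
    norm, and states pull back to states. *)
Lemma star_morphism_contractive a : rnorm (f a) <= rnorm a.
Proof.
rewrite -ler_sqr ?nnegrE ?rnorm_ge0// -!rnorm_cstar -fs -rmorphM.
apply: rnorm_le_states; first exact/star_morphism_sa/sa_star_mul.
by move=> psi sp; exact: (state_le_norm (state_comp sp)).
Qed.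

End Morphisms.

(** * Compactness of the Lipschitz balls *)

Section Ultra.

(** Stated without topology so as to serve both states and elements of the algebra. Without a finite
    net, the complements of the finite unions of the [B x] generate a proper filter, and an
    ultrafilter above it contains no [B x]. *)
Lemma ultra_finite_net (T : eqType) (K : set T) (B : T -> set T) :
  (forall F : set_system T, UltraFilter F -> F K -> exists2 x, K x & F (B x)) ->
  exists s : seq T, (forall x, x \in s -> K x) /\
    forall y, K y -> exists2 x, x \in s & B x y.
Proof.
move=> ultraK; apply: contrapT => nos.
pose C (s : seq T) := [set y | K y /\ forall x, x \in s -> ~ B x y].
pose D := [set s : seq T | forall x, x \in s -> K x].
have FF : Filter (filter_from D C).
  apply: filter_from_filter; first by exists [::].
  move=> s s' Ds Ds'; exists (s ++ s').
    by move=> x; rewrite mem_cat => /orP[/Ds|/Ds'].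
  by move=> y [Ky Cy]; split; split => // x xs; apply: Cy; rewrite mem_cat xs ?orbT.
have PF : ProperFilter (filter_from D C).
  apply: filter_from_proper => s Ds; apply: contrapT => Cs0.
  apply: nos; exists s; split => // y Ky.
  apply: contrapT => nB; apply: Cs0; exists y; split => // x xs Bxy.
  by apply: nB; exists x.
have [F [UF sF]] := ultraFilterLemma PF.
have FK : F K by apply: sF; exists [::] => // y [].
have [x Kx FBx] := ultraK F UF FK.
have FC : F (C [:: x]).
  by apply: sF; exists [:: x] => // y; rewrite inE => /eqP ->.
have [y [[_ Cy] Bxy]] := filter_ex (filterI FC FBx).
exact: (Cy x (mem_head _ _) Bxy).
Qed.

Lemma ultra_bounded_lim (R : realType) (T : Type) (F : set_system T)
    (u : T -> R) (K : R) : UltraFilter F -> F [set t | `|u t| <= K] ->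
  exists l : R, forall e, 0 < e -> F [set t | `|u t - l| < e].
Proof.
move=> UF FK.
have PF : ProperFilter (u @ F) by exact: fmap_proper_filter.
have [|l [_ cl]] := @segment_compact R (- K) K (u @ F) PF.
  change (F [set t | u t \in `[- K, K]]).
  by apply: filterS FK => t /=; rewrite in_itv /= ler_norml.
exists l => e e0.
have [//|FC] := in_ultra_setVsetC [set t | `|u t - l| < e] UF.
have [|y [/= yl le]] :=
  cl [set x | e <= `|x - l|] (ball l e) _ (nbhsx_ballx l e e0).
  change (F [set t | e <= `|u t - l|]).
  by apply: filterS FC => t /=; rewrite leNgt => /negP.
by move: le; rewrite /ball /= distrC ltNge yl.
Qed.

Lemma ultra_bounded_clim (R : realType) (T : Type) (F : set_system T)
    (u : T -> R[i]) (K : R) : UltraFilter F -> F [set t | rnorm (u t) <= K] ->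
  exists l : R[i], forall e, 0 < e -> F [set t | rnorm (u t - l) < e].
Proof.
move=> UF FK.
have [|r rP] := @ultra_bounded_lim R T F (fun t => complex.Re (u t)) K UF.
  by apply: filterS FK => t /=; apply: le_trans; exact: cnorm_Re.
have [|s sP] := @ultra_bounded_lim R T F (fun t => complex.Im (u t)) K UF.
  apply: filterS FK => t /=; apply: le_trans.
  rewrite -(cnorm_i (u t)) -complexiE -normrN.
  by case: (u t) => a b; rewrite (le_trans _ (cnorm_Re _))//= mul0r mul1r sub0r.
exists (r%:C + 'i * s%:C) => e e0; have e2 : 0 < e / 2 by rewrite divr_gt0.
apply: filterS2 (rP _ e2) (sP _ e2) => t /= h1 h2.
rewrite {1}(complexi (u t)) opprD addrACA -mulrBr -!rmorphB.
rewrite (le_lt_trans (cnormD _ _))// cnorm_i !cnorm_real (splitr e).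
exact: ltrD.
Qed.

End Ultra.

Section StateCompact.
Context {R : realType} {A : cstarAlgType R}.
Local Notation states := (state_space A : set {ptws A -> R[i]^o}).

(** The Banach-Alaoglu argument: the values at [a] stay in the disc of radius [|a|], so they
    converge along [F], and the conditions that define a state are closed. *)
Lemma ultra_state_pointwise (F : set_system (A -> R[i])) : UltraFilter F ->
  F (state_space A) -> exists2 phi, state_space A phi &
  forall a (e : R), 0 < e -> F [set psi | rnorm (psi a - phi a) < e].
Proof.
move=> UF FS.
have lim a : exists l : R[i], forall e : R, 0 < e -> F [set psi : A ->
  R[i] | rnorm (psi a - l) < e].
  apply: (@ultra_bounded_clim _ _ _ (fun psi : A -> R[i] => psi a) (rnorm a)).
  by apply: filterS FS => psi sp /=; exact: state_le_norm.
have [phi phiP] := choice lim.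
exists phi => //; split=> [c a b||a].
- apply/subr0_eq/cnorm_eq0/le_anti; rewrite cnorm_ge0 andbT.
  apply/ler_addgt0Pr => e e0; rewrite add0r.
  have K0 : 0 < rnorm c + 2 by rewrite ltr_wpDl// cnorm_ge0.
  have d0 := divr_gt0 e0 K0; set d := e / _ in d0.
  have [psi [[sp h1] [h2 h3]]] :=
    filter_ex (filterI (filterI FS (phiP (c *: a + b) _ d0))
    (filterI (phiP a _ d0) (phiP b _ d0))).
  rewrite (_ : _ - _ = (phi (c *: a + b) - psi (c *: a + b)) +
    (c * (psi a - phi a) + (psi b - phi b))); last first.
    rewrite (stateZD sp) mulrBr.
    transitivity (phi (c *: a + b) - (c * phi a + phi b)) => //; ring.
  rewrite (le_trans (cnormD _ _))//.
  rewrite (le_trans (lerD (lexx _) (cnormD _ _)))// cnormM.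
  have -> : e = d + (rnorm c * d + d) by rewrite /d; field; rewrite gt_eqF.
  apply: lerD; first by rewrite cnorm_distC ltW.
  by apply: lerD; [apply: ler_wpM2l; [exact: cnorm_ge0|exact: ltW]|exact: ltW].
- apply/subr0_eq/cnorm_eq0/le_anti; rewrite cnorm_ge0 andbT.
  apply/ler_addgt0Pr => e e0; rewrite add0r.
  have [psi [sp /= h]] := filter_ex (filterI FS (phiP 1 _ e0)).
  by rewrite cnorm_distC -(state1 sp) ltW.
(* An inequality [0 <= z] in [R[i]] also says that [z] is real, so both parts of the limit are
   estimated. *)
- set z := phi _; have zP := phiP (star a * a); rewrite -/z in zP.
  have h (w : R[i]) (e : R) : 0 <= w -> rnorm (w - z) < e ->
    - e < complex.Re z /\ `|complex.Im z| < e.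
    move=> w0 wz; have wR : complex.Im w = 0 by apply: ger0_Im.
    have wR0 : 0 <= complex.Re w by move: w0; rewrite lecE => /andP[].
    split.
      have := le_lt_trans (cnorm_Re _) wz;
        rewrite raddfB /= ltr_norml => /andP[_]; lra.
    have : rnorm ('i * (w - z)) < e by rewrite cnorm_i.
    move=> /(le_lt_trans (cnorm_Re _)); rewrite -complexiE.
    move: w z wR {w0 wz wR0 zP}; case=> w1 w2; case=> z1 z2 /= ->.
    by rewrite mul0r mul1r !sub0r opprK.
  have h' (e : R) : 0 < e -> - e < complex.Re z /\ `|complex.Im z| < e.
    move=> e0; have [psi [sp /= pz]] := filter_ex (filterI FS (zP _ e0)).
    exact: h (state_pos sp a) pz.
  rewrite lecE /=; apply/andP; split.
    rewrite -normr_eq0 eq_le normr_ge0 andbT; apply/ler_addgt0Pr => e /h'[_].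
    by rewrite add0r => /ltW.
  by apply/ler_addgt0Pr => e /h'[/ltW + _]; rewrite lerNl => ez;
    rewrite -lerBlDl sub0r.
Qed.

Lemma ultra_state_cvg (F : set_system {ptws A -> R[i]^o}) : UltraFilter F ->
  F states -> exists2 phi, state_space A phi & F --> (phi : {ptws A -> R[i]^o}).
Proof.
move=> UF FS; have [phi sphi phiP] := ultra_state_pointwise UF FS.
exists phi => //; apply/pointwise_cvgP => a U /= /nbhs_rnorm[e e0 eU].
change (F [set psi : A -> R[i] | U (psi a)]).
by apply: filterS (phiP a e e0) => psi /= h; apply: eU; rewrite cnorm_distC.
Qed.

End StateCompact.

(* The part of the definition of an L-seminorm which involves neither the product
   nor the topology of the state space. *)
Record real_seminorm {R : realType} (A : cstarAlgType R) (dom : set A)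
    (L : A -> R) : Prop := {
  rs_sa : dom `<=` self_adjoint A ;
  rs_dense : self_adjoint A `<=` closure dom ;
  rs_add : forall a b, dom a -> dom b -> dom (a + b) ;
  rs_scale : forall (t : R) a, dom a -> dom (t%:C *: a) ;
  rs_ge0 : forall a, dom a -> 0 <= L a ;
  rs_addL : forall a b, dom a -> dom b -> L (a + b) <= L a + L b ;
  rs_scaleL : forall (t : R) a, dom a -> L (t%:C *: a) = `|t| * L a ;
  rs_eq0 : [set a | dom a /\ L a = 0] = [set t%:C *: (1 : A) | t in [set: R]]
}.

Section RealSeminorm.
Context {R : realType} {A : cstarAlgType R} {dom : set A} {L : A -> R}
  (LP : real_seminorm dom L).
Implicit Types (a b : A) (phi psi : A -> R[i]).
Local Notation mk := (mk_dist dom L).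

Lemma dom_alg (t : R) : dom t%:S.
Proof.
have : [set a | dom a /\ L a = 0] t%:S by rewrite (rs_eq0 LP); exists t.
by case.
Qed.

Lemma L_alg (t : R) : L t%:S = 0.
Proof.
have : [set a | dom a /\ L a = 0] t%:S by rewrite (rs_eq0 LP); exists t.
by case.
Qed.

Lemma dom_opp a : dom a -> dom (- a).
Proof.
move=> da; have -> : - a = (-1 : R)%:C *: a by rewrite rmorphN1 scaleN1r.
exact: (rs_scale LP).
Qed.

Lemma L_opp a : dom a -> L (- a) = L a.
Proof.
move=> da; have -> : - a = (-1 : R)%:C *: a by rewrite rmorphN1 scaleN1r.
by rewrite (rs_scaleL LP)// normrN1 mul1r.
Qed.

Lemma dom_sub a b : dom a -> dom b -> dom (a - b).
Proof. by move=> da db; apply: (rs_add LP) => //; exact: dom_opp. Qed.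

Lemma L_sub a b : dom a -> dom b -> L (a - b) <= L a + L b.
Proof.
move=> da db; rewrite -(L_opp db); apply: (rs_addL LP) => //; exact: dom_opp.
Qed.

Lemma L_sub_alg a (t : R) : dom a -> L (a - t%:S) <= L a.
Proof.
by move=> da; rewrite (le_trans (L_sub da (dom_alg t)))// L_alg addr0.
Qed.

Lemma mk_le phi psi (e : R) :
  (forall a, dom a -> L a <= 1 -> rnorm (phi a - psi a) <= e) ->
  (mk phi psi <= e%:E)%E.
Proof.
by move=> H; apply: ge_ereal_sup => _ [a [da La] <-]; rewrite lee_fin H.
Qed.

Lemma mk_lip phi psi (e l : R) a : state_space A phi -> state_space A psi ->
  (mk phi psi <= e%:E)%E -> dom a -> L a <= l -> 0 < l ->
  rnorm (phi a - psi a) <= l * e.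
Proof.
move=> sp sq mke da La l0.
have da' : dom ((l^-1)%:C *: a) by exact: (rs_scale LP).
have La' : L ((l^-1)%:C *: a) <= 1.
  by rewrite (rs_scaleL LP)// gtr0_norm ?invr_gt0// mulrC ler_pdivrMr// mul1r.
have : ((rnorm (phi ((l^-1)%:C *: a) - psi ((l^-1)%:C *: a)))%:E <= mk phi psi)%E.
  by apply: ereal_sup_ubound; exists ((l^-1)%:C *: a).
move=> /le_trans/(_ mke); rewrite lee_fin !stateZ// -mulrBr cnormM cnorm_real.
by rewrite gtr0_norm ?invr_gt0// mulrC ler_pdivrMr// mulrC.
Qed.

Lemma mk_ge0 phi psi : (0 <= mk phi psi)%E.
Proof.
apply: (@le_trans _ _ (rnorm (phi 0 - psi 0))%:E).
  by rewrite lee_fin cnorm_ge0.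
apply: ereal_sup_ubound; exists 0 => //.
by rewrite -(scale0r 1) -[0]/((0 : R)%:C); split; [exact: dom_alg|rewrite L_alg].
Qed.

Lemma mk_sym phi psi : mk phi psi = mk psi phi.
Proof.
congr ereal_sup; apply/seteqP; split=> _ [a aP <-]; exists a => //;
  by rewrite cnorm_distC.
Qed.

Lemma mk_refl phi : mk phi phi = 0%E.
Proof.
apply/le_anti; rewrite mk_ge0 andbT.
by apply: mk_le => a _ _; rewrite subrr cnorm0.
Qed.

Lemma mk_triangle phi psi chi : (mk phi chi <= mk phi psi + mk psi chi)%E.
Proof.
apply: ge_ereal_sup => _ [a [da La] <-].
apply: (@le_trans _ _ ((rnorm (phi a - psi a))%:E + (rnorm (psi a - chi a))%:E)%E).
  by rewrite -EFinD lee_fin cnorm_distD.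
by apply: leeD; apply: ereal_sup_ubound; exists a.
Qed.

Lemma dist_alg (t : R) phi psi a : state_space A phi -> state_space A psi ->
  phi a - psi a = phi (a - t%:S) - psi (a - t%:S).
Proof. by move=> sp sq; rewrite !stateB// !state_alg//; ring. Qed.

End RealSeminorm.

(** * From the Monge-Kantorovich metric to compact Lipschitz balls *)

Section Precompact.
Context {R : realType} {A : cstarAlgType R} {dom : set A} {L : A -> R}
  (LP : real_seminorm dom L).
Implicit Types (a b : A) (phi psi : A -> R[i]).
Local Notation mk := (mk_dist dom L).
Local Notation states := (state_space A : set {ptws A -> R[i]^o}).

Definition lip_ball (r : R) := [set a | [/\ dom a, L a <= 1 & rnorm a <= r]].

Definition lip_bounded (D : R) :=
  forall a, dom a -> L a <= 1 -> exists t : R, rnorm (a - t%:S) <= D.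

(** Norm compactness tested on ultrafilters. Ultrafilters are preserved by images, which handles
    direct sums and limits of sequences without extracting subsequences. *)
Definition ultra_compact (K : set A) := forall F : set_system A,
  UltraFilter F -> F K -> exists2 a, K a &
    forall e : R, 0 < e -> F [set b | rnorm (a - b) < e].

Lemma ultra_compact_net (K : set A) (e : R) : ultra_compact K -> 0 < e ->
  exists s : seq A, (forall b, b \in s -> K b) /\
    forall a, K a -> exists2 b, b \in s & rnorm (b - a) < e.
Proof.
move=> cK e0; apply: (@ultra_finite_net A K (fun b => [set a | rnorm (b - a) < e])).
by move=> F UF FK; have [a Ka aF] := cK F UF FK; exists a => //; exact: aF.
Qed.

(** States are compact for pointwise convergence, and the balls of [mk] are neighbourhoods in that
    topology. *)
Lemma metrizes_net (e : R) : metrizes states mk -> 0 < e ->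
  exists s : seq {ptws A -> R[i]^o}, (forall phi, phi \in s -> state_space A phi) /\
    forall psi, state_space A psi ->
      exists2 phi : {ptws A -> R[i]^o}, phi \in s & (mk phi psi < e%:E)%E.
Proof.
move=> [_ _ _ _ top] e0.
have [F UF FS|s [s1 s2]] := @ultra_finite_net {ptws A -> R[i]^o} states
    (fun phi => [set psi | state_space A psi /\ (mk phi psi < e%:E)%E]).
  have [phi sp Fphi] := ultra_state_cvg UF FS; exists phi => //.
  have /top/(_ [set psi | (mk phi psi < e%:E)%E])[_ H] := sp.
  have : within states (nbhs (phi : {ptws A ->
    R[i]^o})) [set psi | (mk phi psi < e%:E)%E].
    by apply: H; exists e.
  move=> /Fphi FB; apply: filterS2 FS FB => psi /= sq H'; split => //; exact: H'.
exists s; split => // psi /s2[phi ps [_ h]]; by exists phi.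
Qed.

(** A finite net of radius 1 puts every state within [M + 1] of [phi0]. With the scalar
    [t = phi0 a], states detect the norm of [a - t]. *)
Lemma metrizes_lip_bounded : metrizes states mk ->
  exists2 D : R, 0 < D & lip_bounded D.
Proof.
move=> met; have [s [s1 s2]] := metrizes_net met ltr01.
have [phi0 sp0] := @state_exists R A.
have [M M0 sM] : exists2 M : R, 0 <= M & forall phi : {ptws A ->
  R[i]^o}, phi \in s ->
    (mk phi0 phi <= M%:E)%E.
  elim: s s1 {s2} => [|phi s IH] s1; first by exists 0.
  have [|M M0 sM] := IH; first by move=> psi ps; apply: s1; rewrite inE ps orbT.
  have sp : state_space A phi by apply: s1; rewrite mem_head.
  case: met => /(_ phi0 phi sp0 sp)/andP[m0 moo] _ _ _ _.
  have mE : mk phi0 phi = (fine (mk phi0 phi))%:E.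
    by rewrite fineK// ge0_fin_numE.
  exists (Num.max M (fine (mk phi0 phi))); first by rewrite le_max M0.
  move=> psi; rewrite inE => /predU1P[->|/sM h].
    by rewrite mE lee_fin le_max lexx orbT.
  by rewrite (le_trans h)// lee_fin le_max lexx.
exists (M + 1); first by rewrite ltr_wpDl.
move=> a da La; exists (complex.Re (phi0 a)).
have sa_a := rs_sa LP da.
apply: rnorm_le_states; first exact/sa_sub/sa_alg.
move=> psi sp; have [phi ps h] := s2 psi sp.
rewrite stateB// state_alg// -state_sa_real//.
rewrite -[M + 1]mul1r; apply: (mk_lip LP sp sp0 _ da La ltr01).
rewrite mk_sym EFinD (le_trans (mk_triangle phi0 phi psi))//.
by apply: leeD; [exact: sM|exact: ltW].
Qed.

(** An Arzela-Ascoli argument: the elements of the ball are 1-Lipschitz functions on the states, so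
    it suffices that they converge along [F] at the finitely many states of a net. *)
Lemma metrizes_lip_compact (r : R) : metrizes states mk ->
  closed [set a | dom a /\ L a <= 1] -> ultra_compact (lip_ball r).
Proof.
move=> met cl F UF FK.
have [|a aP] := @cvg_filter_rnorm R A F _.
  (* Two evaluations within [e / 8] of [l], and a distance [e / 8] multiplied by [L (a - b) <= 2],
     add up to [e / 2]. *)
  move=> e e0; have e8 : 0 < e / 8 by rewrite divr_gt0.
  have [s [s1 s2]] := metrizes_net met e8.
  have [l lP] : exists l : {ptws A -> R[i]^o} ->
    R[i], F [set a | forall phi, phi \in s ->
      rnorm (phi a - l phi) < e / 8].
    have lim (phi : {ptws A -> R[i]^o}) : exists z : R[i], phi \in s ->
        F [set a | rnorm (phi a - z) < e / 8].
      have [ps|_] := boolP (phi \in s); last by exists 0.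
      have [|z zP] := @ultra_bounded_clim R A F (fun a => phi a) r UF.
        apply: filterS FK => a [_ _] /=; apply: le_trans.
        exact/state_le_norm/s1.
      by exists z => _; exact: zP.
    have [l lP] := choice lim; exists l.
    elim: s {s1 s2 lim} lP => [|phi s IH] lP; first by apply: filterE.
    have h1 : F [set a | forall phi, phi \in s -> rnorm (phi a - l phi) < e / 8].
      by apply: IH => psi ps; apply: lP; rewrite inE ps orbT.
    apply: filterS2 h1 (lP phi (mem_head _ _)) => a /= h1 h2 psi.
    by rewrite inE => /predU1P[->|/h1].
  have [a [[da La _] aP]] := filter_ex (filterI FK lP).
  exists a; apply: filterS2 FK lP => b [db Lb _] /= bP.
  apply: (@le_lt_trans _ _ (e / 2)); last by lra.
  apply: rnorm_le_states => [|psi sp].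
    by apply: sa_sub; exact: (rs_sa LP).
  have [phi ps mkh] := s2 _ sp; have sphi := s1 _ ps.
  have dab : dom (a - b) by exact: (dom_sub LP).
  have Lab : L (a - b) <= 2 by rewrite (le_trans (L_sub LP da db))//; lra.
  have h := mk_lip LP sphi sp (ltW mkh) dab Lab (ltr0Sn R 1).
  rewrite (_ : psi (a - b) = (phi a - l phi) - (phi b - l phi) - (phi (a - b)
    - psi (a - b))); last first.
    by rewrite (stateB sphi); ring.
  rewrite (le_trans (cnormD _ _))// cnormN.
  rewrite (le_trans (lerD (cnormD _ _) (lexx _)))// cnormN.
  by have := aP _ ps; have := bP _ ps; move: h; lra.
have near_a e : 0 < e -> exists2 b, lip_ball r b & rnorm (a - b) < e.
  by move=> e0; have [b [Kb ba]] := filter_ex (filterI FK (aP e e0)); exists b.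
exists a => //.
have [da La] : [set a | dom a /\ L a <= 1] a.
  by move/closed_rnorm: cl; apply=> e /near_a[b [db Lb _] ba]; exists b.
split => //; have /closed_rnorm := @closed_rball R A r;
  apply=> e /near_a[b [_ _ rb] ba].
by exists b.
Qed.

End Precompact.

Arguments lip_ball {R A} dom L r.
Arguments lip_bounded {R A} dom L D.

(** * From compact Lipschitz balls to the Monge-Kantorovich metric *)

Section Metrizes.
Context {R : realType} {A : cstarAlgType R} {dom : set A} {L : A -> R}
  (LP : real_seminorm dom L) {D : R} (D0 : 0 < D) (LD : lip_bounded dom L D).
Implicit Types (a b : A) (phi psi : A -> R[i]).
Local Notation mk := (mk_dist dom L).
Local Notation states := (state_space A : set {ptws A -> R[i]^o}).

Lemma mk_le_diam phi psi : state_space A phi -> state_space A psi ->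
  (mk phi psi <= (2 * D)%:E)%E.
Proof.
move=> sp sq; apply: mk_le => a da La; have [t ta] := LD da La.
rewrite (dist_alg t _ sp sq) (le_trans (cnormD _ _))// cnormN mulr_natl mulr2n.
by apply: lerD; apply: le_trans ta; exact: state_le_norm.
Qed.

Lemma mk_fin phi psi : state_space A phi -> state_space A psi ->
  (0 <= mk phi psi < +oo)%E.
Proof.
move=> sp sq; rewrite (mk_ge0 LP)/=.
by rewrite (le_lt_trans (mk_le_diam sp sq))// ltry.
Qed.

(* Self-adjoint elements suffice, and they are limits of elements of [dom]. *)
Lemma mk_ball_eval phi a (e : R) : state_space A phi -> 0 < e ->
  exists2 d : R, 0 < d & forall psi, state_space A psi ->
    (mk phi psi < d%:E)%E -> rnorm (phi a - psi a) < e.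
Proof.
move=> sp.
have H h (r : R) : self_adjoint A h -> 0 < r -> exists2 d : R, 0 < d &
    forall psi, state_space A psi -> (mk phi psi < d%:E)%E ->
      rnorm (phi h - psi h) < r.
  move=> sh r0; have r4 : 0 < r / 4 by rewrite divr_gt0.
  have [x dx hx] : exists2 x, dom x & rnorm (h - x) < r / 4.
    by have /closure_rnorm := rs_dense LP sh; exact.
  have K0 : 0 < L x + 1 by rewrite ltr_wpDl// (rs_ge0 LP).
  have d0 := divr_gt0 r4 K0; set d := _ / _ in d0.
  exists d => // psi sq mkd.
  have Lx : L x <= L x + 1 by rewrite lerDl.
  have := mk_lip LP sp sq (ltW mkd) dx Lx K0.
  rewrite /d mulrC divfK ?gt_eqF// => xh.
  rewrite (_ : _ - _ = phi (h - x) - psi (h - x) + (phi x - psi x)); last first.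
    by rewrite (stateB sp) (stateB sq); ring.
  rewrite (le_lt_trans (cnormD _ _))//.
  have := state_le_norm sp (h - x); have := state_le_norm sq (h - x).
  have := cnormD (phi (h - x)) (- psi (h - x)); rewrite cnormN.
  by move: xh hx; lra.
move=> e0; have e2 : 0 < e / 2 by rewrite divr_gt0.
have [d1 d10 h1] := H _ _ (sa_cre a) e2.
have [d2 d20 h2] := H _ _ (sa_cim a) e2.
exists (Num.min d1 d2); first by rewrite lt_min d10.
move=> psi sq mkd.
have {}h1 : rnorm (phi (cre a) - psi (cre a)) < e / 2.
  by apply: h1 => //; rewrite (lt_le_trans mkd)// lee_fin ge_min lexx.
have {}h2 : rnorm (phi (cim a) - psi (cim a)) < e / 2.
  by apply: h2 => //; rewrite (lt_le_trans mkd)// lee_fin ge_min lexx orbT.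
rewrite -(cre_cim a) (stateD sp) (stateD sq) (stateZ sp 'i) (stateZ sq 'i).
rewrite opprD addrACA -mulrBr (le_lt_trans (cnormD _ _))// cnorm_i.
by rewrite (splitr e) ltrD.
Qed.

(** Closeness for [mk] gives pointwise closeness by [mk_ball_eval]. Conversely, modulo scalars, on
    which states agree, all [a] with [L a <= 1] lie in [lip_ball dom L D]; a finite net of this ball
    reduces [mk] to finitely many evaluations. *)
Lemma metrizes_of_compact : ultra_compact (lip_ball dom L D) -> metrizes states mk.
Proof.
move=> cK; split.
- exact: mk_fin.
- move=> phi psi sp sq; split=> [mk0|->]; last exact: (mk_refl LP).
  apply/funext => a; apply/subr0_eq/cnorm_eq0/le_anti; rewrite cnorm_ge0 andbT.
  apply/ler_addgt0Pr => e e0; rewrite add0r.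
  have [d d0 H] := mk_ball_eval a sp e0.
  by apply/ltW/H => //; rewrite mk0 lte_fin.
- by move=> phi psi _ _; exact: mk_sym.
- by move=> phi psi chi _ _ _; exact: mk_triangle.
- move=> phi sp U; split=> [nU|[e e0 eU]].
    (* The filter of the balls of [mk] around [phi], traced on the states; it converges pointwise to
       [phi] by [mk_ball_eval]. *)
    pose G : set_system {ptws A -> R[i]^o} :=
      [set V : set {ptws A -> R[i]^o} | exists2 e : R, 0 < e &
      forall psi, state_space A psi -> (mk phi psi < e%:E)%E -> V psi].
    have FG : Filter G.
      split; first by exists 1.
        move=> V W [e1 e10 h1] [e2 e20 h2]; exists (Num.min e1 e2).
          by rewrite lt_min e10.
        move=> psi sq h; split; [apply: h1|apply: h2] => //;
          by rewrite (lt_le_trans h)// lee_fin ge_min lexx ?orbT.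
      by move=> V W VW [e e0 eV]; exists e => // psi sq h; apply/VW/eV.
    have Gphi : G --> (phi : {ptws A -> R[i]^o}).
      apply/pointwise_cvgP => a V /= /nbhs_rnorm[e e0 eV].
      change (G [set psi : A -> R[i] | V (psi a)]).
      have [d d0 H] := mk_ball_eval a sp e0.
      by exists d => // psi sq h; apply/eV/H.
    have [e e0 eU] := Gphi _ nU.
    by exists e => // psi sq h; exact: eU.
  have e8 : 0 < e / 8 by rewrite divr_gt0.
  have [s [s1 s2]] := ultra_compact_net cK e8.
  have near_s : nbhs (phi : {ptws A -> R[i]^o})
      [set psi : {ptws A -> R[i]^o} | forall b, b \in s ->
        rnorm (phi b - psi b) < e / 8].
    elim: s {s1 s2} => [|b s IH]; first by apply: filterE.
    have ev : nbhs (phi : {ptws A -> R[i]^o})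
        [set psi : {ptws A -> R[i]^o} | rnorm (phi b - psi b) < e / 8].
      have /pointwise_cvgP/(_ b) cvb : {ptws, nbhs (phi : {ptws A ->
        R[i]^o}) --> phi}.
        by move=> V.
      apply: (cvb [set z | rnorm (phi b - z) < e / 8]); apply/nbhs_rnorm.
      by exists (e / 8).
    apply: filterS2 ev IH => psi /= h1 h2 c.
    by rewrite inE => /predU1P[->|/h2].
  apply: filterS near_s => psi /= psis sq; apply: eU => //.
  apply: (@le_lt_trans _ _ (e / 2)%:E); last by rewrite lte_fin; lra.
  apply: mk_le => a da La; have [t ta] := LD da La.
  have [|b bs ba] := s2 (a - t%:S).
    split => //; first exact/(dom_sub LP)/(dom_alg LP).
    by rewrite (le_trans (L_sub_alg LP t da)).
  rewrite (dist_alg t _ sp sq); set x := a - _ in ba *.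
  rewrite (_ : _ - _ = (phi b - psi b) - (phi (b - x) - psi (b - x))); last first.
    by rewrite (stateB sp) (stateB sq); ring.
  have := psis _ bs.
  have := state_le_norm sp (b - x); have := state_le_norm sq (b - x).
  have := cnormD (phi (b - x)) (- psi (b - x)); rewrite cnormN.
  have := cnormD (phi b - psi b) (- (phi (b - x) - psi (b - x))); rewrite cnormN.
  by move: ba; lra.
Qed.

End Metrizes.

Section Quantum.
Context {R : realType} {KA KB : R}.
Implicit Types X Y : qcms KA KB.

Lemma lip_real_seminorm X : real_seminorm (lip_dom X) (lip X).
Proof. by have [] := lipP X; split. Qed.

Lemma qcms_lip_bounded X : exists2 D : R, 0 < D & lip_bounded (lip_dom X) (lip X) D.
Proof. exact/metrizes_lip_bounded/(L_mk (lipP X))/lip_real_seminorm. Qed.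

Lemma qcms_lip_compact X (r : R) : ultra_compact (lip_ball (lip_dom X) (lip X) r).
Proof.
apply: metrizes_lip_compact; first exact: lip_real_seminorm.
  exact: (L_mk (lipP X)).
exact: (L_closed (lipP X)).
Qed.

Lemma lip_closed_ball X (r : R) (a : X) : 0 < r ->
  (forall e : R, 0 < e ->
    exists2 b, lip_dom X b /\ lip X b <= r & rnorm (a - b) < e) ->
  lip_dom X a /\ lip X a <= r.
Proof.
move=> r0 ap; have LX := lip_real_seminorm X.
have ar : [set x | lip_dom X x /\ lip X x <= 1] ((r^-1)%:C *: a : X).
  have /closed_rnorm := L_closed (lipP X); apply=> e e0.
  have [b [db Lb] ab] := ap _ (mulr_gt0 r0 e0).
  exists ((r^-1)%:C *: b); last first.
    rewrite -scalerBr rnormZr gtr0_norm ?invr_gt0// mulrC ltr_pdivrMr//.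
    by rewrite mulrC.
  split; first exact: (rs_scale LX).
  by rewrite (rs_scaleL LX)// gtr0_norm ?invr_gt0// mulrC ler_pdivrMr// mul1r.
have aE : a = r%:C *: ((r^-1)%:C *: a).
  by rewrite scalerA -rmorphM /= mulfV ?gt_eqF// scale1r.
case: ar => d1 L1; split; first by rewrite aE; exact: (rs_scale LX).
by rewrite aE (rs_scaleL LX)// gtr0_norm// -[leRHS]mulr1 ler_wpM2l// ltW.
Qed.

End Quantum.

(** * Direct sums and gluing *)

(** An alias, on which the C*-structure is declared apart from the instances that [A * B] already
    carries. The norm copied from the product is the maximum, as the C*-identity demands. *)
Definition dsum {R : realType} (A B : cstarAlgType R) : Type := (A * B)%type.

HB.instance Definition _ (R : realType) (A B : cstarAlgType R) :=
  NormedModule.copy (dsum A B) (A * B)%type.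

Section DirectSum.
Context {R : realType} {A B : cstarAlgType R}.
Implicit Types x y : dsum A B.

Lemma rnorm_dsum x : rnorm x = Num.max (rnorm x.1) (rnorm x.2).
Proof.
apply: complexI; rewrite rnormE -[`|x|]/(`|x : (A * B)%type|) prod_normE -!rnormE.
rewrite !maxEle lecR; by case: ifP.
Qed.

Lemma dsum_complete (F : set_system (dsum A B)) : ProperFilter F -> cauchy F ->
  cvg F.
Proof.
move=> FF cF.
have cF' (e : R) : 0 < e -> exists v, F [set u | rnorm (v - u) < e].
  move=> e0; have /cauchyP/(_ e%:C) := cF.
  rewrite ltcR => /(_ e0)[v vF]; exists v.
  by apply: filterS vF => u /=; rewrite ball_rnorm.
have [|a aP] := @cvg_filter_rnorm R A (fst @ F) _.
  move=> e /cF'[v vF]; exists v.1.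
  change (F [set u : dsum A B | rnorm (v.1 - u.1) < e]).
  apply: filterS vF => u /=.
  by rewrite rnorm_dsum gt_max => /andP[].
have [|b bP] := @cvg_filter_rnorm R B (snd @ F) _.
  move=> e /cF'[v vF]; exists v.2.
  change (F [set u : dsum A B | rnorm (v.2 - u.2) < e]).
  apply: filterS vF => u /=.
  by rewrite rnorm_dsum gt_max => /andP[].
apply/cvg_ex; exists ((a, b) : dsum A B) => V /nbhs_rnorm[e e0 eV].
have h1 : F [set u | rnorm (a - u.1) < e] by exact: aP.
have h2 : F [set u | rnorm (b - u.2) < e] by exact: bP.
change (F V); apply: filterS2 h1 h2 => u /= h1 h2; apply: eV.
by rewrite rnorm_dsum gt_max h1.
Qed.

HB.instance Definition _ := Uniform_isComplete.Build (dsum A B) dsum_complete.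

Definition dsum_one : dsum A B := (1, 1).
Definition dsum_mul x y : dsum A B := (x.1 * y.1, x.2 * y.2).
Definition dsum_star x : dsum A B := (star x.1, star x.2).

Lemma dsum_mulA : associative dsum_mul.
Proof. by move=> x y z; rewrite /dsum_mul !mulrA. Qed.

Lemma dsum_mul1l : left_id dsum_one dsum_mul.
Proof. by case=> a b; rewrite /dsum_mul !mul1r. Qed.

Lemma dsum_mul1r : right_id dsum_one dsum_mul.
Proof. by case=> a b; rewrite /dsum_mul !mulr1. Qed.

Lemma dsum_mulDl : left_distributive dsum_mul +%R.
Proof. by move=> x y z; rewrite /dsum_mul !mulrDl. Qed.

Lemma dsum_mulDr : right_distributive dsum_mul +%R.
Proof. by move=> x y z; rewrite /dsum_mul !mulrDr. Qed.

Lemma dsum_one_neq0 : dsum_one != 0.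
Proof. by apply/eqP => -[/eqP]; rewrite oner_eq0. Qed.

Lemma dsum_scaleAl (c : R[i]) x y : c *: dsum_mul x y = dsum_mul (c *: x) y.
Proof. by rewrite /dsum_mul -!scalerAl. Qed.

Lemma dsum_scaleAr (c : R[i]) x y : c *: dsum_mul x y = dsum_mul x (c *: y).
Proof. by rewrite /dsum_mul -!scalerAr. Qed.

Lemma dsum_starK : involutive dsum_star.
Proof. by case=> a b; rewrite /dsum_star !starK. Qed.

Lemma dsum_star_semilinear (c : R[i]) x y :
  dsum_star (c *: x + y) = c^* *: dsum_star x + dsum_star y.
Proof. by rewrite /dsum_star !starZD. Qed.

Lemma dsum_starM x y : dsum_star (dsum_mul x y) = dsum_mul (dsum_star y)
  (dsum_star x).
Proof. by rewrite /dsum_star /dsum_mul !star_mul. Qed.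

Lemma dsum_normM x y : `|dsum_mul x y| <= `|x| * `|y|.
Proof.
rewrite -!rnormE -rmorphM lecR !rnorm_dsum ge_max /=; apply/andP; split.
  by rewrite (le_trans (rnormM _ _))// ler_pM ?rnorm_ge0// le_max lexx.
by rewrite (le_trans (rnormM _ _))// ler_pM ?rnorm_ge0// le_max lexx orbT.
Qed.

Lemma dsum_norm x : `|dsum_mul (dsum_star x) x| = `|x| ^+ 2.
Proof.
rewrite -!rnormE -rmorphXn; congr (_%:C); rewrite !rnorm_dsum /= !rnorm_cstar.
by case: (leP (rnorm x.1) (rnorm x.2)) => h; [rewrite max_r|rewrite max_l];
  rewrite ?ler_sqr ?nnegrE ?rnorm_ge0// ltW.
Qed.

HB.instance Definition _ := isCStar.Build R (dsum A B)
  dsum_mulA dsum_mul1l dsum_mul1r dsum_mulDl dsum_mulDr dsum_one_neq0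
  dsum_scaleAl dsum_scaleAr dsum_starK dsum_star_semilinear dsum_starM
  dsum_normM dsum_norm.

Lemma rnorm_fst x : rnorm x.1 <= rnorm x.
Proof. by rewrite rnorm_dsum le_max lexx. Qed.

Lemma rnorm_snd x : rnorm x.2 <= rnorm x.
Proof. by rewrite rnorm_dsum le_max lexx orbT. Qed.

End DirectSum.

Definition dsum_alg {R : realType} (A B : cstarAlgType R) : cstarAlgType R :=
  dsum A B.

Section Projections.
Context {R : realType} {A B : cstarAlgType R}.
Local Notation D := (dsum_alg A B).

Lemma dsum_addE (a a' : A) (b b' : B) : (a, b) + (a', b') = (a + a', b + b') :> D.
Proof. by []. Qed.

Lemma dsum_subE (a a' : A) (b b' : B) : (a, b) - (a', b') = (a - a', b - b') :> D.
Proof. by []. Qed.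

Lemma dsum_scaleE (c : R[i]) (a : A) (b : B) : c *: (a, b) = (c *: a, c *: b) :> D.
Proof. by []. Qed.

Definition dfst (x : dsum_alg A B) : A := x.1.
Definition dsnd (x : dsum_alg A B) : B := x.2.

Lemma dfst_linear : linear dfst. Proof. by []. Qed.
Lemma dsnd_linear : linear dsnd. Proof. by []. Qed.
Lemma dfst_monoid_morphism : monoid_morphism dfst. Proof. by []. Qed.
Lemma dsnd_monoid_morphism : monoid_morphism dsnd. Proof. by []. Qed.

HB.instance Definition _ :=
  GRing.isLinear.Build R[i] (dsum_alg A B) A _ dfst dfst_linear.
HB.instance Definition _ :=
  GRing.isLinear.Build R[i] (dsum_alg A B) B _ dsnd dsnd_linear.
HB.instance Definition _ :=
  GRing.isMonoidMorphism.Build (dsum_alg A B) A dfst dfst_monoid_morphism.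
HB.instance Definition _ :=
  GRing.isMonoidMorphism.Build (dsum_alg A B) B dsnd dsnd_monoid_morphism.

Definition dfst_lr : {lrmorphism dsum_alg A B -> A} := dfst.
Definition dsnd_lr : {lrmorphism dsum_alg A B -> B} := dsnd.

End Projections.

Lemma ultra_fmap (T U : Type) (f : T -> U) (F : set_system T) : UltraFilter F ->
  UltraFilter (f @ F).
Proof.
move=> UF; split; first exact: fmap_proper_filter.
move=> G PG FG; apply/seteqP; split => // V GV.
have [//|FV] := in_ultra_setVsetC (f @^-1` V) UF.
have GC : G (~` V) by exact: FG.
by have [x []] := filter_ex (filterI GV GC).
Qed.

(** * Quantum isometries *)

Section QuantumIsometry.
Context {R : realType} {KA KB : R}.
Implicit Types X Y Z : qcms KA KB.

Lemma quantum_isometry_sublift X Y (f : {lrmorphism X -> Y}) : quantum_isometry f ->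
  forall (y : Y) (e : R), lip_dom Y y -> 0 < e ->
  exists x : X, [/\ lip_dom X x, f x = y & lip X x <= lip Y y + e].
Proof.
move=> [_ _ _ qf] y e dy e0.
have : (ereal_inf [set (lip X x)%:E | x in [set x | lip_dom X x /\ f x = y]] <
    (lip Y y + e)%:E)%E by rewrite -(qf _ dy) lte_fin ltrDl.
move=> /ereal_inf_lt[_ [x [dx fx] <-]]; rewrite lte_fin => /ltW h.
by exists x.
Qed.

Lemma quantum_isometry_lip_le X Y (f : {lrmorphism X -> Y}) : quantum_isometry f ->
  forall x : X, lip_dom X x -> lip Y (f x) <= lip X x.
Proof.
move=> [_ _ df qf] x dx; rewrite -lee_fin (qf _ (df _ dx)).
by apply: ereal_inf_lbound; exists x.
Qed.

Lemma quantum_isometry_of_lifts X Y (f : {lrmorphism X -> Y}) :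
  star_morphism f -> (forall y : Y, exists x : X, f x = y) ->
  (forall x : X, lip_dom X x -> lip_dom Y (f x) /\ lip Y (f x) <= lip X x) ->
  (forall (y : Y) (e : R), lip_dom Y y -> 0 < e ->
    exists x : X, [/\ lip_dom X x, f x = y & lip X x <= lip Y y + e]) ->
  quantum_isometry f.
Proof.
move=> sf surj le lift; split => // [x /le[]//|y dy].
apply/le_anti/andP; split.
  by apply: le_ereal_inf_tmp => _ [x [dx <-] <-]; rewrite lee_fin; case: (le x dx).
apply/lee_addgt0Pr => e e0; have [x [dx fx Lx]] := lift y e dy e0.
apply: (@le_trans _ _ (lip X x)%:E); last by rewrite -EFinD lee_fin.
by apply: ereal_inf_lbound; exists x.
Qed.

Lemma quantum_isometry_comp X Y Z (f : {lrmorphism X ->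
  Y}) (g : {lrmorphism Y -> Z}) :
  quantum_isometry f -> quantum_isometry g ->
  quantum_isometry (g \o f : {lrmorphism X -> Z}).
Proof.
move=> qf qg; have [sf surjf df _] := qf; have [sg surjg dg _] := qg.
apply: quantum_isometry_of_lifts.
- by move=> a /=; rewrite sf sg.
- by move=> z; have [y <-] := surjg z; have [x <-] := surjf y; exists x.
- move=> x dx /=; split; first exact/dg/df.
  exact: le_trans (quantum_isometry_lip_le qg (df _ dx))
    (quantum_isometry_lip_le qf dx).
- move=> z e dz e0; have e2 : 0 < e / 2 by rewrite divr_gt0.
  have [y [dy gy Ly]] := quantum_isometry_sublift qg dz e2.
  have [x [dx fx Lx]] := quantum_isometry_sublift qf dy e2.
  exists x; split => //=; first by rewrite fx.
  by move: Lx Ly; lra.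
Qed.

End QuantumIsometry.

(* The seminorms [N] through which two quantum compact metric spaces are glued;
   the typical example is [N a b = `|a m - m b|] for an element [m] of a normed
   bimodule, and the axioms on products and inverses are those of this
   derivation. *)
Record gluing {R : realType} {KA KB : R} (X Y : qcms KA KB) (N : X -> Y -> R) :
    Prop := {
  gl_ge0 : forall a b, 0 <= N a b ;
  gl_add : forall a a' b b', N (a + a') (b + b') <= N a b + N a' b' ;
  gl_scale : forall (c : R[i]) a b, N (c *: a) (c *: b) = rnorm c * N a b ;
  gl_one : N 1 1 = 0 ;
  gl_sep : 0 < N 1 0 ;
  gl_mul : forall a a' b b',
    N (a * a') (b * b') <= rnorm a * N a' b' + N a b * rnorm b' ;
  gl_inv : forall a a' b b', a * a' = 1 -> a' * a = 1 -> b * b' = 1 -> b' * b = 1 ->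
    N a' b' <= rnorm a' * rnorm b' * N a b ;
  gl_bound : exists2 K : R, 0 <= K & forall a b, N a b <= K * (rnorm a + rnorm b) ;
  gl_liftl : forall a (e : R), lip_dom X a -> 0 < e ->
    exists b, [/\ lip_dom Y b, lip Y b <= lip X a + e & N a b <= lip X a + e] ;
  gl_liftr : forall b (e : R), lip_dom Y b -> 0 < e ->
    exists a, [/\ lip_dom X a, lip X a <= lip Y b + e & N a b <= lip Y b + e]
}.

(** * The glued seminorm on a direct sum *)

Section Glue.
Context {R : realType} {KA KB : R} (hKA : 1 <= KA) (hKB : 0 <= KB)
  {X Y : qcms KA KB} {N : X -> Y -> R} (gN : gluing N).
Local Notation D := (dsum_alg X Y).
Implicit Types x y : D.

Definition glue_dom : set D := [set x | lip_dom X x.1 /\ lip_dom Y x.2].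
Definition glue_lip x : R := Num.max (Num.max (lip X x.1) (lip Y x.2)) (N x.1 x.2).
Local Notation dom := glue_dom.
Local Notation L := glue_lip.

Let LX : real_seminorm (lip_dom X) (lip X) := lip_real_seminorm X.
Let LY : real_seminorm (lip_dom Y) (lip Y) := lip_real_seminorm Y.

Lemma glue_lip_le x (r : R) :
  (L x <= r) = [&& lip X x.1 <= r, lip Y x.2 <= r & N x.1 x.2 <= r].
Proof. by rewrite !ge_max andbA. Qed.

Lemma lip1_le_glue x : lip X x.1 <= L x.
Proof. by have := lexx (L x); rewrite {1}glue_lip_le => /and3P[]. Qed.

Lemma lip2_le_glue x : lip Y x.2 <= L x.
Proof. by have := lexx (L x); rewrite {1}glue_lip_le => /and3P[]. Qed.

Lemma gl_le_glue x : N x.1 x.2 <= L x.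
Proof. by have := lexx (L x); rewrite {1}glue_lip_le => /and3P[]. Qed.

Lemma glue_lip_ge0 x : 0 <= L x.
Proof. exact: le_trans (gl_ge0 gN _ _) (gl_le_glue x). Qed.

Lemma gl_scaler (t : R) (a : X) (b : Y) :
  N (t%:C *: a) (t%:C *: b) = `|t| * N a b.
Proof. by rewrite (gl_scale gN) cnorm_real. Qed.

Lemma gl_opp (a : X) (b : Y) : N (- a) (- b) = N a b.
Proof.
rewrite -[- a]scaleN1r -[- b]scaleN1r (gl_scale gN) cnormN.
by rewrite -[1]/((1 : R)%:C) cnorm_real normr1 mul1r.
Qed.

Lemma gl_dist (a a' : X) (b b' : Y) : N a b <= N a' b' + N (a - a') (b - b').
Proof.
have := gl_add gN a' (a - a') b' (b - b').
by rewrite ![_ + (_ - _)]addrC !subrK.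
Qed.

(** [N] vanishes on pairs of equal scalars, so [N s t] depends on [s - t] only. This ties together
    the scalars of the two factors: it reduces the kernel of the glued seminorm to common scalars
    and bounds its unit ball modulo them. *)
Lemma gl_alg_sep (s t : R) : `|s - t| * N 1 0 <= N s%:S t%:S.
Proof.
rewrite -gl_scaler scaler0 (le_trans (gl_dist _ s%:S _ t%:S))//.
rewrite alg_sub sub0r (_ : _ - _ - _ = - t%:S); last by zmod.
by rewrite gl_opp gl_scaler (gl_one gN) mulr0 addr0.
Qed.

Lemma glue_real_seminorm : real_seminorm dom L.
Proof.
split.
- by move=> [a b] [/(rs_sa LX) sa /(rs_sa LY) sb]; congr (_, _).
- move=> [a b] [sa sb]; apply/closure_rnorm => e e0.
  have [a' da' aa'] : exists2 u, lip_dom X u & rnorm (a - u) < e.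
    by have /closure_rnorm := rs_dense LX sa; exact.
  have [b' db' bb'] : exists2 u, lip_dom Y u & rnorm (b - u) < e.
    by have /closure_rnorm := rs_dense LY sb; exact.
  by exists (a', b') => //; rewrite rnorm_dsum gt_max aa'.
- by move=> x y [x1 x2] [y1 y2]; split; [exact: (rs_add LX)|exact: (rs_add LY)].
- by move=> t x [x1 x2]; split; [exact: (rs_scale LX)|exact: (rs_scale LY)].
- by move=> x _; exact: glue_lip_ge0.
- move=> x y [x1 x2] [y1 y2]; rewrite glue_lip_le; apply/and3P; split.
  + by rewrite (le_trans (rs_addL LX x1 y1))// lerD// lip1_le_glue.
  + by rewrite (le_trans (rs_addL LY x2 y2))// lerD// lip2_le_glue.
  + by rewrite (le_trans (gl_add gN _ _ _ _))// lerD// gl_le_glue.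
- move=> t x [x1 x2]; rewrite /glue_lip /= (rs_scaleL LX)// (rs_scaleL LY)//.
  by rewrite gl_scaler !maxr_pMr.
- apply/seteqP; split=> [x [[x1 x2] Lx]|_ [t _ <-]].
    have := lexx (L x); rewrite {1}glue_lip_le Lx => /and3P[h1 h2 h3].
    have [s _ sE] : [set t%:S | t in [set: R]] x.1.
      by rewrite -(rs_eq0 LX); split => //; apply/le_anti; rewrite h1 (rs_ge0 LX).
    have [t _ tE] : [set t%:S | t in [set: R]] x.2.
      by rewrite -(rs_eq0 LY); split => //; apply/le_anti; rewrite h2 (rs_ge0 LY).
    exists s => //; rewrite [RHS]surjective_pairing.
    have := le_trans (gl_alg_sep s t); rewrite sE tE => /(_ _ h3).
    rewrite pmulr_lle0 ?(gl_sep gN)// normr_le0 subr_eq0 => /eqP st.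
    by rewrite -sE -tE st.
  split; first by split; [exact: (dom_alg LX)|exact: (dom_alg LY)].
  rewrite /glue_lip /= (L_alg LX) (L_alg LY) gl_scaler (gl_one gN) mulr0.
  by rewrite !maxxx.
Qed.

Lemma glue_closed_ball (r : R) x : 0 < r ->
  (forall e : R, 0 < e -> exists2 y, dom y /\ L y <= r & rnorm (x - y) < e) ->
  dom x /\ L x <= r.
Proof.
move=> r0 ap.
have [d1 L1] : lip_dom X x.1 /\ lip X x.1 <= r.
  apply: lip_closed_ball => // e /ap[y [[y1 y2]]];
    rewrite glue_lip_le => /and3P[h1 h2 h3] xy.
  by exists y.1 => //; exact: le_lt_trans (rnorm_fst _) xy.
have [d2 L2] : lip_dom Y x.2 /\ lip Y x.2 <= r.
  apply: lip_closed_ball => // e /ap[y [[y1 y2]]];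
    rewrite glue_lip_le => /and3P[h1 h2 h3] xy.
  by exists y.2 => //; exact: le_lt_trans (rnorm_snd _) xy.
split => //; rewrite glue_lip_le L1 L2 /=; apply/ler_addgt0Pr => e e0.
have [K K0 NK] := gl_bound gN.
have K20 : 0 < 2 * K + 1 by rewrite ltr_wpDl// mulr_ge0.
have [y [[y1 y2]]] := ap _ (divr_gt0 e0 K20);
  rewrite glue_lip_le => /and3P[h1 h2 h3] xy.
rewrite (le_trans (gl_dist _ y.1 _ y.2))// lerD// (le_trans (NK _ _))//.
apply: (@le_trans _ _ ((2 * K + 1) * rnorm (x - y))).
  have := rnorm_fst (x - y); have := rnorm_snd (x - y) => /= r2 r1.
  apply: (@le_trans _ _ (K * (rnorm (x - y) + rnorm (x - y)))).
    by apply: ler_wpM2l => //; exact: lerD.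
  by have := rnorm_ge0 (x - y); lra.
by rewrite mulrC -ler_pdivlMr// ltW.
Qed.

Lemma glue_lip_compact (r : R) : ultra_compact (lip_ball dom L r).
Proof.
move=> F UF FK.
have UF1 := ultra_fmap fst UF; have UF2 := ultra_fmap snd UF.
have [|a _ aP] := @qcms_lip_compact R KA KB X r (fst @ F) UF1.
  change (F [set x : D | lip_ball (lip_dom X) (lip X) r x.1]).
  apply: filterS FK => x [[x1 x2]]; rewrite glue_lip_le => /and3P[h1 h2 h3] xr.
  by split => //; exact: le_trans (rnorm_fst _) xr.
have [|b _ bP] := @qcms_lip_compact R KA KB Y r (snd @ F) UF2.
  change (F [set x : D | lip_ball (lip_dom Y) (lip Y) r x.2]).
  apply: filterS FK => x [[x1 x2]]; rewrite glue_lip_le => /and3P[h1 h2 h3] xr.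
  by split => //; exact: le_trans (rnorm_snd _) xr.
have abP (e : R) : 0 < e -> F [set y | rnorm ((a, b) - y : D) < e].
  move=> e0; have h1 : F [set x : D | rnorm (a - x.1) < e] by exact: aP.
  have h2 : F [set x : D | rnorm (b - x.2) < e] by exact: bP.
  by apply: filterS2 h1 h2 => y /= h1 h2; rewrite rnorm_dsum gt_max h1.
have near_ab (e : R) : 0 < e ->
  exists2 y, lip_ball dom L r y & rnorm ((a, b) - y : D) < e.
  by move=> e0; have [y [Ky yab]] := filter_ex (filterI FK (abP e e0)); exists y.
exists (a, b) => //.
have [dab Lab] : dom (a, b) /\ L (a, b) <= 1.
  by apply: glue_closed_ball => // e /near_ab[y [dy Ly _] yab]; exists y.
split => //; have /closed_rnorm := @closed_rball R D r;
  apply=> e /near_ab[y [_ _ ry] yab].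
by exists y.
Qed.

Lemma glue_lip_bounded : exists2 M : R, 0 < M & lip_bounded dom L M.
Proof.
have [D1 D10 B1] := qcms_lip_bounded X; have [D2 D20 B2] := qcms_lip_bounded Y.
have [K K0 NK] := gl_bound gN; have k0 := gl_sep gN.
(* The components lie within [D1] of a scalar [s] and within [D2] of a scalar [t]. Then
   [N s t <= 1 + K (D1 + D2)] bounds [|s - t|], and [s] can serve for both components. *)
pose M := D1 + D2 + (1 + K * (D1 + D2)) / N 1 0.
have M1 : 0 <= (1 + K * (D1 + D2)) / N 1 0.
  by rewrite divr_ge0 ?(ltW k0)// addr_ge0// mulr_ge0// addr_ge0// ltW.
exists M; first by rewrite /M; lra.
move=> x [d1 d2]; rewrite glue_lip_le => /and3P[h1 h2 h3].
have [s xs] := B1 _ d1 h1; have [t xt] := B2 _ d2 h2.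
exists s; rewrite rnorm_dsum ge_max; apply/andP; split.
  by rewrite (le_trans xs)// /M; lra.
have st : `|s - t| <= (1 + K * (D1 + D2)) / N 1 0.
  rewrite ler_pdivlMr// (le_trans (gl_alg_sep s t))//.
  rewrite (le_trans (gl_dist _ x.1 _ x.2))// lerD// (le_trans (NK _ _))//.
  by rewrite ler_wpM2l// lerD// rnorm_distC.
change (rnorm (x.2 - s%:S) <= M).
rewrite (le_trans (rnorm_distD (t%:S : Y) _ _))// -alg_sub rnorm_alg distrC.
by move: xt st; rewrite /M; lra.
Qed.

Lemma leibniz_bound_mono (l l' l1 l1' n n' n1 n1' : R) :
  0 <= l1 -> 0 <= l1' -> 0 <= n1 -> 0 <= n1' ->
  l1 <= l -> l1' <= l' -> n1 <= n -> n1' <= n' ->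
  KA * (l1 * n1' + n1 * l1') + KB * (l1 * l1') <=
  KA * (l * n' + n * l') + KB * (l * l').
Proof.
move=> *; apply: lerD; last by rewrite ler_wpM2l// ler_pM.
by rewrite ler_wpM2l ?(le_trans ler01)//; apply: lerD; exact: ler_pM.
Qed.

(** Both brackets at once: [c = 1/2], [d = 1] is the Jordan product, and [c = 1/(2i)], [d = -1] the
    Lie product. The product rule for [N] gives the Leibniz inequality with constant 1, at most
    [KA]. *)
Lemma gl_bracket x y (c d : R[i]) : rnorm c = 2^-1 -> rnorm d = 1 ->
  N (c *: (x.1 * y.1 + d *: (y.1 * x.1))) (c *: (x.2 * y.2 + d *: (y.2 * x.2))) <=
  KA * (L x * rnorm y + rnorm x * L y) + KB * (L x * L y).
Proof.
move=> cE dE; rewrite (gl_scale gN) cE.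
have h : N (x.1 * y.1 + d *: (y.1 * x.1)) (x.2 * y.2 + d *: (y.2 * x.2)) <=
    2 * (L x * rnorm y + rnorm x * L y).
  rewrite (le_trans (gl_add gN _ _ _ _))// (gl_scale gN) dE mul1r.
  rewrite (le_trans (lerD (gl_mul gN _ _ _ _) (gl_mul gN _ _ _ _)))//.
  have e1 : rnorm x.1 * N y.1 y.2 <= rnorm x * L y.
    by apply: ler_pM; rewrite ?rnorm_ge0 ?(gl_ge0 gN) ?rnorm_fst ?gl_le_glue.
  have e2 : rnorm y.1 * N x.1 x.2 <= rnorm y * L x.
    by apply: ler_pM; rewrite ?rnorm_ge0 ?(gl_ge0 gN) ?rnorm_fst ?gl_le_glue.
  have e3 : N x.1 x.2 * rnorm y.2 <= L x * rnorm y.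
    by apply: ler_pM; rewrite ?rnorm_ge0 ?(gl_ge0 gN) ?rnorm_snd ?gl_le_glue.
  have e4 : N y.1 y.2 * rnorm x.2 <= L y * rnorm x.
    by apply: ler_pM; rewrite ?rnorm_ge0 ?(gl_ge0 gN) ?rnorm_snd ?gl_le_glue.
  by move: e1 e2 e3 e4; rewrite [rnorm y * _]mulrC [L y * _]mulrC; lra.
rewrite mulrC ler_pdivrMr// mulrC (le_trans h)// ler_wpM2l//.
have b0 : 0 <= L x * rnorm y + rnorm x * L y.
  by rewrite addr_ge0// mulr_ge0 ?rnorm_ge0 ?glue_lip_ge0.
have c0 : 0 <= KB * (L x * L y) by rewrite !mulr_ge0 ?glue_lip_ge0.
by rewrite -[leLHS]mul1r -[leLHS]addr0 lerD// ler_wpM2r.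
Qed.

Lemma cnorm_half : rnorm ((2 : R[i])^-1) = 2^-1.
Proof.
have -> : (2 : R[i])^-1 = (2^-1 : R)%:C by rewrite fmorphV rmorph_nat.
by rewrite cnorm_real ger0_norm.
Qed.

Lemma cnorm_half_i : rnorm ((2 * 'i : R[i])^-1) = 2^-1.
Proof.
apply: complexI; rewrite cnormE normfV normrM normCi mulr1 normr_nat.
by rewrite fmorphV rmorph_nat.
Qed.

Lemma glue_leibniz x y : dom x -> dom y ->
  Num.max (L (jordan x y)) (L (lie x y)) <=
    KA * (L x * rnorm y + rnorm x * L y) + KB * (L x * L y).
Proof.
move=> [x1 x2] [y1 y2].
have mono1 : KA * (lip X x.1 * rnorm y.1 + rnorm x.1 * lip X y.1) +
    KB * (lip X x.1 * lip X y.1) <=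
    KA * (L x * rnorm y + rnorm x * L y) + KB * (L x * L y).
  by apply: leibniz_bound_mono; rewrite ?rnorm_ge0 ?rnorm_fst ?lip1_le_glue//;
    exact: (rs_ge0 LX).
have mono2 : KA * (lip Y x.2 * rnorm y.2 + rnorm x.2 * lip Y y.2) +
    KB * (lip Y x.2 * lip Y y.2) <=
    KA * (L x * rnorm y + rnorm x * L y) + KB * (L x * L y).
  by apply: leibniz_bound_mono; rewrite ?rnorm_ge0 ?rnorm_snd ?lip2_le_glue//;
    exact: (rs_ge0 LY).
have := L_leibniz (lipP X) x1 y1; rewrite ge_max => /andP[j1 l1].
have := L_leibniz (lipP Y) x2 y2; rewrite ge_max => /andP[j2 l2].
rewrite ge_max !glue_lip_le.
have n1 : rnorm (1 : R[i]) = 1 by rewrite -[1]/((1 : R)%:C) cnorm_real normr1.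
apply/andP; split; apply/and3P; split.
- exact: le_trans j1 mono1.
- exact: le_trans j2 mono2.
- by have := gl_bracket x y cnorm_half n1; rewrite !scale1r.
- exact: le_trans l1 mono1.
- exact: le_trans l2 mono2.
- have := gl_bracket x y cnorm_half_i (etrans (cnormN 1) n1).
  by rewrite !scaleN1r.
Qed.

Lemma glue_Lseminorm : is_Lseminorm KA KB dom L.
Proof.
have LG := glue_real_seminorm; have [M M0 B] := glue_lip_bounded.
have met := metrizes_of_compact LG B (@glue_lip_compact M).
case: (LG) => *; split => //.
- move=> x y [x1 x2] [y1 y2].
  by split; [exact: (dom_jordan (lipP X))|exact: (dom_jordan (lipP Y))].
- move=> x y [x1 x2] [y1 y2].
  by split; [exact: (dom_lie (lipP X))|exact: (dom_lie (lipP Y))].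
- exact: glue_leibniz.
- by apply/closed_rnorm => x ap; exact: glue_closed_ball.
Qed.

Definition glue : qcms KA KB := QCMS glue_Lseminorm.

Lemma lip_glue_le (x : glue) (r : R) :
  (lip glue x <= r) = [&& lip X x.1 <= r, lip Y x.2 <= r & N x.1 x.2 <= r].
Proof. exact: glue_lip_le. Qed.

Definition glue_fst : {lrmorphism glue -> X} := @dfst_lr R X Y.
Definition glue_snd : {lrmorphism glue -> Y} := @dsnd_lr R X Y.

Lemma glue_fst_isometry : quantum_isometry glue_fst.
Proof.
apply: quantum_isometry_of_lifts.
- by [].
- by move=> a; exists ((a, 0) : D).
- by move=> x [x1 x2]; split => //; exact: lip1_le_glue.
- move=> a e da e0; have [b [db Lb Nab]] := gl_liftl gN da e0.
  exists ((a, b) : D); split => //; rewrite [leLHS]/(L (a, b)) glue_lip_le Lb Nab.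
  by rewrite lerDl ltW.
Qed.

Lemma glue_snd_isometry : quantum_isometry glue_snd.
Proof.
apply: quantum_isometry_of_lifts.
- by [].
- by move=> b; exists ((0, b) : D).
- by move=> x [x1 x2]; split => //; exact: lip2_le_glue.
- move=> b e db e0; have [a [da La Nab]] := gl_liftr gN db e0.
  exists ((a, b) : D); split => //; rewrite [leLHS]/(L (a, b)) glue_lip_le La Nab.
  by rewrite lerDl ltW.
Qed.

(** The seminorms of the factors satisfy it by assumption, and [N] by [gl_inv], with constant 1, at
    most [C]. *)
Lemma glue_strongly_leibniz (C : R) : 1 <= C ->
  strongly_leibniz C X -> strongly_leibniz C Y -> strongly_leibniz C glue.
Proof.
move=> C1 sX sY x y [x1 x2] xy yx.
have C0 : 0 <= C by exact: le_trans ler01 C1.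
have xy1 : x.1 * y.1 = 1 by exact: (congr1 fst xy).
have yx1 : y.1 * x.1 = 1 by exact: (congr1 fst yx).
have xy2 : x.2 * y.2 = 1 by exact: (congr1 snd xy).
have yx2 : y.2 * x.2 = 1 by exact: (congr1 snd yx).
have [d1 L1] := sX _ _ x1 xy1 yx1; have [d2 L2] := sY _ _ x2 xy2 yx2.
split; first by split.
rewrite [leLHS]/(L y) glue_lip_le; apply/and3P; split.
- rewrite (le_trans L1)//; apply: ler_pM.
  + by rewrite mulr_ge0 ?sqr_ge0.
  + exact: (rs_ge0 LX).
  + by rewrite ler_wpM2l// ler_sqr ?nnegrE ?rnorm_ge0// rnorm_fst.
  + exact: lip1_le_glue.
- rewrite (le_trans L2)//; apply: ler_pM.
  + by rewrite mulr_ge0 ?sqr_ge0.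
  + exact: (rs_ge0 LY).
  + by rewrite ler_wpM2l// ler_sqr ?nnegrE ?rnorm_ge0// rnorm_snd.
  + exact: lip2_le_glue.
- rewrite (le_trans (gl_inv gN xy1 yx1 xy2 yx2))//.
  apply: ler_pM.
  + by rewrite mulr_ge0 ?rnorm_ge0.
  + exact: (gl_ge0 gN).
  + rewrite -[leLHS]mul1r; apply: ler_pM => //;
      first by rewrite mulr_ge0 ?rnorm_ge0.
    by rewrite expr2; apply: ler_pM; rewrite ?rnorm_ge0 ?rnorm_fst ?rnorm_snd.
  + exact: gl_le_glue.
Qed.

End Glue.

(** * Tunnels and the triangle inequality *)

Section Extent.
Context {R : realType} {KA KB : R}.
Implicit Types X Y D : qcms KA KB.

(* [reach f e] bounds by [e] the Hausdorff distance between the state space of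
   the domain of [f] and its subset of pullbacks along [f]. *)
Definition reach D X (f : {lrmorphism D -> X}) (e : R) :=
  forall phi, state_space D phi -> exists2 psi, state_space X psi &
    forall a, lip_dom D a -> lip D a <= 1 -> rnorm (phi a - psi (f a)) <= e.

Lemma hausdorff_pullback_ge0 D X (f : {lrmorphism D -> X}) :
  (0 <= hausdorff_dist (@mk R KA KB D) (state_space D) (pullback_states f))%E.
Proof.
have [phi sp] := @state_exists R D.
rewrite /hausdorff_dist le_max; apply/orP; left.
apply: (@le_trans _ _ (ereal_inf [set mk phi y | y in pullback_states f])).
  by apply: le_ereal_inf_tmp => _ [psi _ <-]; exact: (mk_ge0 (lip_real_seminorm D)).
by apply: ereal_sup_ubound; exists phi.
Qed.

Lemma reach_of_hausdorff D X (f : {lrmorphism D -> X}) (e : R) :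
  star_morphism f ->
  (hausdorff_dist (@mk R KA KB D) (state_space D) (pullback_states f) < e%:E)%E ->
  reach f e.
Proof.
move=> sf; rewrite /hausdorff_dist gt_max => /andP[he _] phi sp.
have : (ereal_inf [set mk phi y | y in pullback_states f] < e%:E)%E.
  by apply: le_lt_trans he; apply: ereal_sup_ubound; exists phi.
move=> /ereal_inf_lt[_ [_ [psi sq <-] <-] h]; exists psi => // a da La.
rewrite -[e]mul1r.
exact: (mk_lip (lip_real_seminorm D) sp (state_comp sf sq) (ltW h) da La ltr01).
Qed.

Lemma hausdorff_of_reach D X (f : {lrmorphism D -> X}) (e : R) : 0 <= e ->
  star_morphism f -> reach f e ->
  (hausdorff_dist (@mk R KA KB D) (state_space D) (pullback_states f) <= e%:E)%E.
Proof.
move=> e0 sf rf; rewrite /hausdorff_dist ge_max; apply/andP; split.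
  apply: ge_ereal_sup => _ [phi sp <-]; have [psi sq h] := rf phi sp.
  apply: (@le_trans _ _ (mk phi (psi \o f))); last exact: mk_le.
  by apply: ereal_inf_lbound; exists (psi \o f) => //; exists psi.
apply: ge_ereal_sup => _ [_ [psi sq <-] <-].
apply: (@le_trans _ _ (mk (psi \o f) (psi \o f))).
  by apply: ereal_inf_lbound; exists (psi \o f) => //; exact: state_comp.
by rewrite [mk _ _](mk_refl (lip_real_seminorm D)) lee_fin.
Qed.

Lemma star_pi1 X Y (t : tunnel X Y) : star_morphism (tun_pi1 t).
Proof. by case: (tun_pi1P t). Qed.

Lemma star_pi2 X Y (t : tunnel X Y) : star_morphism (tun_pi2 t).
Proof. by case: (tun_pi2P t). Qed.

Lemma extent_ge0 X Y (t : tunnel X Y) : (0 <= extent t)%E.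
Proof. by rewrite /extent le_max hausdorff_pullback_ge0. Qed.

Lemma extent_reach X Y (t : tunnel X Y) (e : R) : (extent t < e%:E)%E ->
  reach (tun_pi1 t) e /\ reach (tun_pi2 t) e.
Proof.
rewrite /extent gt_max => /andP[h1 h2].
by split; apply: reach_of_hausdorff => //; [exact: star_pi1|exact: star_pi2].
Qed.

Lemma reach_extent X Y (t : tunnel X Y) (e : R) : 0 <= e ->
  reach (tun_pi1 t) e -> reach (tun_pi2 t) e -> (extent t <= e%:E)%E.
Proof.
move=> e0 h1 h2; rewrite /extent ge_max !hausdorff_of_reach//.
  exact: star_pi2.
exact: star_pi1.
Qed.

Lemma extent_fin X Y (t : tunnel X Y) : (extent t < +oo)%E.
Proof.
have [D D0 B] := qcms_lip_bounded (tun_space t).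
have reachD (Z : qcms KA KB) (f : {lrmorphism tun_space t ->
  Z}) : star_morphism f -> reach f (2 * D).
  move=> sf phi sp; have [psi sq] := @state_exists R Z; exists psi => // a da La.
  rewrite -[2 * D]mul1r.
  exact: (mk_lip (lip_real_seminorm (tun_space t)) sp (state_comp sf sq)
    (mk_le_diam B sp (state_comp sf sq)) da La ltr01).
apply: (@le_lt_trans _ _ (2 * D)%:E); last exact: ltry.
apply: reach_extent; first by rewrite mulr_ge0// ltW.
  exact/reachD/star_pi1.
exact/reachD/star_pi2.
Qed.

Lemma propinquity_ge0 (C : R) X Y : (0 <= propinquity C X Y)%E.
Proof. by apply: le_ereal_inf_tmp => _ [t [_ ->]]; exact: extent_ge0. Qed.

Lemma propinquity_le_extent (C : R) X Y (t : tunnel X Y) :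
  strongly_leibniz C (tun_space t) -> (propinquity C X Y <= extent t)%E.
Proof. by move=> st; apply: ereal_inf_lbound; exists t. Qed.

Definition tunnel_swap X Y (t : tunnel X Y) : tunnel Y X :=
  Tunnel (tun_pi2P t) (tun_pi1P t).

Lemma propinquity_sym (C : R) X Y : propinquity C X Y = propinquity C Y X.
Proof.
by congr ereal_inf; apply/seteqP; split=> _ [t [st ->]];
  exists (tunnel_swap t); rewrite /extent /= maxC.
Qed.

Lemma isometry_id X : quantum_isometry (idfun : {lrmorphism X -> X}).
Proof.
apply: quantum_isometry_of_lifts => //; first by move=> y; exists y.
by move=> y e dy e0; exists y; split => //; rewrite lerDl ltW.
Qed.

(** [X] itself is a tunnel, with the identity and [f] as projections. Each state of [X] is a
    pullback along both, so the extent is 0. *)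
Lemma propinquity_isometry (C : R) X Y (f : {lrmorphism X -> Y}) :
  strongly_leibniz C X -> full_quantum_isometry f -> propinquity C X Y = 0%E.
Proof.
move=> sX [qf [g [fK gK qg]]].
apply/le_anti; rewrite propinquity_ge0 andbT.
apply: (@le_trans _ _ (extent (Tunnel (isometry_id X) qf))).
  exact: propinquity_le_extent.
apply: reach_extent => //= phi sp.
  by exists phi => // a _ _; rewrite subrr cnorm0.
exists (phi \o g); first by apply: state_comp => //; case: qg.
by move=> a _ _ /=; rewrite fK subrr cnorm0.
Qed.

End Extent.

Arguments star_pi1 {R KA KB X Y} t.
Arguments star_pi2 {R KA KB X Y} t.

(** * States of a direct sum *)

Section DirectSumStates.
Context {R : realType} {A B : cstarAlgType R}.

(** This stands in for the Cauchy-Schwarz inequality. As [phi (0, 1) = 1], the element with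
    components [z^* a] and [k], both of norm [k], has value [|z|^2 + k], which cannot exceed its
    norm [k]. *)
Lemma state_dsum_null (phi : dsum_alg A B -> R[i]) (a : A) :
  state_space (dsum_alg A B) phi -> phi (1, 0) = 0 -> phi (a, 0) = 0.
Proof.
move=> sp p0; set z := phi (a, 0).
have sum1 : phi (0, 1) = 1.
  by rewrite -(state1 sp) -[LHS]add0r -p0 -(stateD sp) dsum_addE addr0 add0r.
pose k := rnorm (z^* *: a).
have := state_le_norm sp ((z^* *: a, k%:S) : dsum_alg A B).
have -> : ((z^* *: a, k%:S) : dsum_alg A B) = z^* *: (a, 0) + k%:C *: (0, 1).
  by rewrite !dsum_scaleE dsum_addE !scaler0 addr0 add0r.
rewrite (stateD sp) !(stateZ sp) sum1 mulr1 -/z.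
have -> : z^* * z = (rnorm z ^+ 2)%:C by rewrite rmorphXn /= cnormE normCKC.
rewrite -rmorphD cnorm_real ger0_norm ?addr_ge0 ?sqr_ge0 ?rnorm_ge0//.
rewrite !dsum_scaleE dsum_addE !scaler0 addr0 add0r rnorm_dsum /= rnorm_alg
  ger0_norm ?rnorm_ge0//.
rewrite maxxx gerDr => h; apply: cnorm_eq0; apply/eqP.
by rewrite -sqrf_eq0 eq_le h sqr_ge0.
Qed.

Lemma state_dsum_normalize (phi : dsum_alg A B -> R[i]) :
  state_space (dsum_alg A B) phi -> exists2 t : R, 0 <= t & phi (1, 0) = t%:C /\
  exists2 psi, state_space A psi & forall a, phi (a, 0) = t%:C * psi a.
Proof.
move=> sp.
have e_pos (a : A) : 0 <= phi (star a * a, 0).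
  have := state_pos sp ((a, 0) : dsum_alg A B).
  rewrite (_ : star _ * _ = ((star a * a, 0) : dsum_alg A B))//.
  by rewrite -[LHS]/((star a * a, star 0 * 0) : dsum_alg A B) mulr0.
have := e_pos 1; rewrite star1 mulr1 => p1.
pose t := complex.Re (phi (1, 0)).
have tE : phi (1, 0) = t%:C.
  by rewrite /t RRe_real// ger0_real.
have t0 : 0 <= t by rewrite -ler0c -tE.
exists t => //; split => //.
(* When [t = 0] there is nothing to normalize: [phi] vanishes on the first factor, and any state
   [psi] fits. *)
have [tz|tn0] := eqVneq t 0.
  have [psi sq] := @state_exists R A; exists psi => // a.
  by rewrite tz mul0r state_dsum_null// tE tz.
have tC0 : t%:C != 0 by rewrite -[0]/((0 : R)%:C) (inj_eq (@complexI R)).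
exists (fun a => t%:C^-1 * phi (a, 0)); last by move=> a; rewrite mulVKf.
split=> [c a b||a].
- have -> : ((c *: a + b, 0) : dsum_alg A B) = c *: (a, 0) + (b, 0).
    by rewrite dsum_scaleE dsum_addE scaler0 addr0.
  rewrite (stateZD sp) mulrDr mulrCA.
  by [].
- by rewrite tE mulVf.
- by rewrite mulr_ge0 ?e_pos// -fmorphV ler0c invr_ge0.
Qed.

End DirectSumStates.

Definition dsum_swap {R : realType} {A B : cstarAlgType R} (x : dsum_alg B A) :
  dsum_alg A B := (x.2, x.1).

Lemma state_dsum_swap {R : realType} {A B : cstarAlgType R}
    (phi : dsum_alg A B -> R[i]) :
  state_space (dsum_alg A B) phi -> state_space (dsum_alg B A) (phi \o dsum_swap).
Proof.
move=> sp; split=> [c a b||a] /=; last exact: (state_pos sp (dsum_swap a)).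
  exact: (stateZD sp c (dsum_swap a) (dsum_swap b)).
exact: (state1 sp).
Qed.

Lemma state_dsum {R : realType} {A B : cstarAlgType R}
    (phi : dsum_alg A B -> R[i]) : state_space (dsum_alg A B) phi ->
  exists t : R, exists psi1, exists psi2, [/\ 0 <= t <= 1, state_space A psi1,
    state_space B psi2 &
    forall x, phi x = t%:C * psi1 x.1 + (1 - t)%:C * psi2 x.2].
Proof.
move=> sp; have [t t0 [tE [psi1 s1 h1]]] := state_dsum_normalize sp.
have [s s0 [sE [psi2 s2 h2]]] := state_dsum_normalize (state_dsum_swap sp).
have sE' : s = 1 - t.
  apply: complexI; rewrite rmorphB /= -tE -sE -[1%:C]/(1 : R[i]) -(state1 sp) /=.
  rewrite -(stateB sp); congr phi.
  by rewrite /dsum_swap /= dsum_subE subrr subr0.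
exists t, psi1, psi2; split => //; first by rewrite t0 -subr_ge0 -sE'.
move=> [a b]; rewrite -h1 -sE' -(h2 b) /= -(stateD sp).
by rewrite /dsum_swap /= dsum_addE addr0 add0r.
Qed.

Section GlueReach.
Context {R : realType} {KA KB : R} (hKA : 1 <= KA) (hKB : 0 <= KB)
  {X Y : qcms KA KB} {N : X -> Y -> R} (gN : gluing N).
Local Notation D := (glue hKA hKB gN).

(** A state of the direct sum is a convex combination of states of the two factors, and the required
    estimate is convex. *)
Lemma glue_reach (Z : qcms KA KB) (h : {lrmorphism D -> Z}) (e : R) :
  (forall phi, state_space X phi -> exists2 psi, state_space Z psi &
    forall x : D, lip_dom D x -> lip D x <= 1 ->
      rnorm (phi x.1 - psi (h x)) <= e) ->
  (forall phi, state_space Y phi -> exists2 psi, state_space Z psi &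
    forall x : D, lip_dom D x -> lip D x <= 1 ->
      rnorm (phi x.2 - psi (h x)) <= e) ->
  reach h e.
Proof.
move=> hX hY phi /state_dsum[t [phi1 [phi2 [/andP[t0 t1] s1 s2 phiE]]]].
have [psi1 q1 h1] := hX _ s1; have [psi2 q2 h2] := hY _ s2.
exists (fun z => t%:C * psi1 z + (1 - t)%:C * psi2 z).
  by apply: state_convex => //; rewrite t0.
move=> x dx Lx; rewrite phiE opprD addrACA -!mulrBr.
have u0 : 0 <= 1 - t by rewrite subr_ge0.
rewrite (le_trans (cnormD _ _))// !cnormM !cnorm_real !ger0_norm//.
have := ler_wpM2l t0 (h1 x dx Lx); have := ler_wpM2l u0 (h2 x dx Lx); lra.
Qed.

End GlueReach.

Section PullbackGluing.
Context {R : realType} {KA KB : R} {D1 D2 Y : qcms KA KB}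
  {f : {lrmorphism D1 -> Y}} {g : {lrmorphism D2 -> Y}}
  (qf : quantum_isometry f) (qg : quantum_isometry g) {k : R} (k0 : 0 < k).

Definition pullback_gap (a : D1) (b : D2) : R := k^-1 * rnorm (f a - g b).

(** This is the derivation into [Y], a bimodule through [f] and [g], with [m = k^-1]. The element
    [f a] lifts exactly along [g], so the lifts have gap 0 whatever [k] is; hence [k] may be
    arbitrarily small. *)
Lemma pullback_gluing : gluing pullback_gap.
Proof.
have ki : 0 <= k^-1 by rewrite invr_ge0 ltW.
have [sf _ _ _] := qf; have [sg _ _ _] := qg.
have L1 := lip_real_seminorm D1; have L2 := lip_real_seminorm D2.
split; rewrite /pullback_gap.
- by move=> a b; rewrite mulr_ge0 ?rnorm_ge0.
- move=> a a' b b'; rewrite -mulrDr ler_wpM2l// !rmorphD /= opprD addrACA.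
  exact: rnormD.
- move=> c a b; have -> : f (c *: a) = c *: f a by rewrite linearZ.
  have -> : g (c *: b) = c *: g b by rewrite linearZ.
  by rewrite -scalerBr rnormZ mulrCA.
- by rewrite !rmorph1 subrr rnorm0 mulr0.
- by rewrite rmorph1 raddf0 subr0 rnorm1 mulr1 invr_gt0.
- move=> a a' b b'; rewrite !rmorphM /=.
  rewrite mulrCA -mulrA -mulrDr ler_wpM2l//.
  rewrite (_ : _ - _ = f a * (f a' - g b') + (f a - g b) * g b'); last by ncring.
  rewrite (le_trans (rnormD _ _))//; apply: lerD; rewrite (le_trans (rnormM _ _))//.
    by rewrite ler_wpM2r ?rnorm_ge0// star_morphism_contractive.
  by rewrite ler_wpM2l ?rnorm_ge0// star_morphism_contractive.
- move=> a a' b b' aa' a'a bb' b'b; rewrite mulrCA ler_wpM2l//.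
  have fa : f a' * f a = 1 by rewrite -rmorphM /= a'a rmorph1.
  have gb : g b * g b' = 1 by rewrite -rmorphM /= bb' rmorph1.
  have -> : f a' - g b' = - (f a' * (f a - g b) * g b').
    rewrite mulrBr mulrBl fa mul1r -mulrA gb mulr1; zmod.
  rewrite rnormN (le_trans (rnormM _ _))// mulrAC.
  rewrite ler_pM ?rnorm_ge0// ?star_morphism_contractive//.
  rewrite (le_trans (rnormM _ _))// ler_pM ?rnorm_ge0// star_morphism_contractive//.
- exists k^-1 => // a b; rewrite ler_wpM2l// (le_trans (rnormB _ _))//.
  by apply: lerD; exact: star_morphism_contractive.
- move=> a e da e0; have [_ _ df _] := qf.
  have [b [db gb Lb]] := quantum_isometry_sublift qg (df _ da) e0.
  exists b; split => //.
    by rewrite (le_trans Lb)// lerD2r (quantum_isometry_lip_le qf).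
  by rewrite gb subrr rnorm0 mulr0 addr_ge0 ?(rs_ge0 L1)// ltW.
- move=> b e db e0; have [_ _ dg _] := qg.
  have [a [da fa La]] := quantum_isometry_sublift qf (dg _ db) e0.
  exists a; split => //.
    by rewrite (le_trans La)// lerD2r (quantum_isometry_lip_le qg).
  by rewrite fa subrr rnorm0 mulr0 addr_ge0 ?(rs_ge0 L2)// ltW.
Qed.

End PullbackGluing.

Section Triangle.
Context {R : realType} {KA KB : R} (hKA : 1 <= KA) (hKB : 0 <= KB).
Implicit Types X Y Z : qcms KA KB.

(** To reach [Z], a state of the first tunnel is replaced by one of [Y] at cost [e1], transferred to
    the second tunnel at cost [k], and replaced by one of [Z] at cost [e2]; a state of the second
    tunnel only pays [e2]. The way to [X] is symmetric. *)
Lemma tunnel_composition (C : R) X Y Z (t1 : tunnel X Y) (t2 : tunnel Y Z)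
    (e1 e2 k : R) : 1 <= C -> strongly_leibniz C (tun_space t1) ->
  strongly_leibniz C (tun_space t2) -> 0 < e1 -> 0 < e2 -> 0 < k ->
  (extent t1 < e1%:E)%E -> (extent t2 < e2%:E)%E ->
  (propinquity C X Z <= (e1 + e2 + k)%:E)%E.
Proof.
move=> C1 sl1 sl2 e10 e20 k0 /extent_reach[r11 r12] /extent_reach[r21 r22].
pose gN := pullback_gluing (tun_pi2P t1) (tun_pi1P t2) k0.
pose D := glue hKA hKB gN.
pose f : {lrmorphism D -> X} := tun_pi1 t1 \o glue_fst hKA hKB gN.
pose g : {lrmorphism D -> Z} := tun_pi2 t2 \o glue_snd hKA hKB gN.
have qf : quantum_isometry f.
  exact: quantum_isometry_comp (glue_fst_isometry hKA hKB gN) (tun_pi1P t1).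
have qg : quantum_isometry g.
  exact: quantum_isometry_comp (glue_snd_isometry hKA hKB gN) (tun_pi2P t2).
apply: (@le_trans _ _ (extent (Tunnel qf qg))).
  by apply: propinquity_le_extent; exact: glue_strongly_leibniz.
have glP (x : D) : lip_dom D x -> lip D x <= 1 ->
    [/\ lip_dom (tun_space t1) x.1, lip_dom (tun_space t2) x.2,
      lip (tun_space t1) x.1 <= 1, lip (tun_space t2) x.2 <= 1 &
      rnorm (tun_pi2 t1 x.1 - tun_pi1 t2 x.2) <= k].
  move=> [d1 d2]; rewrite lip_glue_le => /and3P[l1 l2].
  by rewrite /pullback_gap mulrC ler_pdivrMr// mul1r.
have gap (psi : Y -> R[i]) (x : D) : state_space Y psi -> lip_dom D x ->
  lip D x <= 1 ->
    rnorm (psi (tun_pi2 t1 x.1) - psi (tun_pi1 t2 x.2)) <= k.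
  move=> sp dx Lx; have [_ _ _ _ h] := glP x dx Lx.
  by rewrite -(stateB sp) (le_trans (state_le_norm sp _)).
apply: reach_extent; first by rewrite !addr_ge0 ?ltW.
- apply: glue_reach => phi sp.
    have [psi sq h] := r11 phi sp; exists psi => // x dx Lx.
    have [d1 _ l1 _ _] := glP x dx Lx.
    by rewrite (le_trans (h _ d1 l1))//; lra.
  have [psi sq h] := r21 phi sp.
  have [chi sc h'] := r11 _ (state_comp (star_pi2 t1) sq).
  exists chi => // x dx Lx; have [d1 d2 l1 l2 _] := glP x dx Lx.
  have := gap psi x sq dx Lx; have := h _ d2 l2; have := h' _ d1 l1.
  have := cnorm_distD (psi (tun_pi1 t2 x.2)) (phi x.2) (chi (tun_pi1 t1 x.1)).
  have := cnorm_distD (psi (tun_pi2 t1 x.1)) (psi (tun_pi1 t2 x.2))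
    (chi (tun_pi1 t1 x.1)).
  rewrite [rnorm (psi (tun_pi1 t2 x.2) - psi (tun_pi2 t1 x.1))]cnorm_distC /=; lra.
- apply: glue_reach => phi sp; last first.
    have [psi sq h] := r22 phi sp; exists psi => // x dx Lx.
    have [_ d2 _ l2 _] := glP x dx Lx.
    by rewrite (le_trans (h _ d2 l2))//; lra.
  have [psi sq h] := r12 phi sp.
  have [chi sc h'] := r22 _ (state_comp (star_pi1 t2) sq).
  exists chi => // x dx Lx; have [d1 d2 l1 l2 _] := glP x dx Lx.
  have := gap psi x sq dx Lx; have := h _ d1 l1; have := h' _ d2 l2.
  have := cnorm_distD (psi (tun_pi2 t1 x.1)) (phi x.1) (chi (tun_pi2 t2 x.2)).
  have := cnorm_distD (psi (tun_pi1 t2 x.2)) (psi (tun_pi2 t1 x.1))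
    (chi (tun_pi2 t2 x.2)).
  move=> /=; lra.
Qed.

Lemma propinquity_lt_tunnel (C : R) X Y (e : R) : (propinquity C X Y < e%:E)%E ->
  exists2 t : tunnel X Y, strongly_leibniz C (tun_space t) & (extent t < e%:E)%E.
Proof. by move=> /ereal_inf_lt[_ [t [st ->]] h]; exists t. Qed.

Lemma propinquity_triangle (C : R) X Y Z : 1 <= C ->
  (propinquity C X Y < +oo)%E -> (propinquity C Y Z < +oo)%E ->
  (propinquity C X Z <= propinquity C X Y + propinquity C Y Z)%E.
Proof.
move=> C1 p1 p2.
have E1 : propinquity C X Y = (fine (propinquity C X Y))%:E.
  by rewrite fineK// ge0_fin_numE// propinquity_ge0.
have E2 : propinquity C Y Z = (fine (propinquity C Y Z))%:E.
  by rewrite fineK// ge0_fin_numE// propinquity_ge0.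
have := propinquity_ge0 C X Y; have := propinquity_ge0 C Y Z.
rewrite E1 E2 !lee_fin; set r1 := fine _ in E1 *; set r2 := fine _ in E2 *.
move=> r20 r10; rewrite -EFinD; apply/lee_addgt0Pr => e e0.
have e3 : 0 < e / 3 by rewrite divr_gt0.
have [|t1 s1 h1] := @propinquity_lt_tunnel C X Y (r1 + e / 3).
  by rewrite E1 lte_fin ltrDl.
have [|t2 s2 h2] := @propinquity_lt_tunnel C Y Z (r2 + e / 3).
  by rewrite E2 lte_fin ltrDl.
rewrite -EFinD (_ : r1 + r2 + e = r1 + e / 3 + (r2 + e / 3) + e / 3); last by field.
by apply: (tunnel_composition C1 s1 s2) => //; rewrite ltr_wpDl.
Qed.

End Triangle.

(** * Finiteness *)

Section StateGluing.
Context {R : realType} {KA KB : R} {X Y : qcms KA KB}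
  {phi : X -> R[i]} {psi : Y -> R[i]} (sp : state_space X phi)
  (sq : state_space Y psi) {k : R} (k0 : 0 < k)
  (BX : lip_bounded (lip_dom X) (lip X) k) (BY : lip_bounded (lip_dom Y) (lip Y) k).
Implicit Types (a x : X) (b y : Y).

(* The norm of [a T - T b], where [T] is the functional [phi (x) psi] in the
   bimodule of bounded bilinear functionals on [X * Y]. *)
Definition state_form a b x y : R[i] := phi (x * a) * psi y - phi x * psi (b * y).
Local Notation E := state_form.

Definition state_form_norm a b : R :=
  sup [set rnorm (E a b p.1 p.2)
    | p in [set p : X * Y | rnorm p.1 <= 1 /\ rnorm p.2 <= 1]].
Local Notation S := state_form_norm.

Lemma state_form_le a b x y :
  rnorm (E a b x y) <= (rnorm a + rnorm b) * (rnorm x * rnorm y).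
Proof.
rewrite (le_trans (cnormD _ _))// cnormN !cnormM mulrDl; apply: lerD.
  rewrite mulrA ler_pM ?cnorm_ge0 ?(state_le_norm sq)//.
  by rewrite (le_trans (state_le_norm sp _))// (le_trans (rnormM _ _))// mulrC.
rewrite mulrCA ler_pM ?cnorm_ge0 ?(state_le_norm sp)//.
by rewrite (le_trans (state_le_norm sq _))// rnormM.
Qed.

Lemma state_form_has_sup a b : has_sup [set rnorm (E a b p.1 p.2) |
  p in [set p : X * Y | rnorm p.1 <= 1 /\ rnorm p.2 <= 1]].
Proof.
split; first by exists (rnorm (E a b 0 0)), (0, 0) => //=; rewrite !rnorm0.
exists (rnorm a + rnorm b) => _ [[x y] /= [x1 y1] <-].
rewrite (le_trans (state_form_le a b x y))// -[leRHS]mulr1.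
rewrite ler_wpM2l ?addr_ge0 ?rnorm_ge0// -[leRHS]mulr1.
by rewrite ler_pM ?rnorm_ge0.
Qed.

Lemma state_form_norm_ub a b x y : rnorm x <= 1 -> rnorm y <= 1 ->
  rnorm (E a b x y) <= S a b.
Proof.
by move=> x1 y1; apply: (sup_upper_bound (state_form_has_sup a b)); exists (x, y).
Qed.

Lemma state_form_norm_le a b (m : R) :
  (forall x y, rnorm x <= 1 -> rnorm y <= 1 -> rnorm (E a b x y) <= m) ->
    S a b <= m.
Proof.
move=> H; apply: ge_sup; first exact: (state_form_has_sup a b).1.
by move=> _ [[x y] /= [x1 y1] <-]; exact: H.
Qed.

Lemma state_form_norm_ge0 a b : 0 <= S a b.
Proof.
apply: (le_trans (cnorm_ge0 (E a b 0 0))).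
by apply: state_form_norm_ub; rewrite rnorm0.
Qed.

Lemma state_form_scale a b x y (s t : R) :
  E a b (s%:C *: x) (t%:C *: y) = s%:C * t%:C * E a b x y.
Proof.
rewrite /state_form -scalerAl -scalerAr !(stateZ sp) !(stateZ sq).
by move: s%:C t%:C => u v; ring.
Qed.

Lemma state_form_norm_bound a b x y :
  rnorm (E a b x y) <= S a b * (rnorm x * rnorm y).
Proof.
have [x0|x0] := eqVneq (rnorm x) 0.
  by rewrite (le_trans (state_form_le a b x y))// x0 mul0r !mulr0.
have [y0|y0] := eqVneq (rnorm y) 0.
  by rewrite (le_trans (state_form_le a b x y))// y0 !mulr0.
have {}x0 : 0 < rnorm x by rewrite lt_def x0 rnorm_ge0.
have {}y0 : 0 < rnorm y by rewrite lt_def y0 rnorm_ge0.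
have := @state_form_norm_ub a b ((rnorm x)^-1%:C *: x) ((rnorm y)^-1%:C *: y).
rewrite !rnormZr !gtr0_norm ?invr_gt0// !mulVf ?gt_eqF//.
rewrite state_form_scale !cnormM !cnorm_real !gtr0_norm ?invr_gt0//.
move=> /(_ (lexx _) (lexx _)); rewrite -invfM mulrC ler_pdivrMr ?mulr_gt0//.
Qed.

Definition state_gap a b : R := k^-1 * S a b.

Lemma state_gap_le a b (m : R) : S a b <= k * m -> state_gap a b <= m.
Proof. by move=> h; rewrite /state_gap mulrC ler_pdivrMr// mulrC. Qed.

(** The term [e] keeps the scaling factor positive when [lip Z a] is 0. *)
Lemma lip_bounded_scale (Z : qcms KA KB) (a : Z) (e : R) :
  lip_bounded (lip_dom Z) (lip Z) k -> lip_dom Z a -> 0 < e ->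
  exists t : R, rnorm (a - t%:S) <= k * (lip Z a + e).
Proof.
move=> BZ da e0; have LZ := lip_real_seminorm Z.
have l0 : 0 < lip Z a + e by rewrite ltr_wpDl ?(rs_ge0 LZ).
set l := _ + e in l0 *.
have [||t ta] := BZ ((l^-1)%:C *: a).
- exact: (rs_scale LZ).
- rewrite (rs_scaleL LZ)// gtr0_norm ?invr_gt0// mulrC ler_pdivrMr// mul1r.
  by rewrite lerDl ltW.
exists (l * t).
have -> : a - (l * t)%:S = l%:C *: ((l^-1)%:C *: a - t%:S).
  by rewrite scalerBr scalerA -rmorphM /= mulfV ?gt_eqF// scale1r alg_scale.
by rewrite rnormZr gtr0_norm// mulrC ler_wpM2r// ltW.
Qed.

(** The value 1 of [T] at the pair of units gives [gl_sep]. An element [a] is matched with a scalar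
    [t], of seminorm 0, because [a T - T t = (a - t) T] has norm at most [|a - t|]; so [k] has to
    bound the Lipschitz balls of both spaces modulo scalars. *)
Lemma state_gluing : gluing state_gap.
Proof.
have ki : 0 <= k^-1 by rewrite invr_ge0 ltW.
have LX := lip_real_seminorm X; have LY := lip_real_seminorm Y.
split; rewrite /state_gap.
- by move=> a b; rewrite mulr_ge0// state_form_norm_ge0.
- move=> a a' b b'; rewrite -mulrDr ler_wpM2l//;
    apply: state_form_norm_le => x y x1 y1.
  rewrite (_ : E _ _ x y = E a b x y + E a' b' x y).
    by rewrite (le_trans (cnormD _ _))// lerD// state_form_norm_ub.
  rewrite /state_form [x * _]mulrDr [_ * y]mulrDl (stateD sp) (stateD sq).
  by ring.
- move=> c a b; rewrite mulrCA; congr (_ * _).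
  have EZ (d : R[i]) a' b' x y : E (d *: a') (d *: b') x y = d * E a' b' x y.
    rewrite /state_form -scalerAl -scalerAr (stateZ sp) (stateZ sq).
    by ring.
  have SZ (d : R[i]) a' b' : S (d *: a') (d *: b') <= rnorm d * S a' b'.
    apply: state_form_norm_le => x y x1 y1.
    by rewrite EZ cnormM ler_wpM2l ?cnorm_ge0// state_form_norm_ub.
  apply/le_anti; rewrite SZ/=.
  have [->|c0] := eqVneq c 0; first by rewrite cnorm0 mul0r state_form_norm_ge0.
  have nc0 : 0 < rnorm c.
    rewrite lt_def cnorm_ge0 andbT; apply/eqP => /cnorm_eq0/eqP.
    by rewrite (negbTE c0).
  rewrite -ler_pdivlMl//.
  have := SZ c^-1 (c *: a) (c *: b); rewrite !scalerA mulVf// !scale1r.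
  have -> // : rnorm c^-1 = (rnorm c)^-1.
  by apply: complexI; rewrite fmorphV /= !cnormE normfV.
- apply/eqP; rewrite mulf_eq0; apply/orP; right; apply/eqP/le_anti.
  rewrite state_form_norm_ge0 andbT; apply: state_form_norm_le => x y _ _.
  by rewrite /state_form mulr1 mul1r subrr cnorm0.
- rewrite mulr_gt0 ?invr_gt0//; apply: (@lt_le_trans _ _ 1) => //.
  have := @state_form_norm_ub 1 0 1 1; rewrite !rnorm1 => /(_ (lexx _) (lexx _)).
  rewrite /state_form mul0r mul1r (state1 sp) (state1 sq) (state0 sq) mulr0 subr0.
  by rewrite mulr1 (_ : (1 : R[i]) = (1 : R)%:C)// cnorm_real normr1.
- move=> a a' b b'; rewrite mulrCA -mulrA -mulrDr ler_wpM2l//.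
  apply: state_form_norm_le => x y x1 y1.
  rewrite (_ : E _ _ x y = E a' b' (x * a) y + E a b x (b' * y)); last first.
    by rewrite /state_form !mulrA addrA subrK.
  rewrite (le_trans (cnormD _ _))//; apply: lerD.
    rewrite (le_trans (state_form_norm_bound _ _ _ _))// mulrC ler_wpM2r
      ?state_form_norm_ge0//.
    rewrite -[leRHS]mulr1 ler_pM ?rnorm_ge0// (le_trans (rnormM _ _))//.
    by rewrite -[leRHS]mul1r ler_wpM2r ?rnorm_ge0.
  rewrite (le_trans (state_form_norm_bound _ _ _ _))// ler_wpM2l
    ?state_form_norm_ge0//.
  rewrite -[leRHS]mul1r ler_pM ?rnorm_ge0// (le_trans (rnormM _ _))//.
  by rewrite -[leRHS]mulr1 ler_wpM2l ?rnorm_ge0.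
- move=> a a' b b' aa' a'a bb' b'b; rewrite mulrCA ler_wpM2l//.
  apply: state_form_norm_le => x y x1 y1.
  rewrite (_ : E _ _ x y = - E a b (x * a') (b' * y)); last first.
    rewrite /state_form -mulrA a'a mulr1 mulrA bb' mul1r; ring.
  rewrite cnormN (le_trans (state_form_norm_bound _ _ _ _))// mulrC.
  rewrite ler_wpM2r ?state_form_norm_ge0// ler_pM ?rnorm_ge0// (le_trans (rnormM
    _ _))//.
    by rewrite -[leRHS]mul1r ler_wpM2r ?rnorm_ge0.
  by rewrite -[leRHS]mulr1 ler_wpM2l ?rnorm_ge0.
- exists k^-1 => // a b; rewrite ler_wpM2l//;
    apply: state_form_norm_le => x y x1 y1.
  rewrite (le_trans (state_form_le a b x y))// -[leRHS]mulr1.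
  rewrite ler_wpM2l ?addr_ge0 ?rnorm_ge0// -[leRHS]mulr1.
  by rewrite ler_pM ?rnorm_ge0.
- move=> a e da e0; have [t ta] := lip_bounded_scale BX da e0.
  exists t%:S; split; first exact: (dom_alg LY).
    by rewrite (L_alg LY) addr_ge0 ?(rs_ge0 LX)// ltW.
  apply: state_gap_le; apply: le_trans ta; apply: state_form_norm_le => x y x1 y1.
  rewrite (_ : E _ _ x y = E (a - t%:S) 0 x y).
    rewrite (le_trans (state_form_le _ _ x y))// rnorm0 addr0 -[leRHS]mulr1.
    rewrite ler_wpM2l ?rnorm_ge0// -[leRHS]mulr1.
    by rewrite ler_pM ?rnorm_ge0.
  rewrite /state_form mulrBr mulr_algr mulr_algl mul0r (stateB sp) (stateZ sp).
  rewrite (stateZ sq) (state0 sq); move: t%:C => u; ring.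
- move=> b e db e0; have [t tb] := lip_bounded_scale BY db e0.
  exists t%:S; split; first exact: (dom_alg LX).
    by rewrite (L_alg LX) addr_ge0 ?(rs_ge0 LY)// ltW.
  apply: state_gap_le; apply: le_trans tb; apply: state_form_norm_le => x y x1 y1.
  rewrite (_ : E _ _ x y = E 0 (b - t%:S) x y).
    rewrite (le_trans (state_form_le _ _ x y))// rnorm0 add0r -[leRHS]mulr1.
    rewrite ler_wpM2l ?rnorm_ge0// -[leRHS]mulr1.
    by rewrite ler_pM ?rnorm_ge0.
  rewrite /state_form mulrBl mulr_algr mulr_algl mulr0 (stateB sq) (stateZ sp).
  rewrite (stateZ sq) (state0 sp); move: t%:C => u; ring.
Qed.

End StateGluing.

Lemma propinquity_fin {R : realType} {KA KB : R} (hKA : 1 <= KA) (hKB : 0 <= KB)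
    (C : R) (X Y : qcms KA KB) : 1 <= C ->
  strongly_leibniz C X -> strongly_leibniz C Y -> (propinquity C X Y < +oo)%E.
Proof.
move=> C1 sX sY.
have [D1 D10 B1] := qcms_lip_bounded X; have [D2 D20 B2] := qcms_lip_bounded Y.
have [phi sp] := @state_exists R X; have [psi sq] := @state_exists R Y.
pose k := Num.max D1 D2; have k0 : 0 < k by rewrite lt_max D10.
have BX : lip_bounded (lip_dom X) (lip X) k.
  by move=> a da La; have [t ta] := B1 a da La; exists t; rewrite le_max ta.
have BY : lip_bounded (lip_dom Y) (lip Y) k.
  by move=> a da La; have [t ta] := B2 a da La; exists t; rewrite le_max ta orbT.
pose gN := state_gluing sp sq k0 BX BY.
pose t := Tunnel (glue_fst_isometry hKA hKB gN) (glue_snd_isometry hKA hKB gN).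
apply: le_lt_trans (extent_fin t); apply: propinquity_le_extent.
exact: glue_strongly_leibniz.
Qed.

(** * Coincidence *)

Lemma lrmorphism_of_fun {R : realType} {A B : cstarAlgType R} (f : A -> B) :
  linear f -> monoid_morphism f -> exists F : {lrmorphism A ->
    B}, forall a, F a = f a.
Proof.
move=> lf mf.
pose F : {lrmorphism A -> B} := HB.pack f
  (GRing.isLinear.Build R[i] A B _ f lf) (GRing.isMonoidMorphism.Build A B f mf).
by exists F.
Qed.

(** [d] is self-adjoint, so its norm is detected by states, and after scaling [d] into the unit ball
    of [lip D] each state is within [l e] of a pullback along [f]. *)
Lemma reach_norm {R : realType} {KA KB : R} (D X : qcms KA KB)
    (f : {lrmorphism D -> X}) (e l : R) (d : D) : reach f e ->
  lip_dom D d -> lip D d <= l -> 0 < l -> rnorm d <= rnorm (f d) + l * e.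
Proof.
move=> rf dd Ld l0; have LD := lip_real_seminorm D.
apply: rnorm_le_states; first exact: (rs_sa LD).
move=> phi sp; have [psi sq h] := rf phi sp.
have := h ((l^-1)%:C *: d) (rs_scale LD _ dd).
rewrite (rs_scaleL LD)// gtr0_norm ?invr_gt0// mulrC ler_pdivrMr// mul1r => /(_ Ld).
have -> : f ((l^-1)%:C *: d) = (l^-1)%:C *: f d by rewrite linearZ.
rewrite (stateZ sp) (stateZ sq) -mulrBr cnormM cnorm_real gtr0_norm ?invr_gt0//.
rewrite mulrC ler_pdivrMr// [e * _]mulrC => {}h.
have := state_le_norm sq (f d); have := cnormD (psi (f d)) (phi d - psi (f d)).
by rewrite addrC subrK; move: h; lra.
Qed.

Lemma mul_near {R : realType} (A : cstarAlgType R) (a b x y : A) (e : R)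
  : 0 < e -> e <= 1 ->
  rnorm (a - x) < e -> rnorm (b - y) < e ->
  rnorm (a * b - x * y) < e * (rnorm x + rnorm y + 1).
Proof.
move=> e0 e1 ax yb.
rewrite (_ : _ - _ = (a - x) * (b - y) + (x * (b - y) + (a - x) * y));
  last by ncring.
rewrite (le_lt_trans (rnormD _ _))//.
rewrite (le_lt_trans (lerD (rnormM _ _) (rnormD _ _)))//.
have h1 : rnorm (a - x) * rnorm (b - y) < e * 1.
  by rewrite ltr_pM ?rnorm_ge0// (lt_le_trans yb).
have h2 : rnorm (x * (b - y)) <= e * rnorm x.
  by rewrite (le_trans (rnormM _ _))// mulrC ler_wpM2r ?rnorm_ge0// ltW.
have h3 : rnorm ((a - x) * y) <= e * rnorm y.
  by rewrite (le_trans (rnormM _ _))// ler_wpM2r ?rnorm_ge0// ltW.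
by move: h1 h2 h3; lra.
Qed.

(** * Elements of bounded seminorm and norm *)

Definition tame {R : realType} {KA KB : R} (Z : qcms KA KB) (l : R) (a : Z) :=
  [/\ lip_dom Z a, lip Z a <= l & rnorm a <= l].

(** The seminorm concerns self-adjoint elements only, so a bound on an arbitrary element is put on
    its two parts. Products remain controlled because [a b] is [jordan a b + i lie a b]. *)
Definition ctame {R : realType} {KA KB : R} (Z : qcms KA KB) (l : R) (d : Z) :=
  exists d1 d2, [/\ tame l d1, tame l d2 & d = d1 + 'i *: d2].

Section Tame.
Context {R : realType} {KA KB : R} (hKA : 1 <= KA) (hKB : 0 <= KB) {Z : qcms KA KB}.
Let LZ := lip_real_seminorm Z.
Implicit Types (a b d : Z).

Lemma tame_add (l l' : R) a b : tame l a -> tame l' b -> tame (l + l') (a + b).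
Proof.
move=> [da La na] [db Lb nb]; split; first exact: (rs_add LZ).
  by rewrite (le_trans (rs_addL LZ da db))// lerD.
by rewrite (le_trans (rnormD _ _))// lerD.
Qed.

Lemma tame_opp (l : R) a : tame l a -> tame l (- a).
Proof.
by move=> [da La na]; split;
  [exact: (dom_opp LZ)|rewrite (L_opp LZ)|rewrite rnormN].
Qed.

Lemma tame_sub (l l' : R) a b : tame l a -> tame l' b -> tame (l + l') (a - b).
Proof. by move=> ta tb; apply/tame_add/tame_opp. Qed.

Lemma tame_alg (s : R) : tame `|s| (s%:S : Z).
Proof. by split; [exact: (dom_alg LZ)|rewrite (L_alg LZ)|rewrite rnorm_alg]. Qed.

Lemma tame0 (l : R) : 0 <= l -> tame l (0 : Z).
Proof.
move=> l0; rewrite (_ : 0 = (0 : R)%:S); last by rewrite scale0r.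
by split; [exact: (dom_alg LZ)|rewrite (L_alg LZ)|rewrite rnorm_alg normr0].
Qed.

Lemma tame_mono (l l' : R) a : l <= l' -> tame l a -> tame l' a.
Proof. by move=> ll [da La na]; split => //; exact: le_trans ll. Qed.

(** The right-hand side [KA (l l' + l l') + KB l l'] of the Leibniz inequality. Its factor is at
    least 1, so it also bounds the norms of the brackets. *)
Definition bracket_bound (l l' : R) := (2 * KA + KB) * (l * l').

Lemma bracket_factor_ge1 : 1 <= 2 * KA + KB.
Proof. by move: hKA hKB; lra. Qed.

Lemma tame_bracket (l l' : R) a b : tame l a -> tame l' b ->
  tame (bracket_bound l l') (jordan a b) /\ tame (bracket_bound l l') (lie a b).
Proof.
move=> [da La na] [db Lb nb].
have La0 := rs_ge0 LZ da; have Lb0 := rs_ge0 LZ db.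
have l0 : 0 <= l by exact: le_trans La0 La.
have l'0 : 0 <= l' by exact: le_trans Lb0 Lb.
have bound : KA * (lip Z a * rnorm b + rnorm a * lip Z b) +
    KB * (lip Z a * lip Z b) <= bracket_bound l l'.
  have := leibniz_bound_mono hKA hKB La0 Lb0 (rnorm_ge0 a) (rnorm_ge0 b)
    La Lb na nb.
  by move=> /le_trans; apply; rewrite /bracket_bound; lra.
have := L_leibniz (lipP Z) da db; rewrite ge_max => /andP[j1 j2].
have ll : l * l' <= bracket_bound l l'.
  by rewrite /bracket_bound ler_peMl ?mulr_ge0// bracket_factor_ge1.
have nab : rnorm (a * b) <= l * l'.
  by rewrite (le_trans (rnormM _ _))// ler_pM ?rnorm_ge0.
have nba : rnorm (b * a) <= l * l'.
  by rewrite (le_trans (rnormM _ _))// mulrC ler_pM ?rnorm_ge0.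
split; split.
- exact: (dom_jordan (lipP Z)).
- exact: le_trans j1 bound.
- apply: le_trans ll; rewrite /jordan rnormZ [complex.Re _]cnorm_half.
  by rewrite mulrC ler_pdivrMr// (le_trans (rnormD _ _))//; move: nab nba; lra.
- exact: (dom_lie (lipP Z)).
- exact: le_trans j2 bound.
- apply: le_trans ll; rewrite /lie rnormZ [complex.Re _]cnorm_half_i.
  by rewrite mulrC ler_pdivrMr// (le_trans (rnormB _ _))//; move: nab nba; lra.
Qed.

Lemma mul_jordan_lie a b : a * b = jordan a b + 'i *: lie a b.
Proof.
have i0 : 'i != 0 :> R[i] by exact: neq0Ci.
rewrite /jordan /lie scalerA invfM mulrCA mulfV// mulr1 -scalerDr.
rewrite addrACA subrr addr0 scalerDr -scalerDl.
by rewrite (_ : 2^-1 + 2^-1 = 1 :> R[i]) ?scale1r//; field.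
Qed.

Lemma ctame_add (l l' : R) a b : ctame l a -> ctame l' b -> ctame (l + l') (a + b).
Proof.
move=> [a1 [a2 [t1 t2 ->]]] [b1 [b2 [t1' t2' ->]]].
exists (a1 + b1), (a2 + b2); split; [exact: tame_add|exact: tame_add|].
by rewrite scalerDr; zmod.
Qed.

Lemma ctame_opp (l : R) a : ctame l a -> ctame l (- a).
Proof.
move=> [a1 [a2 [t1 t2 ->]]]; exists (- a1), (- a2).
by split; [exact: tame_opp|exact: tame_opp|rewrite opprD scalerN].
Qed.

Lemma ctame_sub (l l' : R) a b : ctame l a -> ctame l' b -> ctame (l + l') (a - b).
Proof. by move=> ta tb; apply/ctame_add/ctame_opp. Qed.

Lemma ctame_star (l : R) a : ctame l a -> ctame l (star a).
Proof.
move=> [a1 [a2 [t1 t2 ->]]]; exists a1, (- a2); split => //; first exact: tame_opp.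
have [[/(rs_sa LZ) s1 _ _] [/(rs_sa LZ) s2 _ _]] := (t1, t2).
by rewrite starD (starZ 'i) conjCi s1 s2 scalerN scaleNr.
Qed.

Lemma ctame_alg (c : R[i]) :
  ctame (`|complex.Re c| + `|complex.Im c|) (c%:A : Z).
Proof.
exists (complex.Re c)%:S, (complex.Im c)%:S; split.
- by apply: tame_mono (tame_alg _); rewrite lerDl.
- by apply: tame_mono (tame_alg _); rewrite lerDr.
- by rewrite {1}(complexi c) scalerDl scalerA.
Qed.

Lemma ctame_mul (l l' : R) a b : ctame l a -> ctame l' b ->
  ctame (bracket_bound l l' + bracket_bound l l' + (bracket_bound l l' +
    bracket_bound l l')) (a * b).
Proof.
move=> [a1 [a2 [t1 t2 ->]]] [b1 [b2 [t1' t2' ->]]].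
have [j11 l11] := tame_bracket t1 t1'; have [j12 l12] := tame_bracket t1 t2'.
have [j21 l21] := tame_bracket t2 t1'; have [j22 l22] := tame_bracket t2 t2'.
exists (jordan a1 b1 - jordan a2 b2 - (lie a1 b2 + lie a2 b1)).
exists (lie a1 b1 - lie a2 b2 + (jordan a1 b2 + jordan a2 b1)).
split.
- by apply: tame_sub; [exact: tame_sub|exact: tame_add].
- by apply: tame_add; [exact: tame_sub|exact: tame_add].
rewrite mulrDl !mulrDr -!scalerAl -!scalerAr !mul_jordan_lie.
move: (jordan a1 b1) (jordan a1 b2) (jordan a2 b1) (jordan a2 b2).
move: (lie a1 b1) (lie a1 b2) (lie a2 b1) (lie a2 b2) => *.
rewrite !(scalerDr, scalerN, scalerA) -!expr2 sqrCi !scaleN1r.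
rewrite mulN1r scaleNr.
by zmod.
Qed.

End Tame.

Arguments bracket_bound {R} KA KB l l'.

(** * The limit of a sequence of tunnels along an ultrafilter *)

Section Limit.
Context {R : realType} {KA KB : R} (hKA : 1 <= KA) (hKB : 0 <= KB)
  {X Y : qcms KA KB} (t : nat -> tunnel X Y)
  (r1 : forall n, reach (tun_pi1 (t n)) n.+1%:R^-1)
  (U : set_system nat) (UU : UltraFilter U) (Uoo : \oo `<=` U).
Local Notation D n := (tun_space (t n)).
Local Notation p n := (tun_pi1 (t n)).
Local Notation q n := (tun_pi2 (t n)).
Let LX := lip_real_seminorm X.
Let LY := lip_real_seminorm Y.
Let LD n := lip_real_seminorm (D n).

Lemma near_eps (e : R) : 0 < e -> U [set n | n.+1%:R^-1 < e].
Proof. by move=> e0; apply: Uoo; exact: near_infty_natSinv_lt (PosNum e0). Qed.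

(* [x] and [y] are the limits along [U] of the images of a sequence of elements of
   the tunnels whose Lipschitz seminorms and norms are bounded. *)
Definition limit_rel (x : X) (y : Y) :=
  forall e : R, 0 < e -> exists2 l : R, 0 < l &
  U [set n | exists d : D n, [/\ ctame l d, rnorm (p n d - x)
    < e & rnorm (q n d - y) < e]].


(** The comparison passes through the tunnel: [reach_norm] bounds each self-adjoint part of [d] by
    its image in [X], and [q n] is contractive. The factor 2 counts the two parts. *)
Lemma ctame_norm n (l : R) (d : D n) : 0 < l -> ctame l d ->
  rnorm (q n d) <= 2 * rnorm (p n d) + 2 * (l * n.+1%:R^-1).
Proof.
move=> l0 [d1 [d2 [[dd1 L1 _] [dd2 L2 _] dE]]].
have [s1 s2] := (rs_sa (LD n) dd1, rs_sa (LD n) dd2).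
have sp := star_pi1 (t n).
have pdE : p n d = p n d1 + 'i *: p n d2 by rewrite dE rmorphD /= linearZ.
have c1 : cre (p n d) = p n d1.
  by rewrite pdE cre_unique//; exact: (star_morphism_sa sp).
have c2 : cim (p n d) = p n d2.
  by rewrite pdE cim_unique//; exact: (star_morphism_sa sp).
have h1 := reach_norm (@r1 n) dd1 L1 l0; have h2 := reach_norm (@r1 n) dd2 L2 l0.
have := rnorm_cre (p n d); have := rnorm_cim (p n d); rewrite c1 c2 => g2 g1.
rewrite (le_trans (star_morphism_contractive (star_pi2 (t n)) d))//.
rewrite {1}dE (le_trans (rnormD _ _))// rnormZi.
by move: h1 h2 g1 g2; move: (l / _) => r; lra.
Qed.

(** The finite constant has two uses: it makes the relation single-valued, and it turns convergence
    in [X] into a Cauchy condition in [Y]. *)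
Lemma limit_rel_lip x y x' y' : limit_rel x y -> limit_rel x' y' ->
  rnorm (y - y') <= 2 * rnorm (x - x').
Proof.
move=> rxy rxy'; apply/ler_addgt0Pr => e' e'0.
(* The errors are [2 e] in [X], doubled by [ctame_norm], then [2 e] from the reach and [2 e] in
   [Y]. *)
pose e := e' / 8; have e0 : 0 < e by rewrite divr_gt0.
have [l l0 Ul] := rxy e e0; have [l' l'0 Ul'] := rxy' e e0.
have ll0 : 0 < l + l' by rewrite addr_gt0.
have [n [[[d [td d1 d2]] [d' [td' d1' d2']]] neps]] :=
  filter_ex (filterI (filterI Ul Ul') (near_eps (divr_gt0 e0 ll0))).
have := ctame_norm ll0 (ctame_sub td td').
have nl : (l + l') * n.+1%:R^-1 <= e by rewrite mulrC -ler_pdivlMr// ltW.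
have -> : q n (d - d') = q n d - q n d' by rewrite rmorphB.
have -> : p n (d - d') = p n d - p n d' by rewrite rmorphB.
have e1 : rnorm (p n d - p n d') <= rnorm (x - x') + 2 * e.
  rewrite (_ : _ - _ = (p n d - x) - (p n d' - x') + (x - x')); last by zmod.
  rewrite (le_trans (rnormD _ _))//.
  by have := rnormB (p n d - x) (p n d' - x'); move: d1 d1'; lra.
have e2 : rnorm (y - y') <= rnorm (q n d - q n d') + 2 * e.
  rewrite (_ : y - y' = (q n d - q n d') - ((q n d - y) - (q n d' - y')));
    last by zmod.
  rewrite (le_trans (rnormB _ _))//.
  by have := rnormB (q n d - y) (q n d' - y'); move: d2 d2'; lra.
by move: e1 e2 nl; rewrite /e; move: (_ / n.+1%:R) => r; lra.
Qed.

Lemma limit_rel_uniq x y y' : limit_rel x y -> limit_rel x y' -> y = y'.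
Proof.
move=> h h'; apply/subr0_eq/rnorm_eq0/le_anti; rewrite rnorm_ge0 andbT.
by have := limit_rel_lip h h'; rewrite subrr rnorm0 mulr0.
Qed.

Lemma limit_rel_add x y x' y' : limit_rel x y -> limit_rel x' y' ->
  limit_rel (x + x') (y + y').
Proof.
move=> h h' e e0; have e2 : 0 < e / 2 by rewrite divr_gt0.
have [l l0 Ul] := h _ e2; have [l' l'0 Ul'] := h' _ e2.
exists (l + l'); first by rewrite addr_gt0.
apply: filterS2 Ul Ul' => n [d [td d1 d2]] [d' [td' d1' d2']].
exists (d + d'); split; first exact: ctame_add.
  rewrite rmorphD /= opprD addrACA (le_lt_trans (rnormD _ _))// (splitr e).
  exact: ltrD.
rewrite rmorphD /= opprD addrACA (le_lt_trans (rnormD _ _))// (splitr e).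
exact: ltrD.
Qed.

Lemma limit_rel_mul x y x' y' : limit_rel x y -> limit_rel x' y' ->
  limit_rel (x * x') (y * y').
Proof.
move=> h h' e e0.
pose K := rnorm x + rnorm x' + (rnorm y + rnorm y') + 1.
have K0 : 0 < K by rewrite ltr_wpDl// !addr_ge0 ?rnorm_ge0.
pose d := Num.min 1 (e / K).
have d0 : 0 < d by rewrite lt_min ltr01 divr_gt0.
have d1 : d <= 1 by rewrite ge_min lexx.
have dK : d * K <= e by rewrite -ler_pdivlMr// ge_min lexx orbT.
have [l l0 Ul] := h _ d0; have [l' l'0 Ul'] := h' _ d0.
have b0 : 0 < bracket_bound KA KB l l'.
  by rewrite !mulr_gt0// (lt_le_trans ltr01)// bracket_factor_ge1.
exists (bracket_bound KA KB l l' + bracket_bound KA KB l l' + (bracket_bound KA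
  KB l l' + bracket_bound KA KB l l')).
  by rewrite !addr_gt0.
have nx := rnorm_ge0 x; have nx' := rnorm_ge0 x'.
have ny := rnorm_ge0 y; have ny' := rnorm_ge0 y'.
apply: filterS2 Ul Ul' => n [a [ta a1 a2]] [b [tb b1 b2]].
exists (a * b); split; first exact: ctame_mul.
  rewrite rmorphM /=; apply: lt_le_trans (mul_near d0 d1 a1 b1) _.
  by rewrite (le_trans _ dK)// ler_wpM2l ?(ltW d0)// /K; lra.
rewrite rmorphM /=; apply: lt_le_trans (mul_near d0 d1 a2 b2) _.
by rewrite (le_trans _ dK)// ler_wpM2l ?(ltW d0)// /K; lra.
Qed.

Lemma limit_rel_star x y : limit_rel x y -> limit_rel (star x) (star y).
Proof.
move=> h e e0; have [l l0 Ul] := h e e0; exists l => //.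
apply: filterS Ul => n [d [td d1 d2]]; exists (star d); split.
- exact: ctame_star.
- by rewrite (star_pi1 (t n)) -starB rnorm_star.
- by rewrite (star_pi2 (t n)) -starB rnorm_star.
Qed.

Lemma limit_rel_alg (c : R[i]) : limit_rel c%:A c%:A.
Proof.
move=> e e0; exists (`|complex.Re c| + `|complex.Im c| + 1).
  by rewrite ltr_wpDl// addr_ge0.
apply: filterE => n; exists c%:A; split.
- have [d1 [d2 [t1 t2 E]]] := @ctame_alg R KA KB (D n) c.
  by exists d1, d2; split => //; [apply: tame_mono t1|apply: tame_mono t2];
    rewrite lerDl.
- by rewrite linearZ /= rmorph1 subrr rnorm0.
- by rewrite linearZ /= rmorph1 subrr rnorm0.
Qed.

Lemma limit_rel_scale (c : R[i]) x y : limit_rel x y -> limit_rel (c *: x) (c *: y).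
Proof.
by move=> h; rewrite -[x]mul1r -[y]mul1r !scalerAl;
  exact: limit_rel_mul (limit_rel_alg c) h.
Qed.

(** Lifts of [a] with seminorms at most [lip X a + 1/(n+1)] have bounded norms by [reach_norm].
    Their images in [Y] stay in a compact ball and converge along [U]; since the balls of [lip] are
    closed, the limit keeps the bound [lip X a]. *)
Lemma limit_rel_dom a : lip_dom X a ->
  exists b, [/\ limit_rel a b, lip_dom Y b & lip Y b <= lip X a].
Proof.
move=> da; have La0 := rs_ge0 LX da.
have lift n : exists d : D n, [/\ lip_dom (D n) d, p n d = a &
    lip (D n) d <= lip X a + n.+1%:R^-1].
  by apply: (quantum_isometry_sublift (tun_pi1P (t n)) da); rewrite invr_gt0.
pose d n := sval (cid (lift n)).
have dP n : [/\ lip_dom (D n) (d n), p n (d n) = a &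
    lip (D n) (d n) <= lip X a + n.+1%:R^-1] by rewrite /d; case: cid.
pose l := lip X a + 1; have l0 : 0 < l by rewrite ltr_wpDl.
have eps1 n : n.+1%:R^-1 <= 1 :> R by rewrite invf_le1// ler1n.
have Ld n : lip (D n) (d n) <= l.
  by case: (dP n) => _ _ h; rewrite (le_trans h)// /l lerD2l.
have nd n : rnorm (d n) <= rnorm a + l.
  have [dd pd _] := dP n; have := reach_norm (@r1 n) dd (Ld n) l0; rewrite pd.
  move=> /le_trans; apply; rewrite lerD2l -[leRHS]mulr1 ler_wpM2l// ltW//.
pose b n := q n (d n).
have db n : lip_dom Y (b n).
  by have [dd _ _] := dP n; case: (tun_pi2P (t n)) => _ _ dq _; exact: dq.
have Lb n : lip Y (b n) <= lip (D n) (d n).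
  by have [dd _ _] := dP n; exact: (quantum_isometry_lip_le (tun_pi2P (t n)) dd).
have nb n : rnorm (b n) <= rnorm a + l.
  by rewrite (le_trans (star_morphism_contractive (star_pi2 (t n)) _)).
(* Rescaled into the ball of seminorm at most 1, for which compactness is known. *)
pose b' n : Y := (l^-1)%:C *: b n.
have UF : UltraFilter (b' @ U) by exact: ultra_fmap.
have [|c _ cP] := @qcms_lip_compact R KA KB Y (l^-1 * (rnorm a + l)) (b' @ U) UF.
  change (U [set n | lip_ball (lip_dom Y) (lip Y) (l^-1 * (rnorm a + l)) (b' n)]).
  apply: filterE => n; split; first exact: (rs_scale LY).
    rewrite (rs_scaleL LY)// gtr0_norm ?invr_gt0// mulrC ler_pdivrMr// mul1r.
    exact: le_trans (Lb n) (Ld n).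
  by rewrite rnormZr gtr0_norm ?invr_gt0// ler_wpM2l// invr_ge0 ltW.
pose c' := l%:C *: c.
have c'P (e : R) : 0 < e -> U [set n | rnorm (c' - b n) < e].
  move=> e0; have : U [set n | rnorm (c - b' n) < e / l] by apply: cP;
    rewrite divr_gt0.
  apply: filterS => n /=; rewrite ltr_pdivlMr// => h.
  have -> : c' - b n = l%:C *: (c - b' n).
    by rewrite scalerBr scalerA -rmorphM /= mulfV ?gt_eqF// scale1r.
  by rewrite rnormZr gtr0_norm// mulrC.
have lipc (e : R) : 0 < e -> lip_dom Y c' /\ lip Y c' <= lip X a + e.
  move=> e0; apply: lip_closed_ball; first by rewrite ltr_wpDl.
  move=> r r0; have [n [h1 h2]] := filter_ex (filterI (near_eps e0) (c'P r r0)).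
  exists (b n) => //; split => //; rewrite (le_trans (Lb n))//.
  by case: (dP n) => _ _ h; rewrite (le_trans h)// lerD2l ltW.
exists c'; split.
- move=> e e0; exists (rnorm a + l + l);
    first by rewrite ltr_wpDl// addr_ge0 ?rnorm_ge0// ltW.
  apply: filterS (c'P e e0) => n /= h; have [dd pd _] := dP n.
  exists (d n); split; last by rewrite rnorm_distC.
  + exists (d n), 0; split; last by rewrite scaler0 addr0.
    * split => //; last by rewrite (le_trans (nd n))// lerDl ltW.
      by rewrite (le_trans (Ld n))// lerDr addr_ge0 ?rnorm_ge0// ltW.
    * by apply: tame0; rewrite !addr_ge0 ?rnorm_ge0// ltW.
  + by rewrite pd subrr rnorm0.
- by have [] := lipc 1 ltr01.
- by apply/ler_addgt0Pr => e /lipc[].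
Qed.

(** It holds because [l] may depend on [e] in [limit_rel]; a uniform bound would confine the
    relation to elements with Lipschitz parts. *)
Lemma limit_rel_closed x y :
  (forall e : R, 0 < e -> exists x', exists2 y', limit_rel x' y' &
    rnorm (x' - x) < e /\ rnorm (y' - y) < e) -> limit_rel x y.
Proof.
move=> ap e e0; have e2 : 0 < e / 2 by rewrite divr_gt0.
have [x' [y' rxy [xx yy]]] := ap _ e2; have [l l0 Ul] := rxy _ e2; exists l => //.
apply: filterS Ul => n [d [td d1 d2]]; exists d; split => //.
  by rewrite (le_lt_trans (rnorm_distD x' _ _))// (splitr e) ltrD.
by rewrite (le_lt_trans (rnorm_distD y' _ _))// (splitr e) ltrD.
Qed.

Lemma limit_rel_dense x (e : R) : 0 < e ->
  exists x', exists2 y', limit_rel x' y' & rnorm (x' - x) < e.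
Proof.
move=> e0; have e2 : 0 < e / 2 by rewrite divr_gt0.
have dense h : self_adjoint X h -> exists2 u, lip_dom X u & rnorm (h - u) < e / 2.
  by move=> sh; have /closure_rnorm := rs_dense LX sh; exact.
have [u du hu] := dense _ (sa_cre x); have [v dv hv] := dense _ (sa_cim x).
have [u' [ru _ _]] := limit_rel_dom du; have [v' [rv _ _]] := limit_rel_dom dv.
exists (u + 'i *: v), (u' + 'i *: v').
  by apply: limit_rel_add => //; exact: limit_rel_scale.
rewrite rnorm_distC -{1}(cre_cim x) opprD addrACA -scalerBr.
by rewrite (le_lt_trans (rnormD _ _))// rnormZi (splitr e) ltrD.
Qed.

(** Elements near [x] that have a partner exist by density, and [limit_rel_lip] makes these partners
    a Cauchy filter in the complete algebra [Y]. *)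
Lemma limit_rel_total x : exists y, limit_rel x y.
Proof.
pose B (e : R) := [set y' | exists2 x', limit_rel x' y' & rnorm (x' - x) < e].
pose G := filter_from [set e : R | 0 < e] B.
have PG : ProperFilter G.
  apply: filter_from_proper; last first.
    by move=> e /= e0; have [x' [y' r xx]] := limit_rel_dense x e0; exists y', x'.
  apply: filter_from_filter; first by exists 1 => /=.
  move=> e1 e2 /= e10 e20; exists (Num.min e1 e2); first by rewrite /= lt_min e10.
  by move=> y' [x' r]; rewrite lt_min => /andP[h1 h2]; split; exists x'.
have [|y yP] := @cvg_filter_rnorm R Y G PG.
  (* Two elements within [e / 5] of [x] have partners at distance less than [4 e / 5], because of
     the constant 2. *)
  move=> e e0; have e5 : 0 < e / 5 by rewrite divr_gt0.
  have [x0 [y0 r0 xx0]] := limit_rel_dense x e5; exists y0.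
  exists (e / 5) => // y' [x' r' xx'] /=.
  rewrite (le_lt_trans (limit_rel_lip r0 r'))//.
  have := rnorm_distD x x0 x'; rewrite [rnorm (x - x')]rnorm_distC.
  by move: xx0 xx'; lra.
exists y; apply: limit_rel_closed => e e0.
have GB : G (B e) by exists e.
have [y' [[x' r' xx'] yy']] := filter_ex (filterI GB (yP e e0)).
by exists x', y' => //; split => //; rewrite rnorm_distC.
Qed.

(** Each algebraic identity follows from uniqueness, both of its sides being partners of the same
    element. *)
Lemma limit_morphism : exists f : {lrmorphism X -> Y},
  [/\ star_morphism f, (forall x, limit_rel x (f x)) &
    forall x, lip_dom X x -> lip_dom Y (f x) /\ lip Y (f x) <= lip X x].
Proof.
have [f fP] := choice limit_rel_total.
have lf : linear f.
  move=> c a b; apply: limit_rel_uniq (fP _) _.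
  by apply: limit_rel_add => //; exact: limit_rel_scale.
have mf : monoid_morphism f.
  split; last by move=> a b;
    apply: limit_rel_uniq (fP _) (limit_rel_mul (fP a) (fP b)).
  by apply: limit_rel_uniq (fP _) _; have := limit_rel_alg 1; rewrite !scale1r.
have [F FE] := lrmorphism_of_fun lf mf.
exists F; split=> [x|x|x dx].
- by rewrite !FE; exact: limit_rel_uniq (fP _) (limit_rel_star (fP x)).
- by rewrite FE.
- have [b [rb db Lb]] := limit_rel_dom dx.
  by rewrite FE (limit_rel_uniq (fP x) rb).
Qed.

End Limit.

Lemma limit_rel_swap {R : realType} {KA KB : R} {X Y : qcms KA KB}
    (t : nat -> tunnel X Y) (U : set_system nat) (UU : UltraFilter U) x y :
  limit_rel (fun n => tunnel_swap (t n)) U y x -> limit_rel t U x y.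
Proof.
move=> h e e0; have [l l0 Ul] := h e e0; exists l => //.
by apply: filterS Ul => n [d [td d1 d2]]; exists d.
Qed.

(** The limit relations of the tunnels and of the swapped tunnels are transposes of each other along
    the same ultrafilter, so the two limit morphisms are mutually inverse. Neither increases [lip],
    hence both preserve it. *)
Lemma isometry_of_propinquity0 {R : realType} {KA KB : R} (hKA : 1 <= KA)
    (hKB : 0 <= KB) (C : R) (X Y : qcms KA KB) : propinquity C X Y = 0%E ->
  exists f : {lrmorphism X -> Y}, full_quantum_isometry f.
Proof.
move=> p0.
have tun n : exists t : tunnel X Y, (extent t < (n.+1%:R^-1)%:E)%E.
  have [|t _ h] := @propinquity_lt_tunnel R KA KB C X Y n.+1%:R^-1.
    by rewrite p0 lte_fin invr_gt0.
  by exists t.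
have [t tP] := choice tun.
have r1 n := (extent_reach (tP n)).1; have r2 n := (extent_reach (tP n)).2.
have [U [UU Uoo]] := @ultraFilterLemma nat \oo _.
have [f [sf relf lf]] := limit_morphism hKA hKB r1 UU Uoo.
have [g [sg relg lg]] := limit_morphism hKA hKB
  (t := fun n => tunnel_swap (t n)) r2 UU Uoo.
have fK : cancel f g.
  move=> x; apply: (limit_rel_uniq (t :=
    fun n => tunnel_swap (t n)) r2 UU Uoo (relg (f x))).
  exact: (limit_rel_swap (t := fun n => tunnel_swap (t n)) UU (relf x)).
have gK : cancel g f.
  move=> y; apply: (limit_rel_uniq r1 UU Uoo (relf (g y))).
  exact: (limit_rel_swap UU (relg y)).
exists f; split.
  apply: quantum_isometry_of_lifts => // [y|y e dy e0]; first by exists (g y).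
  have [dg Lg] := lg y dy.
  by exists (g y); split => //; rewrite (le_trans Lg)// lerDl ltW.
exists g; split => //.
apply: quantum_isometry_of_lifts => // [x|x e dx e0]; first by exists (f x).
have [df Lf] := lf x dx.
by exists (f x); split => //; rewrite (le_trans Lf)// lerDl ltW.
Qed.

Theorem lemma2p2 (R : realType) (KA KB : R) (hKA : 1 <= KA) (hKB : 0 <= KB)
    (C : R) (hC : 1 <= C) :
  [/\ (forall X Y : qcms KA KB,
         strongly_leibniz C X -> strongly_leibniz C Y ->
         (0 <= propinquity C X Y < +oo)%E),
      (forall X Y : qcms KA KB,
         strongly_leibniz C X -> strongly_leibniz C Y ->
         propinquity C X Y = propinquity C Y X),
      (forall X Y Z : qcms KA KB,
         strongly_leibniz C X -> strongly_leibniz C Y -> strongly_leibniz C Z ->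
         (propinquity C X Z <= propinquity C X Y + propinquity C Y Z)%E) &
      (forall X Y : qcms KA KB,
         strongly_leibniz C X -> strongly_leibniz C Y ->
         (propinquity C X Y = 0%E <->
          exists f : {lrmorphism X -> Y}, full_quantum_isometry f))].
Proof.
have fin (X Y : qcms KA KB) : strongly_leibniz C X -> strongly_leibniz C Y ->
  (propinquity C X Y < +oo)%E by move=> sX sY; exact: propinquity_fin.
split=> [X Y sX sY|X Y _ _|X Y Z sX sY sZ|X Y sX sY].
- by rewrite propinquity_ge0 fin.
- exact: propinquity_sym.
- exact: (propinquity_triangle hKA hKB hC (fin _ _ sX sY) (fin _ _ sY sZ)).
- split=> [|[f]]; first exact: isometry_of_propinquity0.
  exact: propinquity_isometry.
Qed.
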